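(* Let $\mathcal{S}$ be an operator system and let $\mathcal{D}$ be a unital $C^*$-algebra. If $\mathcal{U}(\mathcal{S})\otimes_{\min}\mathcal{D}=\mathcal{U}(\mathcal{S})\otimes_{\max}\mathcal{D}$, then $\mathcal{S}\otimes_{\min}\mathcal{D}=\mathcal{S}\otimes_c\mathcal{D}$. In particular, if $\mathcal{S}$ is a nuclearity detector, then $\mathcal{U}(\mathcal{S})$ is a nuclearity detector.
   Context: For an operator space $X\subseteq B(\mathcal{H})$, $\mathcal{U}(X) := \left\{\begin{bmatrix}\lambda & x\\ 0&\lambda\end{bmatrix} : \lambda\in\mathbb{C},\ x\in X\right\}\subseteq M_2(B(\mathcal{H}))$, a unital operator algebra, independent of the representation of $X$. Operator algebra tensor products: for approximately unital operator algebras $\mathcal{A}\subseteq B(\mathcal{H})$ and $\mathcal{E}\subseteq B(\mathcal{K})$, $\mathcal{A}\otimes_{\min}\mathcal{E}$ is the completion of $\mathcal{A}\otimes\mathcal{E}$ in the (matrix) norms inherited from $B(\mathcal{H}\otimes\mathcal{K})$. $\mathcal{A}\otimes_{\max}\mathcal{E}$ is the completion in $\|x\|_{\max}=\sup\|\pi\cdot\rho(x)\|$ (similarly for matrix norms), the supremum being over all pairs of completely contractive representations $\pi:\mathcal{A}\to B(\mathcal{H})$, $\rho:\mathcal{E}\to B(\mathcal{H})$ with commuting ranges, where $\pi\cdot\rho(a\otimes b)=\pi(a)\rho(b)$. Equality of the two means the identity on $\mathcal{A}\otimes\mathcal{E}$ extends to a completely isometric isomorphism. Operator system tensor products: $X\in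 M_n(\mathcal{S}\otimes_{\min}\mathcal{T})$ is positive iff $(\varphi\otimes\psi)^{(n)}(X)\geq 0$ for all unital completely positive (ucp) maps $\varphi:\mathcal{S}\to M_k$, $\psi:\mathcal{T}\to M_m$, $k,m\in\mathbb{N}$. $X\in M_n(\mathcal{S}\otimes_c\mathcal{T})$ is positive iff $(\varphi\cdot\psi)^{(n)}(X)\geq0$ for all pairs of ucp maps $\varphi:\mathcal{S}\to B(\mathcal{H})$, $\psi:\mathcal{T}\to B(\mathcal{H})$ with commuting ranges. Equality means that the identity map is a complete order isomorphism. An operator system $\mathcal{S}$ is a nuclearity detector if, whenever $\mathcal{D}$ is a unital $C^*$-algebra with $\mathcal{S}\otimes_{\min}\mathcal{D}=\mathcal{S}\otimes_c\mathcal{D}$, $\mathcal{D}$ is nuclear. The operator algebra $\mathcal{U}(\mathcal{S})$ is a nuclearity detector if, whenever $\mathcal{D}$ is a unital $C^*$-algebra with $\mathcal{U}(\mathcal{S})\otimes_{\min}\mathcal{D}=\mathcal{U}(\mathcal{S})\otimes_{\max}\mathcal{D}$ (operator algebra tensor products), $\mathcal{D}$ is nuclear. *)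

(* Defs.v *)
From HB Require Import structures.
From mathcomp Require Import all_boot all_order all_algebra.
From mathcomp Require Import sesquilinear complex mxtens.
From mathcomp Require Import all_classical all_reals ereal.
Set Implicit Arguments.
Unset Strict Implicit.
Unset Printing Implicit Defensive.
Import Order.TTheory GRing.Theory Num.Theory.
Local Open Scope classical_set_scope.
Local Open Scope ring_scope.
Local Open Scope complex_scope.

(** * Complex Hilbert spaces *)

Definition dot_norm (R : realType) (V : lmodType R[i])
    (ip : {dot V for Num.conj}) (x : V) : R :=
  Num.sqrt (complex.Re (ip x x)).

Section Completeness.
Variables (R : realType) (V : zmodType).

Definition cauchy_for (N : V -> R) (u : nat -> V) : Prop :=
  forall e : R, 0 < e ->
  exists m0, forall m n, (m0 <= m)%N -> (m0 <= n)%N -> N (u m - u n) < e.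

Definition cvg_for (N : V -> R) (u : nat -> V) (l : V) : Prop :=
  forall e : R, 0 < e -> exists m0, forall m, (m0 <= m)%N -> N (u m - l) < e.

Definition complete_for (N : V -> R) : Prop :=
  forall u : nat -> V, cauchy_for N u -> exists l, cvg_for N u l.

End Completeness.

(* The inner product is linear in its first variable and conjugate-linear in
   its second one (this is the convention of [{dot _ for _}]). *)
Record hilbert (R : realType) := Hilbert {
  hilbert_sort :> lmodType R[i];
  ip : {dot hilbert_sort for Num.conj};
  hilbert_complete : complete_for (dot_norm ip)
}.
Arguments ip {R} h.

Definition hnorm (R : realType) (H : hilbert R) (x : H) : R :=
  dot_norm (ip H) x.

(** * The Hilbert space direct sum H^n *)

Section DirectSum.
Variables (R : realType) (n : nat) (H : hilbert R).

Definition hsum_ip (f g : {ffun 'I_n -> H}) : R[i] :=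
  \sum_(i < n) ip H (f i) (g i).

Fact hsum_ip_bilinear :
  bilinear_for ( *%R : GRing.Scale.law R[i] R[i])
    (Num.conj \; *%R : GRing.Scale.law R[i] R[i]) hsum_ip.
Proof.
split=> [g a f f'|f a g g'] /=; rewrite /hsum_ip mulr_sumr -big_split /=.
  by apply: eq_bigr => i _; rewrite !ffunE linearPl.
by apply: eq_bigr => i _; rewrite !ffunE linearPr.
Qed.

HB.instance Definition _ :=
  bilinear_isBilinear.Build R[i] {ffun 'I_n -> H} {ffun 'I_n -> H} R[i]
    *%R (Num.conj \; *%R) hsum_ip hsum_ip_bilinear.

Fact hsum_ip_hermitian (f g : {ffun 'I_n -> H}) :
  hsum_ip f g = (-1) ^+ false * Num.conj (hsum_ip g f).
Proof.
rewrite expr0 mul1r /hsum_ip rmorph_sum; apply: eq_bigr => i _.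
by rewrite hermC expr0 mul1r.
Qed.

HB.instance Definition _ :=
  isHermitianSesquilinear.Build R[i] {ffun 'I_n -> H} false Num.conj
    hsum_ip hsum_ip_hermitian.

Fact hsum_ip_gt0 (f : {ffun 'I_n -> H}) : f != 0 -> 0 < hsum_ip f f.
Proof.
move=> f0; have [i fi0] : exists i, f i != 0.
  apply/existsP; apply: contraNT f0 => /existsPn f0; apply/eqP/ffunP => i.
  by rewrite ffunE; apply/eqP; rewrite -[_ == _]negbK f0.
rewrite /hsum_ip (bigD1 i) //= ltr_pwDl ?dnorm_gt0 //.
by apply: sumr_ge0 => j _; exact: dnorm_ge0.
Qed.

HB.instance Definition _ :=
  isDotProduct.Build R[i] {ffun 'I_n -> H} hsum_ip hsum_ip_gt0.

Let re_ge0 (x : H) : 0 <= complex.Re (ip H x x).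
Proof. by have := dnorm_ge0 (ip H) x; rewrite lecE => /andP[]. Qed.

Let dot_norm_hsum (f : {ffun 'I_n -> H}) :
  dot_norm hsum_ip f = Num.sqrt (\sum_(i < n) complex.Re (ip H (f i) (f i))).
Proof. by rewrite /dot_norm /= /hsum_ip raddf_sum. Qed.

Let hnorm_hsum (f : {ffun 'I_n -> H}) i : hnorm (f i) <= dot_norm hsum_ip f.
Proof.
rewrite dot_norm_hsum /hnorm /dot_norm ler_wsqrtr // (bigD1 i) //= lerDl.
by apply: sumr_ge0.
Qed.

Fact hsum_complete : complete_for (dot_norm hsum_ip).
Proof.
move=> u u_cauchy.
have /choice[l lP] i : exists l, cvg_for (dot_norm (ip H)) (u ^~ i) l.
  apply: hilbert_complete => e /u_cauchy[m0 um0]; exists m0 => m p m0m m0p.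
  apply: le_lt_trans (um0 m p m0m m0p).
  by have := hnorm_hsum (u m - u p) i; rewrite !ffunE.
exists (finfun l) => e e0; pose d := e ^+ 2 / n.+1%:R.
have d0 : 0 < d by rewrite divr_gt0 ?exprn_gt0.
have /choice[m0 m0P] i : exists m0, forall m, (m0 <= m)%N ->
    dot_norm (ip H) (u m i - l i) < Num.sqrt d by apply: lP; rewrite sqrtr_gt0.
exists (\max_(i < n) m0 i)%N => m mm.
rewrite dot_norm_hsum -(gtr0_norm e0) -sqrtr_sqr ltr_sqrt ?exprn_gt0 //.
apply: (@le_lt_trans _ _ (\sum_(i < n) d)); last first.
  rewrite sumr_const card_ord -mulr_natr /d -mulrA gtr_pMr ?exprn_gt0 //.
  by rewrite mulrC ltr_pdivrMr // mul1r ltr_nat.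
apply: ler_sum => i _; rewrite !ffunE.
have := m0P i m (leq_trans (leq_bigmax i) mm).
by rewrite /dot_norm ltr_sqrt // => /ltW.
Qed.

Definition hsum : hilbert R := Hilbert hsum_complete.

End DirectSum.

(** * Bounded operators and matrices of operators *)

Section Operators.
Variable R : realType.
Implicit Types H K L : hilbert R.

Definition bounded_op H K (T : H -> K) : Prop :=
  linear T /\ exists M : R, forall x, hnorm (T x) <= M * hnorm x.

Definition opnorm H K (T : H -> K) : \bar R :=
  ereal_sup [set (hnorm (T x))%:E | x in [set x | hnorm x <= 1]].

Definition positive_op H (T : H -> H) : Prop := forall x, 0 <= ip H (T x) x.

Definition adjoint_op H (T T' : H -> H) : Prop :=
  forall x y, ip H (T x) y = ip H x (T' y).

(* The identification of M_n(B(H)) with B(H^n), through which matrices of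
   operators are normed and ordered. *)
Definition op_mx H n (X : 'M[H -> H]_n) : hsum n H -> hsum n H :=
  fun x : {ffun 'I_n -> H} => [ffun i => \sum_(j < n) X i j (x j)].

Definition entries_in (T : Type) n (A : set T) (X : 'M[T]_n) : Prop :=
  forall i j, A (X i j).

Definition linear_on (V W : lmodType R[i]) (A : set V) (f : V -> W) : Prop :=
  forall (c : R[i]) x y, A x -> A y -> f (c *: x + y) = c *: f x + f y.

Definition subspace (V : lmodType R[i]) (A : set V) : Prop :=
  A 0 /\ forall (c : R[i]) x y, A x -> A y -> A (c *: x + y).

(** * Operator systems, operator algebras, C*-algebras *)

(* All are given concretely, as sets of bounded operators on a Hilbert space. *)
Record operator_system H (S : set (H -> H)) : Prop := {
  os_bounded : S `<=` @bounded_op H H;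
  os_subspace : subspace S;
  os_unit : S idfun;
  os_adjoint : forall x, S x -> exists2 y, S y & adjoint_op x y
}.

Record cstar_algebra H (D : set (H -> H)) : Prop := {
  cs_bounded : D `<=` @bounded_op H H;
  cs_subspace : subspace D;
  cs_mul : forall x y, D x -> D y -> D (x \o y);
  cs_adjoint : forall x, D x -> exists2 y, D y & adjoint_op x y;
  cs_closed : forall T, bounded_op T ->
    (forall e : R, 0 < e -> exists2 x, D x & (opnorm (T - x)%R < e%:E)%E) -> D T
}.

Definition unital_cstar_algebra H (D : set (H -> H)) : Prop :=
  cstar_algebra D /\ D idfun.

Definition Ualg H (X : set (H -> H)) : set (hsum 2 H -> hsum 2 H) :=
  [set T | exists (lambda : R[i]) (x : H -> H), X x /\
     T = op_mx (\matrix_(i < 2, j < 2)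
                  if i == j then lambda *: (idfun : H -> H)
                  else if (i < j)%N then x else 0)].

(** * Algebraic tensor products *)

(* The element sum_k a_k (x) e_k is represented by the list of the pairs
   (a_k, e_k).  Everything below is evaluated on such representatives through
   maps that are bilinear, so that it only depends on the tensor. *)
Definition tensor (A E : Type) := seq (A * E).

Definition tensor_eval (A E : Type) (V : nmodType) (f : A -> E -> V)
  (t : tensor A E) : V := \sum_(p <- t) f p.1 p.2.

Definition tensor_in H K (A : set (H -> H)) (E : set (K -> K)) :
    set (tensor (H -> H) (K -> K)) :=
  [set t : tensor (H -> H) (K -> K) | forall p, p \in t -> A p.1 /\ E p.2].

(* [ht_op a b] is the operator a (x) b of B(H (x) K); it is determined by
   [ht_op_pure] since elementary tensors are total. *)
Record hilbert_tensor H K := HilbertTensor {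
  ht_space :> hilbert R;
  ht_pure : H -> K -> ht_space;
  ht_linl : forall k, linear (ht_pure^~ k);
  ht_linr : forall h, linear (ht_pure h);
  ht_ip : forall h h' k k',
    ip ht_space (ht_pure h k) (ht_pure h' k') = ip H h h' * ip K k k';
  ht_dense : forall x (e : R), 0 < e ->
    exists t : tensor H K, hnorm (x - tensor_eval ht_pure t) < e;
  ht_op : (H -> H) -> (K -> K) -> (ht_space -> ht_space);
  ht_op_bounded : forall a b, bounded_op a -> bounded_op b ->
    bounded_op (ht_op a b);
  ht_op_pure : forall a b, bounded_op a -> bounded_op b ->
    forall h k, ht_op a b (ht_pure h k) = ht_pure (a h) (b k)
}.

(** * Tensor products of operator algebras *)

Definition min_norm H K (HK : hilbert_tensor H K) n
    (X : 'M[tensor (H -> H) (K -> K)]_n) : \bar R :=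
  opnorm (op_mx (map_mx (tensor_eval (@ht_op H K HK)) X)).

Record cc_representation H L (A : set (H -> H)) (pi : (H -> H) -> (L -> L)) :
    Prop := {
  ccr_bounded : forall a, A a -> bounded_op (pi a);
  ccr_linear : linear_on A pi;
  ccr_mul : forall a b, A a -> A b -> pi (a \o b) = pi a \o pi b;
  ccr_contractive : forall n (X : 'M[H -> H]_n), entries_in A X ->
    (opnorm (op_mx (map_mx pi X)) <= opnorm (op_mx X))%E
}.

Definition commuting_ranges H K L (A : set (H -> H)) (E : set (K -> K))
    (pi : (H -> H) -> (L -> L)) (rho : (K -> K) -> (L -> L)) : Prop :=
  forall a e, A a -> E e -> pi a \o rho e = rho e \o pi a.

Definition dot_map H K L (pi : (H -> H) -> (L -> L))
    (rho : (K -> K) -> (L -> L)) : tensor (H -> H) (K -> K) -> (L -> L) :=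
  tensor_eval (fun a e => pi a \o rho e).

Definition max_norm H K (A : set (H -> H)) (E : set (K -> K)) n
    (X : 'M[tensor (H -> H) (K -> K)]_n) : \bar R :=
  ereal_sup [set r | exists (L : hilbert R) (pi : (H -> H) -> (L -> L))
                            (rho : (K -> K) -> (L -> L)),
    [/\ cc_representation A pi, cc_representation E rho,
        commuting_ranges A E pi rho
      & r = opnorm (op_mx (map_mx (dot_map pi rho) X))]].

(* A completion of the algebraic tensor product of A and E for the family of
   matrix norms p; [mc_pure a e] is the image of a (x) e. *)
Record mx_completion H K (A : set (H -> H)) (E : set (K -> K))
    (p : forall n, 'M[tensor (H -> H) (K -> K)]_n -> \bar R) := MxCompletion {
  mc_space :> lmodType R[i];
  mc_norm : forall n, 'M[mc_space]_n -> R;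
  mc_normD : forall n (X Y : 'M[mc_space]_n),
    mc_norm (X + Y) <= mc_norm X + mc_norm Y;
  mc_normZ : forall n (c : R[i]) (X : 'M[mc_space]_n),
    mc_norm (map_mx ( *:%R c) X) = complex.Re `|c| * mc_norm X;
  mc_norm0 : forall n (X : 'M[mc_space]_n), mc_norm X = 0 -> X = 0;
  mc_complete : forall n, complete_for (@mc_norm n);
  mc_pure : (H -> H) -> (K -> K) -> mc_space;
  mc_linl : forall e, E e -> linear_on A (mc_pure^~ e);
  mc_linr : forall a, A a -> linear_on E (mc_pure a);
  mc_isometric : forall n (X : 'M[tensor (H -> H) (K -> K)]_n),
    entries_in (tensor_in A E) X ->
    (mc_norm (map_mx (tensor_eval mc_pure) X))%:E = p n X;
  mc_dense : forall n (Y : 'M[mc_space]_n) (r : R), 0 < r ->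
    exists2 X : 'M[tensor (H -> H) (K -> K)]_n, entries_in (tensor_in A E) X
      & mc_norm (Y - map_mx (tensor_eval mc_pure) X) < r
}.

(* The Hilbert space tensor product and the two completions are unique up to
   isomorphism, so that their choice is immaterial. *)
Definition alg_min_eq_max H K (A : set (H -> H)) (E : set (K -> K)) : Prop :=
  exists (HK : hilbert_tensor H K) (Wmin : mx_completion A E (min_norm HK))
         (Wmax : mx_completion A E (max_norm A E))
         (Phi : {linear Wmin -> Wmax}),
    [/\ bijective Phi,
        forall n (Y : 'M[Wmin]_n), mc_norm (map_mx Phi Y) = mc_norm Y
      & forall a e, A a -> E e -> Phi (mc_pure Wmin a e) = mc_pure Wmax a e].

(** * Tensor products of operator systems *)

Definition psd_mx n k (A : 'M['M[R[i]]_k]_n) : Prop :=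
  forall v : 'I_n -> 'cV[R[i]]_k,
    0 <= (\sum_(i < n) \sum_(j < n)
            (map_mx Num.conj (v i))^T *m A i j *m v j) ord0 ord0.

Record ucp_mx H k (S : set (H -> H)) (phi : (H -> H) -> 'M[R[i]]_k) : Prop := {
  ucpm_linear : linear_on S phi;
  ucpm_unital : phi idfun = 1%:M;
  ucpm_positive : forall n (X : 'M[H -> H]_n), entries_in S X ->
    positive_op (op_mx X) -> psd_mx (map_mx phi X)
}.

Record ucp H L (S : set (H -> H)) (phi : (H -> H) -> (L -> L)) : Prop := {
  ucp_bounded : forall x, S x -> bounded_op (phi x);
  ucp_linear : linear_on S phi;
  ucp_unital : phi idfun = idfun;
  ucp_positive : forall n (X : 'M[H -> H]_n), entries_in S X ->
    positive_op (op_mx X) -> positive_op (op_mx (map_mx phi X))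
}.

Definition min_positive H K (S : set (H -> H)) (T : set (K -> K)) n
    (X : 'M[tensor (H -> H) (K -> K)]_n) : Prop :=
  forall k m (phi : (H -> H) -> 'M[R[i]]_k) (psi : (K -> K) -> 'M[R[i]]_m),
    ucp_mx S phi -> ucp_mx T psi ->
    psd_mx (map_mx (tensor_eval (fun s t => tensmx (phi s) (psi t))) X).

Definition c_positive H K (S : set (H -> H)) (T : set (K -> K)) n
    (X : 'M[tensor (H -> H) (K -> K)]_n) : Prop :=
  forall (L : hilbert R) (phi : (H -> H) -> (L -> L))
    (psi : (K -> K) -> (L -> L)),
    ucp S phi -> ucp T psi -> commuting_ranges S T phi psi ->
    positive_op (op_mx (map_mx (dot_map phi psi) X)).

Definition sys_min_eq_c H K (S : set (H -> H)) (T : set (K -> K)) : Prop :=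
  forall n (X : 'M[tensor (H -> H) (K -> K)]_n), entries_in (tensor_in S T) X ->
    min_positive S T X <-> c_positive S T X.

(** * Nuclearity detectors *)

Definition nuclear H (D : set (H -> H)) : Prop :=
  forall (K : hilbert R) (B : set (K -> K)),
    cstar_algebra B -> alg_min_eq_max D B.

Definition system_nuclearity_detector H (S : set (H -> H)) : Prop :=
  forall (K : hilbert R) (D : set (K -> K)),
    unital_cstar_algebra D -> sys_min_eq_c S D -> nuclear D.

Definition algebra_nuclearity_detector H (A : set (H -> H)) : Prop :=
  forall (K : hilbert R) (D : set (K -> K)),
    unital_cstar_algebra D -> alg_min_eq_max A D -> nuclear D.

End Operators.

(* Main.v *)
Require Import Defs.
From mathcomp Require Import all_boot all_order all_algebra.
From mathcomp Require Import all_classical all_reals.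
From HB Require Import structures.
From mathcomp Require Import sesquilinear complex mxtens ereal ring lra.

(** One implication between the two cones is always true: two matricial ucp
    maps [phi] and [psi] commute once they act on the two legs of
    C^k (x) C^m, so that commuting positivity implies minimal positivity.

    For the other one, let [X] be minimally positive in M_n(S (x) D) and let
    [phi], [psi] be commuting ucp maps of [S] and [D] into B(L).

    By [commuting_dilation] both maps are compressions of commuting ucp maps
    [sigma], [pi] on a larger space, where [pi] is moreover multiplicative. The
    larger space is Stinespring's space for [psi], obtained here as the Hilbert
    space of the kernel [<psi (d'^* d) l, l'>] on pairs [(d, l)]. That [phi]
    lifts to it, and that the lift is still completely positive, comes from
    the positivity of a product of commuting positive operators, used in the
    form of [schur_product_positive].

    The algebra U(S) has few representations coming from [sigma], but one of
    them suffices: [[c, x], [0, c]] goes to [[c, sigma x], [0, c]], which is a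
    completely contractive representation because the second amplification of
    [sigma] is completely contractive ([tri_rep_cc]). It commutes with two
    copies of [pi]. Hence, if the minimal and maximal norms agree, the norm of
    [sigma . pi (X) + z] is at most the spatial norm of the element of
    M_n(U(S) (x) D) that carries [X + z (1 (x) 1)] in its nilpotent corner.

    This trades order for norm, and the norm estimate has to be turned back
    into positivity. Compressing both legs to finite dimensional subspaces
    shows that [X] acts on the spatial tensor product as a positive operator
    [T] ([min_positive_spatial]). Therefore [T + z] has norm at most
    [sqrt (|z|^2 + |T|^2)] whenever [z] has nonpositive real part
    ([nilp_lift_min_norm]), and the same bound holds for [sigma . pi (X) + z].
    Letting [z] tend to infinity along three directions forces the numerical
    range of [sigma . pi (X)] into the half-line of nonnegative numbers
    ([positive_of_shifts]). *)

Set Implicit Arguments.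
Unset Strict Implicit.
Unset Printing Implicit Defensive.
Import Order.TTheory GRing.Theory Num.Theory.
Local Open Scope classical_set_scope.
Local Open Scope ring_scope.
Local Open Scope complex_scope.

(** * Complex numbers *)

Section ComplexNumbers.
Variable R : realType.
Implicit Types (a b : R) (z w : R[i]).
Local Notation Re := complex.Re.
Local Notation Im := complex.Im.

Definition cnorm z : R := Re `|z|.

Lemma cnormE z : (cnorm z)%:C = `|z|.
Proof. by rewrite /cnorm normc_def. Qed.

Lemma cnorm_ge0 z : 0 <= cnorm z.
Proof. by rewrite -lecR cnormE normr_ge0. Qed.

Lemma cnormD z w : cnorm (z + w) <= cnorm z + cnorm w.
Proof. by rewrite -lecR rmorphD /= !cnormE ler_normD. Qed.

Lemma cnormM z w : cnorm (z * w) = cnorm z * cnorm w.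
Proof. by apply: complexI; rewrite rmorphM /= !cnormE normrM. Qed.

Lemma cnormN z : cnorm (- z) = cnorm z.
Proof. by apply: complexI; rewrite !cnormE normrN. Qed.

Lemma cnormB z w : cnorm (z - w) = cnorm (w - z).
Proof. by rewrite -cnormN opprB. Qed.

Lemma cnorm0 : cnorm 0 = 0.
Proof. by apply: complexI; rewrite cnormE normr0. Qed.

Lemma cnorm_eq0 z : (cnorm z == 0) = (z == 0).
Proof. by rewrite -(inj_eq (@complexI _)) cnormE normr_eq0. Qed.

Lemma cnormJ z : cnorm (Num.conj z) = cnorm z.
Proof. by apply: complexI; rewrite !cnormE norm_conjC. Qed.

Lemma cnormR a : 0 <= a -> cnorm a%:C = a.
Proof. by move=> a0; apply: complexI; rewrite !cnormE ger0_norm // ler0c. Qed.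

Lemma cnorm_sqr z : cnorm z ^+ 2 = Re z ^+ 2 + Im z ^+ 2.
Proof.
by apply: complexI; rewrite rmorphXn /= cnormE add_Re2_Im2.
Qed.

Lemma Re_le_cnorm z : `|Re z| <= cnorm z.
Proof.
rewrite -(@ler_pXn2r _ 2) ?nnegrE ?cnorm_ge0 //.
by rewrite real_normK ?num_real // cnorm_sqr lerDl sqr_ge0.
Qed.

Lemma Im_le_cnorm z : `|Im z| <= cnorm z.
Proof.
rewrite -(@ler_pXn2r _ 2) ?nnegrE ?cnorm_ge0 //.
by rewrite real_normK ?num_real // cnorm_sqr lerDr sqr_ge0.
Qed.

Lemma cnorm_le_ReIm z : cnorm z <= `|Re z| + `|Im z|.
Proof.
rewrite -(@ler_pXn2r _ 2) ?nnegrE ?cnorm_ge0 ?addr_ge0 //.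
rewrite cnorm_sqr sqrrD !real_normK ?num_real //.
by rewrite lerD2r lerDl mulrn_wge0 // mulr_ge0.
Qed.

Lemma ReD z w : Re (z + w) = Re z + Re w. Proof. by case: z w => ? ? []. Qed.
Lemma ImD z w : Im (z + w) = Im z + Im w. Proof. by case: z w => ? ? []. Qed.
Lemma ReN z : Re (- z) = - Re z. Proof. by case: z. Qed.
Lemma ImN z : Im (- z) = - Im z. Proof. by case: z. Qed.
Lemma ReM z w : Re (z * w) = Re z * Re w - Im z * Im w.
Proof. by case: z w => ? ? []. Qed.
Lemma ImM z w : Im (z * w) = Re z * Im w + Im z * Re w.
Proof. by case: z w => ? ? []. Qed.
Lemma ReJ z : Re (Num.conj z) = Re z. Proof. by case: z. Qed.
Lemma ImJ z : Im (Num.conj z) = - Im z. Proof. by case: z. Qed.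

Definition ReImE := (ReD, ImD, ReN, ImN, ReM, ImM, ReJ, ImJ).

Lemma complexP z w : Re z = Re w -> Im z = Im w -> z = w.
Proof. by case: z w => ? ? [? ?] /= -> ->. Qed.

Lemma ge0_ReIm z : (0 <= z) <-> (Im z = 0 /\ 0 <= Re z).
Proof. by rewrite lecE /=; split=> [/andP[/eqP]|[->]] // ->; rewrite eqxx. Qed.

Lemma conj_ge0 z : 0 <= z -> Num.conj z = z.
Proof. by move=> /ge0_ReIm[z0 _]; apply: complexP; rewrite ReImE ?z0 ?oppr0. Qed.

Lemma le_eps a b : (forall e, 0 < e -> a <= b + e) -> a <= b.
Proof. by move=> h; apply/ler_addgt0Pr. Qed.

(** Every positivity statement proved below by approximation ends here; the
    half-line of nonnegative numbers being closed, approximants that are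
    themselves nonnegative are enough. *)
Lemma ge0_closed z :
  (forall e, 0 < e -> exists2 p : R[i], 0 <= p & cnorm (z - p) <= e) -> 0 <= z.
Proof.
move=> h; apply/ge0_ReIm; split.
  apply/eqP; rewrite -normr_le0; apply: le_eps => e /h[p /ge0_ReIm[p0 _]].
  by rewrite add0r; apply: le_trans; apply: le_trans (Im_le_cnorm _); rewrite !ReImE p0 subr0.
apply: le_eps => e /h[p /ge0_ReIm[_ p0]] hz.
have := le_trans (Re_le_cnorm _) hz; rewrite !ReImE ler_distl => /andP[+ _].
lra.
Qed.

(** The discriminant argument behind every Cauchy-Schwarz inequality. *)
Lemma discriminant_le a b z : 0 <= a -> 0 <= b ->
  (forall t : R[i], 0 <= a + 2 * Re (t * z) + cnorm t ^+ 2 * b) ->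
  cnorm z ^+ 2 <= a * b.
Proof.
move=> a0 b0 h.
have {}h (s : R) : 0 <= a - 2 * s * cnorm z ^+ 2 + s ^+ 2 * cnorm z ^+ 2 * b.
  have := h (- (s%:C * Num.conj z)).
  rewrite cnormN cnormM exprMn cnormJ !cnorm_sqr !ReImE /= expr0n /=; lra.
set w := cnorm z ^+ 2 in h *; have w0 : 0 <= w by rewrite sqr_ge0.
have [bz|b_gt0] := eqVneq b 0.
  rewrite bz mulr0; case: (ltP 0 w) => // w_gt0.
  have := h ((a + 1) / (2 * w)); rewrite bz mulr0 addr0.
  have -> : 2 * ((a + 1) / (2 * w)) * w = a + 1 by field; rewrite gt_eqF.
  lra.
have {}b_gt0 : 0 < b by rewrite lt0r b_gt0.
have := h b^-1.
have -> : a - 2 * b^-1 * w + b^-1 ^+ 2 * w * b = (a * b - w) / b.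
  by field; rewrite gt_eqF.
by rewrite pmulr_lge0 ?invr_gt0 // subr_ge0.
Qed.

(** The limit is the supremum of the eventual lower bounds. *)
Lemma real_complete : complete_for (fun x : R => `|x|).
Proof.
move=> u ucauchy.
pose A := [set x : R | exists m0, forall m, (m0 <= m)%N -> x <= u m].
have Asup : has_sup A.
  have [m0 hm0] := ucauchy 1 ltr01; split.
    exists (u m0 - 1); exists m0 => m m0m.
    by have := hm0 _ _ m0m (leqnn _); rewrite ltr_distl => /andP[/ltW].
  exists (u m0 + 1) => x [m1 hm1].
  apply: le_trans (hm1 (maxn m0 m1) (leq_maxr _ _)) _.
  have := hm0 _ m0 (leq_maxl m0 m1) (leqnn _).
  by rewrite ltr_distl => /andP[_ /ltW].
exists (sup A) => e e0; have e2 : 0 < e / 2 by rewrite divr_gt0.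
have [m0 hm0] := ucauchy _ e2.
have lo m : (m0 <= m)%N -> u m - e / 2 <= sup A.
  move=> m0m; apply: ub_le_sup; first by case: Asup.
  exists m0 => p m0p.
  by have := hm0 _ _ m0m m0p; rewrite distrC ltr_distl => /andP[/ltW].
have hi m : (m0 <= m)%N -> sup A <= u m + e / 2.
  move=> m0m; apply: ge_sup; first by case: Asup.
  move=> x [m1 hm1]; apply: le_trans (hm1 (maxn m0 m1) (leq_maxr _ _)) _.
  have := hm0 _ m (leq_maxl m0 m1) m0m.
  by rewrite ltr_distl => /andP[_ /ltW].
exists m0 => m m0m; rewrite ltr_norml; have := lo _ m0m; have := hi _ m0m.
move=> h1 h2; apply/andP; split; lra.
Qed.

Lemma complex_complete : complete_for (cnorm : R[i] -> R).
Proof.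
move=> u hu.
have [a ha] : exists a, cvg_for (fun x : R => `|x|) (fun n => Re (u n)) a.
  apply: real_complete => e /hu[m0 h]; exists m0 => m n hm hn.
  apply: le_lt_trans (h m n hm hn); apply: le_trans (Re_le_cnorm _).
  by rewrite !ReImE.
have [b hb] : exists b, cvg_for (fun x : R => `|x|) (fun n => Im (u n)) b.
  apply: real_complete => e /hu[m0 h]; exists m0 => m n hm hn.
  apply: le_lt_trans (h m n hm hn); apply: le_trans (Im_le_cnorm _).
  by rewrite !ReImE.
exists (a +i* b) => e e0; have e2 : 0 < e / 2 by rewrite divr_gt0.
have [m1 h1] := ha _ e2; have [m2 h2] := hb _ e2.
exists (maxn m1 m2) => m; rewrite geq_max => /andP[/h1 h1' /h2 h2'].
apply: le_lt_trans (cnorm_le_ReIm _) _; rewrite !ReImE /=; lra.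
Qed.

(** ** Limits of sequences of complex numbers *)

Local Notation climit := (@cvg_for R R[i] cnorm).

Lemma climit_unique u z w : climit u z -> climit u w -> z = w.
Proof.
move=> hz hw; apply/eqP; rewrite -subr_eq0 -cnorm_eq0.
rewrite eq_le cnorm_ge0 andbT; apply: le_eps => e e0.
have e2 : 0 < e / 2 by rewrite divr_gt0.
have [m1 h1] := hz _ e2; have [m2 h2] := hw _ e2.
have := h1 _ (leq_maxl m1 m2); have := h2 _ (leq_maxr m1 m2).
set x := u _ => hb; rewrite cnormB => ha.
have := cnormD (z - x) (x - w); rewrite [_ + _]addrA subrK; lra.
Qed.

(** Lets estimates carry a multiplicative constant, so that [e] need not be
    divided beforehand. *)
Lemma climitP u z a : 0 <= a ->
  (forall e, 0 < e -> exists m0, forall m, (m0 <= m)%N -> cnorm (u m - z) <= a * e) ->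
  climit u z.
Proof.
move=> a0 h e e0; have [|m0 hm] := h (e / (a + 1)).
  by rewrite divr_gt0 // ltr_wpDl.
exists m0 => m /hm /le_lt_trans; apply; rewrite mulrA ltr_pdivrMr ?ltr_wpDl //.
by rewrite mulrDr mulr1 mulrC ltrDl.
Qed.

Lemma climit_lin (c : R[i]) u v z w : climit u z -> climit v w ->
  climit (fun n => c * u n + v n) (c * z + w).
Proof.
move=> hu hv; apply: (@climitP _ _ (cnorm c + 1)); first by rewrite addr_ge0 ?cnorm_ge0.
move=> e e0; have [m1 h1] := hu _ e0; have [m2 h2] := hv _ e0.
exists (maxn m1 m2) => m; rewrite geq_max => /andP[/h1 h1' /h2 h2'].
have -> : c * u m + v m - (c * z + w) = c * (u m - z) + (v m - w) by ring.
apply: le_trans (cnormD _ _) _; rewrite cnormM mulrDl mul1r.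
by rewrite lerD ?ler_wpM2l ?cnorm_ge0 ?ltW.
Qed.

Lemma climitJ u z : climit u z -> climit (fun n => Num.conj (u n)) (Num.conj z).
Proof.
by move=> h e /h[m0 hm]; exists m0 => m /hm; rewrite -rmorphB cnormJ.
Qed.

Lemma climit_cst z : climit (fun=> z) z.
Proof. by move=> e e0; exists 0%N => m _; rewrite subrr cnorm0. Qed.

Lemma climit_ge0 u z : (forall n, 0 <= u n) -> climit u z -> 0 <= z.
Proof.
move=> u0 h; apply: ge0_closed => e /h[m0 hm]; exists (u m0) => //.
by rewrite cnormB ltW ?hm.
Qed.

Lemma inv_eps (e : R) : 0 < e -> exists m0, forall m, (m0 <= m)%N -> m.+1%:R^-1 < e.
Proof.
move=> e0; exists (Num.bound e^-1) => m h.
rewrite invf_plt ?posrE ?ltr0n //; apply: lt_le_trans (archi_boundP _) _.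
  by rewrite invr_ge0 ltW.
by rewrite ler_nat leqW.
Qed.

End ComplexNumbers.

(** * Hilbert spaces *)

Section HilbertBasics.
Variables (R : realType) (H : hilbert R).
Implicit Types (x y u v : H) (c : R[i]).
Local Notation Re := complex.Re.
Local Notation "'[ x , y ]" := (ip H x y).

Lemma ipDl x y u : '[x + y, u] = '[x, u] + '[y, u].
Proof. exact: linearDl. Qed.
Lemma ipDr x y u : '[u, x + y] = '[u, x] + '[u, y].
Proof. exact: linearDr. Qed.
Lemma ipZl c x y : '[c *: x, y] = c * '[x, y].
Proof. exact: linearZl_LR. Qed.
Lemma ipZr c x y : '[x, c *: y] = Num.conj c * '[x, y].
Proof. exact: linearZr_LR. Qed.
Lemma ip0l x : '[0, x] = 0. Proof. exact: linear0l. Qed.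
Lemma ip0r x : '[x, 0] = 0. Proof. exact: linear0r. Qed.
Lemma ipNl x y : '[- x, y] = - '[x, y]. Proof. exact: linearNl. Qed.
Lemma ipNr x y : '[x, - y] = - '[x, y]. Proof. exact: linearNr. Qed.
Lemma ip_suml I (r : seq I) (P : pred I) (F : I -> H) y :
  '[\sum_(i <- r | P i) F i, y] = \sum_(i <- r | P i) '[F i, y].
Proof. exact: linear_sumlz. Qed.
Lemma ip_sumr I (r : seq I) (P : pred I) (F : I -> H) y :
  '[y, \sum_(i <- r | P i) F i] = \sum_(i <- r | P i) '[y, F i].
Proof. exact: linear_sumr. Qed.

Definition ipE := (ipDl, ipDr, ipZl, ipZr, ipNl, ipNr, ip0l, ip0r).

Lemma ipC x y : '[x, y] = Num.conj '[y, x].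
Proof. by rewrite hermC expr0 mul1r. Qed.

Lemma ipxx_ge0 x : 0 <= '[x, x]. Proof. exact: dnorm_ge0. Qed.

Lemma hnorm_ge0 x : 0 <= hnorm x. Proof. exact: sqrtr_ge0. Qed.

Lemma hnorm_sqr x : hnorm x ^+ 2 = Re '[x, x].
Proof. by rewrite sqr_sqrtr //; have /ge0_ReIm[] := ipxx_ge0 x. Qed.

Lemma hnorm_sqrC x : (hnorm x ^+ 2)%:C = '[x, x].
Proof.
rewrite hnorm_sqr; have /ge0_ReIm[h _] := ipxx_ge0 x.
by apply: complexP; rewrite //= h.
Qed.

Lemma hnorm0 : hnorm (0 : H) = 0.
Proof. by apply/eqP; rewrite -sqrf_eq0 hnorm_sqr ip0l. Qed.

Lemma hnorm_eq0 x : hnorm x = 0 -> x = 0.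
Proof.
move=> h; apply/eqP; rewrite -(dnorm_eq0 (ip H)) -hnorm_sqrC h expr0n.
exact: eqxx.
Qed.

Lemma hnorm_sqrD x y :
  hnorm (x + y) ^+ 2 = hnorm x ^+ 2 + 2 * Re '[x, y] + hnorm y ^+ 2.
Proof. by rewrite !hnorm_sqr !ipE (ipC y x) !ReImE; ring. Qed.

Lemma hnormZ c x : hnorm (c *: x) = cnorm c * hnorm x.
Proof.
apply/eqP; rewrite -(@eqrXn2 _ 2) ?mulr_ge0 ?hnorm_ge0 ?cnorm_ge0 //.
rewrite exprMn cnorm_sqr hnorm_sqr !ipE -hnorm_sqrC !ReImE /=.
by apply/eqP; ring.
Qed.

Lemma hnormN x : hnorm (- x) = hnorm x.
Proof. by rewrite /hnorm /dot_norm !ipE opprK. Qed.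

Lemma hnormB x y : hnorm (x - y) = hnorm (y - x).
Proof. by rewrite -hnormN opprB. Qed.

Lemma cauchy_schwarz x y : cnorm '[x, y] <= hnorm x * hnorm y.
Proof.
rewrite -(@ler_pXn2r _ 2) ?nnegrE ?cnorm_ge0 ?mulr_ge0 ?hnorm_ge0 //.
rewrite exprMn; apply: discriminant_le; rewrite ?sqr_ge0 // => t.
have := sqr_ge0 (hnorm (x + Num.conj t *: y)).
by rewrite hnorm_sqrD hnormZ cnormJ exprMn !ipE conjCK.
Qed.

Lemma hnormD x y : hnorm (x + y) <= hnorm x + hnorm y.
Proof.
rewrite -(@ler_pXn2r _ 2) ?nnegrE ?addr_ge0 ?hnorm_ge0 //.
rewrite hnorm_sqrD sqrrD lerD2r lerD2l -[leRHS]mulr_natl ler_wpM2l //.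
exact: le_trans (ler_norm _) (le_trans (Re_le_cnorm _) (cauchy_schwarz _ _)).
Qed.

Lemma hnorm_sum I (r : seq I) (P : pred I) (F : I -> H) :
  hnorm (\sum_(i <- r | P i) F i) <= \sum_(i <- r | P i) hnorm (F i).
Proof.
elim/big_ind2: _ => [|x a y b hx hy|i _]; rewrite ?hnorm0 //.
by apply: le_trans (hnormD _ _) _; rewrite lerD.
Qed.

Lemma ip_inj x y : (forall z, '[x, z] = '[y, z]) -> x = y.
Proof.
move=> h; apply/eqP; rewrite -subr_eq0 -(dnorm_eq0 (ip H)).
by rewrite /= !ipDl !ipNl h subrr.
Qed.

End HilbertBasics.

(** * Bounded operators and matrices of operators *)

Section LinearMaps.
Variables (R : realType) (V W : lmodType R[i]) (f : V -> W).
Hypothesis f_linear : linear f.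

Lemma lin0 : f 0 = 0.
Proof.
have /eqP := f_linear 1 0 0.
by rewrite !scale1r add0r -subr_eq0 opprD addNKr oppr_eq0 => /eqP.
Qed.

Lemma linD x y : f (x + y) = f x + f y.
Proof. by rewrite -{1}[x]scale1r f_linear scale1r. Qed.

Lemma linZ c x : f (c *: x) = c *: f x.
Proof. by rewrite -{1}[c *: x]addr0 f_linear lin0 addr0. Qed.

Lemma linN x : f (- x) = - f x.
Proof. by rewrite -scaleN1r linZ scaleN1r. Qed.

Lemma linB x y : f (x - y) = f x - f y.
Proof. by rewrite linD linN. Qed.

Lemma linS I (r : seq I) (P : pred I) (F : I -> V) :
  f (\sum_(i <- r | P i) F i) = \sum_(i <- r | P i) f (F i).
Proof. exact: (big_morph f linD lin0). Qed.

End LinearMaps.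

Section BoundedOperators.
Variable R : realType.
Implicit Types H K L : hilbert R.
Local Notation Im := complex.Im.

Lemma bounded_lin H K (T : H -> K) : bounded_op T -> linear T.
Proof. by case. Qed.

Lemma bounded_nonneg H K (T : H -> K) : bounded_op T ->
  exists2 M : R, 0 <= M & forall x, hnorm (T x) <= M * hnorm x.
Proof.
move=> [_ [M hM]]; exists `|M| => // x; apply: le_trans (hM x) _.
by rewrite ler_wpM2r ?hnorm_ge0 // ler_norm.
Qed.

Lemma bounded_id H : bounded_op (idfun : H -> H).
Proof. by split=> //; exists 1 => x; rewrite mul1r. Qed.

Lemma bounded_lincomb H K (c : R[i]) (S T : H -> K) :
  bounded_op S -> bounded_op T -> bounded_op (c *: S + T).
Proof.
move=> Sb Tb; split=> [a x y|].
  have -> z : (c *: S + T) z = c *: S z + T z by [].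
  rewrite (linD (bounded_lin Sb)) (linD (bounded_lin Tb)).
  rewrite (linZ (bounded_lin Sb)) (linZ (bounded_lin Tb)).
  have -> z : (c *: S + T) z = c *: S z + T z by [].
  by rewrite !scalerDr !scalerA [c * a]mulrC addrACA.
have [M M0 hM] := bounded_nonneg Sb; have [N N0 hN] := bounded_nonneg Tb.
exists (cnorm c * M + N) => x.
have -> : (c *: S + T) x = c *: S x + T x by [].
apply: le_trans (hnormD _ _) _; rewrite hnormZ mulrDl -mulrA lerD //.
by rewrite ler_wpM2l ?cnorm_ge0.
Qed.

Lemma bounded_zero H K : bounded_op (0 : H -> K).
Proof.
split=> [a x y|]; first by rewrite /= scaler0 addr0.
by exists 0 => x; rewrite hnorm0 mul0r.
Qed.

Lemma bounded_scale H K (c : R[i]) (T : H -> K) :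
  bounded_op T -> bounded_op (c *: T).
Proof.
by move=> Tb; rewrite -[c *: T]addr0; apply: bounded_lincomb => //; exact: bounded_zero.
Qed.

Lemma bounded_add H K (S T : H -> K) :
  bounded_op S -> bounded_op T -> bounded_op (S + T).
Proof. by move=> Sb Tb; rewrite -[S]scale1r; apply: bounded_lincomb. Qed.

Lemma bounded_sum H K (I : eqType) (r : seq I) (F : I -> H -> K) :
  (forall i, i \in r -> bounded_op (F i)) -> bounded_op (\sum_(i <- r) F i).
Proof.
move=> h; rewrite big_seq; elim/big_ind: _ => //; first exact: bounded_zero.
by move=> *; apply: bounded_add.
Qed.

Lemma bounded_comp H K L (S : K -> L) (T : H -> K) :
  bounded_op S -> bounded_op T -> bounded_op (S \o T).
Proof.
move=> Sb Tb; split=> [a x y|].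
  by rewrite /= (bounded_lin Tb) (bounded_lin Sb).
have [M M0 hM] := bounded_nonneg Sb; have [N N0 hN] := bounded_nonneg Tb.
exists (M * N) => x; apply: le_trans (hM _) _.
by rewrite -mulrA ler_wpM2l.
Qed.

(** A positive operator on a complex Hilbert space is symmetric, by
    polarization: only the reality of its quadratic form matters. *)
Lemma positive_sym H (T : H -> H) : linear T -> positive_op T ->
  adjoint_op T T.
Proof.
move=> Tl Tpos x y.
have real u v : Im (ip H (T u) v) + Im (ip H (T v) u) = 0.
  have := Tpos (u + v); have := Tpos u; have := Tpos v.
  rewrite (linD Tl) !ipE => /ge0_ReIm[h1 _] /ge0_ReIm[h2 _] /ge0_ReIm[h3 _].
  by move: h3; rewrite !ImD h1 h2 add0r addr0.
have h1 := real x y; have := real x ('i *: y).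
rewrite (linZ Tl) !ipE !ReImE /= => h2.
rewrite (ipC x); apply: complexP; rewrite !ReImE; lra.
Qed.

Lemma opnorm_le H K (T : H -> K) (c : R) : 0 <= c ->
  (forall x, hnorm (T x) <= c * hnorm x) -> (opnorm T <= c%:E)%E.
Proof.
move=> c0 h; apply: ge_ereal_sup => _ [x /= x1 <-].
by rewrite lee_fin; apply: le_trans (h x) _; rewrite ler_piMr.
Qed.

Lemma opnorm_bound H K (T : H -> K) (c : R) : linear T ->
  (opnorm T <= c%:E)%E -> forall x, hnorm (T x) <= c * hnorm x.
Proof.
move=> Tl Tc x; have [x0|x0] := eqVneq (hnorm x) 0.
  by rewrite (hnorm_eq0 x0) (lin0 Tl) !hnorm0 mulr0.
have x_gt0 : 0 < hnorm x by rewrite lt0r x0 hnorm_ge0.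
have nx : cnorm (hnorm x)^-1%:C = (hnorm x)^-1.
  by rewrite cnormR // invr_ge0 ltW.
have : ((hnorm (T ((hnorm x)^-1%:C *: x)))%:E <= c%:E)%E.
  apply: le_trans Tc; apply: ereal_sup_ubound; exists ((hnorm x)^-1%:C *: x) => //=.
  by rewrite hnormZ nx mulVf.
by rewrite lee_fin (linZ Tl) hnormZ nx mulrC ler_pdivrMr.
Qed.

(** Complete contractivity is proved for vectors; operator norms are extended
    reals, and this is the passage from one to the other. *)
Lemma opnorm_mono H K H' K' (T : H -> K) (T' : H' -> K') : linear T ->
  (forall c : R, 0 <= c -> (forall x, hnorm (T x) <= c * hnorm x) ->
     forall x, hnorm (T' x) <= c * hnorm x) ->
  (opnorm T' <= opnorm T)%E.
Proof.
move=> Tl h; have : (0 <= opnorm T)%E.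
  apply: ereal_sup_ubound; exists 0 => /=; first by rewrite hnorm0.
  by rewrite (lin0 Tl) hnorm0.
case E : (opnorm T) => [c| |] // c0; last by rewrite leey.
by apply: opnorm_le => //; apply: h => //; apply: opnorm_bound; rewrite ?E.
Qed.

End BoundedOperators.

Section DirectSums.
Variables (R : realType) (H : hilbert R).
Implicit Types n : nat.

Lemma hsum_ipE n (v w : {ffun 'I_n -> H}) :
  ip (hsum n H) v w = \sum_(i < n) ip H (v i) (w i).
Proof. by []. Qed.

Lemma hsum_norm n (v : {ffun 'I_n -> H}) :
  hnorm (v : hsum n H) ^+ 2 = \sum_(i < n) hnorm (v i) ^+ 2.
Proof.
rewrite hnorm_sqr hsum_ipE (big_morph (@complex.Re R) (@ReD R) (erefl _)).
by apply: eq_bigr => i _; rewrite hnorm_sqr.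
Qed.

Lemma hsum_coord_le n (v : {ffun 'I_n -> H}) i :
  hnorm (v i) <= hnorm (v : hsum n H).
Proof.
rewrite -(@ler_pXn2r _ 2) ?nnegrE ?hnorm_ge0 // hsum_norm (bigD1 i) //=.
by rewrite lerDl sumr_ge0 // => j _; rewrite sqr_ge0.
Qed.

Lemma hsum_norm_le n (v : {ffun 'I_n -> H}) :
  hnorm (v : hsum n H) <= \sum_(i < n) hnorm (v i).
Proof.
rewrite -(@ler_pXn2r _ 2) ?nnegrE ?hnorm_ge0 ?sumr_ge0 //; last first.
  by move=> i _; exact: hnorm_ge0.
rewrite hsum_norm expr2 mulr_suml ler_sum // => i _.
rewrite expr2 ler_wpM2l ?hnorm_ge0 // (bigD1 i) //= lerDl.
by apply: sumr_ge0 => j _; exact: hnorm_ge0.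
Qed.

Lemma op_mxE n (X : 'M[H -> H]_n) (v : {ffun 'I_n -> H}) i :
  (op_mx X v : {ffun _ -> _}) i = \sum_(j < n) X i j (v j).
Proof. by rewrite /op_mx ffunE. Qed.

Lemma op_mx_ip n (X : 'M[H -> H]_n) (v w : {ffun 'I_n -> H}) :
  ip (hsum n H) (op_mx X v) w
  = \sum_(i < n) \sum_(j < n) ip H (X i j (v j)) (w i).
Proof.
by rewrite hsum_ipE; apply: eq_bigr => i _; rewrite op_mxE ip_suml.
Qed.

Lemma op_mx_bounded n (X : 'M[H -> H]_n) :
  (forall i j, bounded_op (X i j)) -> bounded_op (op_mx X).
Proof.
move=> Xb; split=> [a v w|].
  apply/ffunP => i; rewrite ffunE [in RHS]ffunE [in X in _ = X + _]ffunE.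
  rewrite !ffunE scaler_sumr -big_split /=; apply: eq_bigr => j _.
  by rewrite !ffunE (bounded_lin (Xb i j)).
have /choice[M hM] : forall ij : 'I_n * 'I_n, exists M : R, 0 <= M /\
    forall x, hnorm (X ij.1 ij.2 x) <= M * hnorm x.
  by move=> ij; have [M M0 hM] := bounded_nonneg (Xb ij.1 ij.2); exists M.
exists (\sum_(i < n) \sum_(j < n) M (i, j)) => v.
apply: le_trans (hsum_norm_le _) _; rewrite mulr_suml ler_sum // => i _.
rewrite op_mxE; apply: le_trans (hnorm_sum _ _ _) _.
rewrite mulr_suml ler_sum // => j _.
have [M0 hMij] := hM (i, j); apply: le_trans (hMij _) _.
by rewrite ler_wpM2l // hsum_coord_le.
Qed.

Lemma op_mx_adjoint n (X Y : 'M[H -> H]_n) :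
  (forall i j, adjoint_op (X i j) (Y j i)) -> adjoint_op (op_mx X) (op_mx Y).
Proof.
move=> h v w; rewrite op_mx_ip hsum_ipE exchange_big.
apply: eq_bigr => j _; rewrite op_mxE ip_sumr.
by apply: eq_bigr => i _; exact: h.
Qed.

End DirectSums.

(** * Products of commuting positive operators *)

Section CommutingProduct.
Variables (R : realType) (L : hilbert R).
Local Notation "'[ x , y ]" := (ip L x y).

(** F. Riesz's sequence [A, A - A^2, (A - A^2) - (A - A^2)^2, ...]: for
    [0 <= A <= 1] it writes [A] as a series of squares of operators commuting
    with everything that commutes with [A], which replaces a square root. *)
Fixpoint riesz_seq (A : L -> L) n : L -> L :=
  if n is n'.+1 then fun x => riesz_seq A n' x - riesz_seq A n' (riesz_seq A n' x)
  else A.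

Section Contraction.
Variables A B : L -> L.
Hypotheses (A_linear : linear A) (B_bounded : bounded_op B).
Hypotheses (A_pos : positive_op A) (A_le1 : forall x, '[A x, x] <= '[x, x]).
Hypotheses (B_pos : positive_op B) (AB : forall x, A (B x) = B (A x)).
Local Notation P := (riesz_seq A).

Lemma riesz_seq_linear n : linear (P n).
Proof.
elim: n => //= n IH a x y.
by rewrite !(linD IH, linZ IH) scalerBr opprD addrACA.
Qed.

Lemma riesz_seq_comm n x : P n (B x) = B (P n x).
Proof.
by elim: n x => //= n IH x; rewrite !IH (linB (bounded_lin B_bounded)).
Qed.

Lemma riesz_seq_bounds n :
  positive_op (P n) /\ forall x, '[P n x, x] <= '[x, x].
Proof.
elim: n => //= n [Ppos Ple]; split=> x.
  (* P - P^2 = P (1 - P) P + (1 - P) P (1 - P) *)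
  have -> : '[P n x - P n (P n x), x] =
      ('[P n x, P n x] - '[P n (P n x), P n x])
      + '[P n (x - P n x), x - P n x].
    by rewrite (linB (riesz_seq_linear n)) !ipE; ring.
  by rewrite addr_ge0 ?Ppos // subr_ge0 Ple.
rewrite !ipE (positive_sym (riesz_seq_linear n) Ppos (P n x)).
by rewrite lerBlDr ler_wpDr ?ipxx_ge0 // Ple.
Qed.

Lemma riesz_seq_sum n x :
  '[A x, x] = \sum_(k < n) '[P k x, P k x] + '[P n x, x].
Proof.
elim: n => [|n ->]; first by rewrite big_ord0 add0r.
rewrite big_ord_recr /= -addrA; congr (_ + _); rewrite !ipE.
have [Ppos _] := riesz_seq_bounds n.
by rewrite (positive_sym (riesz_seq_linear n) Ppos (P n x)); ring.
Qed.

Lemma riesz_seq_sum_comm n x :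
  '[A (B x), x] = \sum_(k < n) '[B (P k x), P k x] + '[B (P n x), x].
Proof.
elim: n => [|n ->]; first by rewrite big_ord0 add0r AB.
rewrite big_ord_recr /= -addrA; congr (_ + _).
have [Ppos _] := riesz_seq_bounds n.
rewrite (linB (bounded_lin B_bounded)) !ipE.
by rewrite -(riesz_seq_comm _ (P n x)) (positive_sym (riesz_seq_linear n) Ppos); ring.
Qed.

Lemma riesz_seq_small (e : R) x : 0 < e -> exists n, hnorm (P n x) < e.
Proof.
move=> e0; set M := hnorm x ^+ 2 / e ^+ 2.
have M0 : 0 <= M by rewrite divr_ge0 ?sqr_ge0.
apply: contrapT => /forallNP small; suff : M < M by rewrite ltxx.
apply: lt_le_trans (archi_boundP M0) _.
rewrite ler_pdivlMr ?exprn_gt0 // -lecR hnorm_sqrC.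
apply: le_trans (A_le1 x); rewrite (riesz_seq_sum (Num.bound M)).
apply: ler_wpDr; first by have [Ppos _] := riesz_seq_bounds (Num.bound M).
rewrite rmorphM /= rmorph_nat mulr_natl -[X in _ *+ X]card_ord -sumr_const.
apply: ler_sum => k _; rewrite -hnorm_sqrC lecR.
by rewrite ler_pXn2r ?nnegrE ?hnorm_ge0 ?(ltW e0) // leNgt; apply/negP/small.
Qed.

Lemma contraction_product_positive : positive_op (A \o B).
Proof.
have [M M0 hM] := bounded_nonneg B_bounded.
move=> x; apply: ge0_closed => e e0.
have d0 : 0 < e / (M * hnorm x + 1).
  by rewrite divr_gt0 // ltr_wpDl // mulr_ge0 ?hnorm_ge0.
have [n hn] := riesz_seq_small x d0.
exists (\sum_(k < n) '[B (P k x), P k x]); first by apply: sumr_ge0 => k _; exact: B_pos.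
rewrite /= (riesz_seq_sum_comm n) addrC addKr.
apply: le_trans (cauchy_schwarz _ _) _.
apply: (@le_trans _ _ (M * hnorm x * hnorm (P n x))).
  by rewrite mulrAC ler_wpM2r ?hnorm_ge0.
apply: (@le_trans _ _ ((M * hnorm x + 1) * hnorm (P n x))).
  by rewrite ler_wpM2r ?hnorm_ge0 // lerDl.
by move/ltW: hn; rewrite ler_pdivlMr ?ltr_wpDl ?mulr_ge0 ?hnorm_ge0 // mulrC.
Qed.

End Contraction.

Lemma commuting_product_positive (A B : L -> L) :
  bounded_op A -> bounded_op B -> positive_op A -> positive_op B ->
  (forall x, A (B x) = B (A x)) -> positive_op (A \o B).
Proof.
move=> Ab Bb A0 B0 AB; have [M M0 hM] := bounded_nonneg Ab.
have M1 : 0 < M + 1 by rewrite ltr_wpDl.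
pose c := (M + 1)^-1%:C : R[i].
have c0 : 0 < c by rewrite ltcR invr_gt0.
have cAb : bounded_op (c *: A) by exact: bounded_scale.
have cA0 : positive_op (c *: A).
  by move=> x; rewrite ipZl mulr_ge0 ?(ltW c0).
have cA1 x : '[(c *: A) x, x] <= '[x, x].
  have /ge0_ReIm[cAx _] := cA0 x; have /ge0_ReIm[xx _] := ipxx_ge0 x.
  rewrite lecE cAx xx eqxx /= -hnorm_sqr.
  apply: le_trans (ler_norm _) (le_trans (Re_le_cnorm _) _).
  rewrite ipZl cnormM cnormR ?invr_ge0 ?(ltW M1) // ler_pdivrMl //.
  apply: le_trans (cauchy_schwarz _ _) _.
  rewrite expr2 mulrA ler_wpM2r ?hnorm_ge0 //; apply: le_trans (hM x) _.
  by rewrite ler_wpM2r ?hnorm_ge0 // lerDl.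
have h := @contraction_product_positive (c *: A) B (bounded_lin cAb) Bb cA0 cA1 B0.
move=> x; have := h _ x; rewrite /= ipZl pmulr_rge0 //; apply=> y.
by rewrite (linZ (bounded_lin Bb)) -AB.
Qed.

End CommutingProduct.

(** * Ampliations and Schur products *)

Section Ampliation.
Variables (R : realType) (H : hilbert R).

Definition ampl n (T : H -> H) : hsum n H -> hsum n H :=
  fun v : {ffun 'I_n -> H} => [ffun i => T (v i)].
Arguments ampl n T v : clear implicits.

Definition diag_op n (T : H -> H) : 'M[H -> H]_n :=
  \matrix_(i, j) (if i == j then T else 0).

Lemma op_mx_diag n (T : H -> H) : op_mx (diag_op n T) = ampl n T.
Proof.
apply/funext => v; apply/ffunP => i; rewrite !ffunE (bigD1 i) //= mxE eqxx.
rewrite big1 ?addr0 // => j ji.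
by rewrite mxE eq_sym (negPf ji).
Qed.

Lemma diag_op_bounded n (T : H -> H) : bounded_op T ->
  forall i j, bounded_op (diag_op n T i j).
Proof. by move=> Tb i j; rewrite mxE; case: ifP => // _; exact: bounded_zero. Qed.

Lemma ampl_bounded n (T : H -> H) : bounded_op T -> bounded_op (ampl n T).
Proof. by move=> Tb; rewrite -op_mx_diag; exact/op_mx_bounded/diag_op_bounded. Qed.

Lemma ampl_positive n (T : H -> H) : positive_op T -> positive_op (ampl n T).
Proof.
by move=> T0 v; rewrite hsum_ipE; apply: sumr_ge0 => i _; rewrite ffunE.
Qed.

Lemma amplZD n c (S T : H -> H) :
  ampl n (c *: S + T) = c *: ampl n S + ampl n T.
Proof. by apply/funext => v; apply/ffunP => i; rewrite !ffunE. Qed.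

Lemma ampl_comp n (S T : H -> H) : ampl n (S \o T) = ampl n S \o ampl n T.
Proof. by apply/funext => v; apply/ffunP => i; rewrite !ffunE. Qed.

Lemma ampl_id n : ampl n (idfun : H -> H) = idfun.
Proof. by apply/funext => v; apply/ffunP => i; rewrite !ffunE. Qed.

Lemma op_mx_ampl n k (X : 'M[H -> H]_n) (v : {ffun 'I_n -> hsum k H}) i r :
  ((op_mx (map_mx (ampl k) X) v : {ffun _ -> hsum k H}) i : {ffun _ -> H}) r
  = \sum_(j < n) X i j ((v j : {ffun _ -> H}) r).
Proof.
by rewrite op_mxE sum_ffunE; apply: eq_bigr => j _; rewrite !mxE ffunE.
Qed.

Lemma op_mx_ampl_positive n k (X : 'M[H -> H]_n) :
  positive_op (op_mx X) -> positive_op (op_mx (map_mx (ampl k) X)).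
Proof.
move=> X0 v.
suff -> : ip (hsum n (hsum k H)) (op_mx (map_mx (ampl k) X) v) v =
  \sum_(r < k) ip (hsum n H) (op_mx X
     [ffun i => ((v : {ffun _ -> hsum k H}) i : {ffun _ -> H}) r])
     [ffun i => ((v : {ffun _ -> hsum k H}) i : {ffun _ -> H}) r].
  by apply: sumr_ge0 => r _; exact: X0.
under [RHS]eq_bigr => r _ do rewrite hsum_ipE.
rewrite hsum_ipE exchange_big; apply: eq_bigr => r _; apply: eq_bigr => i _.
rewrite op_mx_ampl op_mxE !ffunE; congr (ip H _ _).
by apply: eq_bigr => j _; rewrite ffunE.
Qed.

(** Evaluates the form of [X] at the vector that sums, for each [i], the
    entries of [v] over the fibre of [tau] at [i]; this allows repeated and
    omitted indices. *)
Lemma op_mx_pullback_positive n m (tau : 'I_m -> 'I_n) (X : 'M[H -> H]_n) :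
  (forall i j, linear (X i j)) -> positive_op (op_mx X) ->
  positive_op (op_mx (\matrix_(p, q) X (tau p) (tau q))).
Proof.
move=> Xl X0 v.
pose w : {ffun 'I_n -> H} :=
  [ffun i => \sum_(p | tau p == i) (v : {ffun _ -> H}) p].
have Xw p : (op_mx X w : {ffun _ -> H}) (tau p) =
    (op_mx (\matrix_(p, q) X (tau p) (tau q)) v : {ffun _ -> H}) p.
  rewrite !op_mxE [RHS](partition_big tau xpredT) //=.
  apply: eq_bigr => j _; rewrite ffunE (linS (Xl _ _)).
  by apply: eq_bigr => q /eqP <-; rewrite mxE.
have := X0 w; rewrite !hsum_ipE; congr (0 <= _).
rewrite [RHS](partition_big tau xpredT) //=; apply: eq_bigr => i _.
rewrite [w i]ffunE ip_sumr; apply: eq_bigr => p /eqP <-.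
by rewrite Xw.
Qed.

End Ampliation.
Arguments ampl {R H} n T v.

Section SchurProduct.
Variables (R : realType) (H : hilbert R).

(** The Schur product of two families is the compression of the product of
    their ampliations [A (x) 1] and [1 (x) B] to the diagonal copy of the
    space; these commute when the two families do. *)
Lemma schur_product_positive m (A B : 'M[H -> H]_m) :
  (forall p q, bounded_op (A p q)) -> (forall p q, bounded_op (B p q)) ->
  (forall p q r s x, A p q (B r s x) = B r s (A p q x)) ->
  positive_op (op_mx A) -> positive_op (op_mx B) ->
  positive_op (op_mx (\matrix_(p, q) (A p q \o B p q))).
Proof.
move=> Ab Bb AB A0 B0 v.
pose A1 := op_mx (map_mx (ampl m) A); pose B1 := ampl m (op_mx B).
have A1B1 : positive_op (A1 \o B1).
  apply: commuting_product_positive.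
  - by apply: op_mx_bounded => p q; rewrite mxE; exact: ampl_bounded.
  - exact/ampl_bounded/op_mx_bounded.
  - exact: op_mx_ampl_positive.
  - exact: ampl_positive.
  move=> x; apply/ffunP => p; apply/ffunP => r.
  rewrite op_mx_ampl ffunE op_mxE.
  under [RHS]eq_bigr => s _ do rewrite op_mx_ampl (linS (bounded_lin (Bb _ _))).
  rewrite exchange_big /=; apply: eq_bigr => q _.
  rewrite ffunE op_mxE (linS (bounded_lin (Ab _ _))).
  by apply: eq_bigr => s _; rewrite AB.
pose w : {ffun 'I_m -> hsum m H} :=
  [ffun p => [ffun r => if p == r then (v : {ffun _ -> H}) p else 0]].
have := A1B1 w; congr (0 <= _).
have diag (F : 'I_m -> H) (x : H) p :
    \sum_r ip H (F r) (if p == r then x else 0) = ip H (F p) x.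
  rewrite (bigD1 p) //= eqxx big1 ?addr0 // => r rp.
  by rewrite eq_sym (negPf rp) ip0r.
rewrite !hsum_ipE; apply: eq_bigr => p _; rewrite hsum_ipE.
under eq_bigr => r _ do rewrite [w p]ffunE [X in ip H _ X]ffunE.
rewrite diag op_mx_ampl op_mxE; congr (ip H _ _); apply: eq_bigr => q _.
rewrite mxE /= ffunE op_mxE (bigD1 q) //= big1 ?addr0 => [|r rq].
  by rewrite !ffunE eqxx.
by rewrite !ffunE eq_sym (negPf rq) (lin0 (bounded_lin (Bb _ _))).
Qed.

End SchurProduct.

(** * Unital completely positive maps *)

Section BlockOperators.
Variables (R : realType) (H : hilbert R).

(** The identification of H^n (+) H^n with H^(n + n). *)
Definition hjoin n (u w : {ffun 'I_n -> H}) : {ffun 'I_(n + n) -> H} :=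
  [ffun i => match fintype.split i with inl j => u j | inr j => w j end].

Lemma hjoinl n (u w : {ffun 'I_n -> H}) (i : 'I_n) : hjoin u w (lshift n i) = u i.
Proof. by rewrite ffunE (unsplitK (inl i : 'I_n + 'I_n)). Qed.

Lemma hjoinr n (u w : {ffun 'I_n -> H}) (i : 'I_n) : hjoin u w (rshift n i) = w i.
Proof. by rewrite ffunE (unsplitK (inr i : 'I_n + 'I_n)). Qed.

Lemma hjoinP n (v : {ffun 'I_(n + n) -> H}) :
  v = hjoin [ffun i => v (lshift n i)] [ffun i => v (rshift n i)].
Proof.
apply/ffunP => i; rewrite ffunE -{1}(splitK i).
by case: (fintype.split i) => j; rewrite ffunE.
Qed.

Lemma ip_hjoin n (u w u' w' : {ffun 'I_n -> H}) :
  ip (hsum (n + n) H) (hjoin u w) (hjoin u' w')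
  = ip (hsum n H) u u' + ip (hsum n H) w w'.
Proof.
rewrite !hsum_ipE big_split_ord /=; congr (_ + _); apply: eq_bigr => i _.
  by rewrite !hjoinl.
by rewrite !hjoinr.
Qed.

Lemma op_mx_block n (A B C D : 'M[H -> H]_n) (u w : {ffun 'I_n -> H}) :
  op_mx (block_mx A B C D) (hjoin u w) =
  hjoin ((op_mx A u : hsum n H) + op_mx B w) ((op_mx C u : hsum n H) + op_mx D w).
Proof.
apply/ffunP => i; rewrite op_mxE big_split_ord /= -(splitK i).
case: (fintype.split i) => k /=.
  rewrite hjoinl ffunE !op_mxE; congr (_ + _); apply: eq_bigr => j _.
    by rewrite block_mxEul hjoinl.
  by rewrite block_mxEur hjoinr.
rewrite hjoinr ffunE !op_mxE; congr (_ + _); apply: eq_bigr => j _.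
  by rewrite block_mxEdl hjoinl.
by rewrite block_mxEdr hjoinr.
Qed.

End BlockOperators.

Section SubspaceMaps.
Variables (R : realType) (V W : lmodType R[i]) (S : set V).
Hypothesis S_subspace : Defs.subspace S.

Lemma sub0 : S 0. Proof. by move: S_subspace => []. Qed.

Lemma subZD c x y : S x -> S y -> S (c *: x + y).
Proof. by move: S_subspace => [_ h]; exact: h. Qed.

Lemma subZ c x : S x -> S (c *: x).
Proof. by move=> Sx; rewrite -[_ *: _]addr0; apply: subZD => //; exact: sub0. Qed.

Variable f : V -> W.
Hypothesis f_linear : linear_on S f.

Lemma lin_on0 : f 0 = 0.
Proof.
have /eqP := f_linear 1 sub0 sub0.
by rewrite !scale1r add0r -subr_eq0 opprD addNKr oppr_eq0 => /eqP.
Qed.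

Lemma lin_onZ c x : S x -> f (c *: x) = c *: f x.
Proof.
by move=> Sx; rewrite -{1}[c *: x]addr0 (f_linear _ Sx sub0) lin_on0 addr0.
Qed.

End SubspaceMaps.

Section CompletelyPositive.
Variables (R : realType) (H L : hilbert R) (S : set (H -> H)).
Variable phi : (H -> H) -> (L -> L).
Hypotheses (S_system : operator_system S) (phi_ucp : ucp S phi).

Let S_sub := os_subspace S_system.
Let phi_lin := ucp_linear phi_ucp.

Lemma adjoint_entries n (X : 'M[H -> H]_n) : entries_in S X ->
  exists2 Y : 'M[H -> H]_n, entries_in S Y &
    forall i j, adjoint_op (X i j) (Y j i).
Proof.
move=> SX.
have /choice[g hg] : forall ij : 'I_n * 'I_n, exists y : H -> H, S y /\
    adjoint_op (X ij.1 ij.2) y.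
  by move=> ij; have [y Sy hy] := os_adjoint S_system (SX ij.1 ij.2); exists y.
exists (\matrix_(i, j) g (j, i)) => i j; rewrite mxE; first by case: (hg (j, i)).
by case: (hg (i, j)).
Qed.

(** Paulsen's trick: the bound [c] on the norm of [X] is the positivity of the
    block matrix [[c, X], [X^*, c]], which a completely positive map
    preserves. Both the compatibility of [phi] with adjoints and its complete
    contractivity are read off from the resulting form. *)
Lemma ucp_block n (X Y : 'M[H -> H]_n) (c : R) (u w : {ffun 'I_n -> L}) :
  entries_in S X -> entries_in S Y ->
  (forall i j, adjoint_op (X i j) (Y j i)) -> 0 <= c ->
  (forall v, hnorm (op_mx X v) <= c * hnorm v) ->
  0 <= c%:C * ip (hsum n L) u u + ip (hsum n L) (op_mx (map_mx phi X) w) u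
       + ip (hsum n L) (op_mx (map_mx phi Y) u) w + c%:C * ip (hsum n L) w w.
Proof.
move=> SX SY XY c0 Xc.
have S1 : S (c%:C *: idfun) by apply: subZ => //; exact: os_unit.
pose D := diag_op n (c%:C *: (idfun : H -> H)).
have SD : entries_in S D by move=> i j; rewrite mxE; case: ifP => // _; exact: sub0.
have phiD : op_mx (map_mx phi D) = ampl n (c%:C *: (idfun : L -> L)).
  rewrite -op_mx_diag; congr op_mx; apply/matrixP => i j; rewrite !mxE.
  case: ifP => _; last exact: (lin_on0 S_sub).
  by rewrite (lin_onZ S_sub phi_lin) ?(ucp_unital phi_ucp) //; exact: os_unit.
have SB : entries_in S (block_mx D X Y D).
  move=> i j; rewrite -(splitK i) -(splitK j).
  by case: (fintype.split i) (fintype.split j) => i' [] j' /=;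
    rewrite ?block_mxEul ?block_mxEur ?block_mxEdl ?block_mxEdr.
have B0 : positive_op (op_mx (block_mx D X Y D)).
  move=> v; rewrite [v]hjoinP; set a := [ffun _ => _]; set b := [ffun _ => _].
  rewrite op_mx_block ip_hjoin op_mx_diag !(ipDl (H := hsum n H)).
  have amplE x : ampl n (c%:C *: (idfun : H -> H)) x = c%:C *: x.
    by apply/ffunP => i; rewrite !ffunE.
  have YX : ip (hsum n H) (op_mx Y a) b = Num.conj (ip (hsum n H) (op_mx X b) a).
    by rewrite ipC (op_mx_adjoint XY).
  rewrite !amplE !ipZl YX -!hnorm_sqrC; set z := ip (hsum n H) _ _.
  apply/ge0_ReIm; rewrite !ReImE /=; split; first by ring.
  have : cnorm z <= c * @hnorm R (hsum n H) b * @hnorm R (hsum n H) a.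
    apply: le_trans (cauchy_schwarz _ _) _.
    by rewrite ler_wpM2r ?hnorm_ge0 // Xc.
  have := Re_le_cnorm z; rewrite ler_norml => /andP[h1 _] h2.
  have : 0 <= c * (@hnorm R (hsum n H) a - @hnorm R (hsum n H) b) ^+ 2.
    by rewrite mulr_ge0 ?sqr_ge0.
  move: h1 h2; set A := hnorm _; set B := hnorm _; nra.
have := ucp_positive phi_ucp SB B0 (hjoin u w).
rewrite map_block_mx op_mx_block ip_hjoin phiD !ipDl.
have amplE x : ampl n (c%:C *: (idfun : L -> L)) x = c%:C *: x.
  by apply/ffunP => i; rewrite !ffunE.
by rewrite !amplE !ipZl !addrA.
Qed.

(** The form of [ucp_block] is real at every pair of vectors; replacing one of
    them by ['i] times itself separates its two cross terms. *)
Lemma ucp_adjoint x y : S x -> S y -> adjoint_op x y ->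
  adjoint_op (phi x) (phi y).
Proof.
move=> Sx Sy xy; pose c1 := fun z : H -> H => const_mx z : 'M[H -> H]_1.
have S1 z : S z -> entries_in S (c1 z) by move=> Sz i j; rewrite mxE.
have op1 (K : hilbert R) (z : K -> K) (v : K) :
    op_mx (const_mx z : 'M_1) [ffun=> v] = [ffun=> z v] :> {ffun 'I_1 -> K}.
  by apply/ffunP => i; rewrite op_mxE big_ord1 mxE !ffunE.
have ip1 (K : hilbert R) (v w : K) :
    ip (hsum 1 K) ([ffun=> v] : {ffun _ -> K}) ([ffun=> w] : {ffun _ -> K}) = ip K v w.
  by rewrite hsum_ipE big_ord1 !ffunE.
have [M M0 hM] : exists2 M : R, 0 <= M & forall v, hnorm (op_mx (c1 x) v) <= M * hnorm v.
  apply: bounded_nonneg; apply: op_mx_bounded => i j; rewrite mxE.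
  exact: (os_bounded S_system).
have real u w : complex.Im (ip L (phi x w) u) + complex.Im (ip L (phi y u) w) = 0.
  have := @ucp_block _ (c1 x) (c1 y) M [ffun=> u] [ffun=> w] (S1 _ Sx) (S1 _ Sy) _ M0 hM.
  rewrite /c1 !map_const_mx !op1 !ip1 -!hnorm_sqrC.
  case/(_ _)/ge0_ReIm => [i j|]; first by rewrite !mxE.
  rewrite !ReImE /= => + _; lra.
move=> w u; have h1 := real u w; have := real u ('i *: w).
rewrite (linZ (bounded_lin (ucp_bounded phi_ucp Sx))) !ipE !ReImE /= => h2.
rewrite (ipC w); apply: complexP; rewrite !ReImE; lra.
Qed.

(** Taking [u] in [ucp_block] to be a multiple of the image of [w] makes the
    positive form a quadratic polynomial in the multiplier, and the bound is
    its discriminant. *)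
Lemma ucp_contractive n (X : 'M[H -> H]_n) (c : R) : entries_in S X -> 0 <= c ->
  (forall v, hnorm (op_mx X v) <= c * hnorm v) ->
  forall w, hnorm (op_mx (map_mx phi X) w) <= c * hnorm w.
Proof.
move=> SX c0 Xc w; have [Y SY XY] := adjoint_entries SX.
set Yw := op_mx (map_mx phi X) w; set N := hnorm Yw.
have adj : adjoint_op (op_mx (map_mx phi X)) (op_mx (map_mx phi Y)).
  by apply: op_mx_adjoint => i j; rewrite !mxE; exact: ucp_adjoint.
have : cnorm (ip (hsum n L) Yw Yw) ^+ 2 <= (c * hnorm w ^+ 2) * (c * N ^+ 2).
  apply: discriminant_le => [||t]; try exact: mulr_ge0 c0 (sqr_ge0 _).
  have := ucp_block (Num.conj t *: (Yw : hsum n L)) w SX SY XY c0 Xc.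
  rewrite -/Yw (ipC _ w) -(adj w) -/Yw !(ipZl, ipZr) conjCK -!hnorm_sqrC -/N.
  by move=> /ge0_ReIm[_]; rewrite cnorm_sqr !ReImE /=; lra.
rewrite -hnorm_sqrC cnormR ?sqr_ge0 // -/N => h.
have w0 : 0 <= hnorm w by exact: hnorm_ge0.
have [N0|N0] := eqVneq N 0; first by rewrite N0 mulr_ge0.
have N_gt0 : 0 < N by rewrite lt0r N0 hnorm_ge0.
rewrite -(@ler_pXn2r _ 2) ?nnegrE ?mulr_ge0 ?hnorm_ge0 ?(ltW N_gt0) //.
by rewrite -(ler_pM2r (exprn_gt0 2 N_gt0)); move: h; congr (_ <= _); ring.
Qed.

Lemma ucp_opnorm n (X : 'M[H -> H]_n) : entries_in S X ->
  (opnorm (op_mx (map_mx phi X)) <= opnorm (op_mx X))%E.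
Proof.
move=> SX; apply: opnorm_mono => [|c c0 Xc]; last exact: ucp_contractive.
by apply/bounded_lin/op_mx_bounded => i j; exact: (os_bounded S_system).
Qed.

End CompletelyPositive.

(** * Density arguments *)

Section Density.
Variable R : realType.
Implicit Types H K : hilbert R.

Definition dense_set H (D : set H) : Prop :=
  forall x (e : R), 0 < e -> exists2 y, D y & hnorm (x - y) < e.

Lemma dense_hsum H (D : set H) n : dense_set D ->
  dense_set [set v : hsum n H | forall i, D ((v : {ffun 'I_n -> H}) i)].
Proof.
move=> Dd v e e0; have d0 : 0 < e / n.+1%:R by rewrite divr_gt0 ?ltr0n.
have /choice[w hw] : forall i, exists y : H,
    D y /\ hnorm ((v : {ffun 'I_n -> H}) i - y) < e / n.+1%:R.
  by move=> i; have [y Dy hy] := Dd ((v : {ffun 'I_n -> H}) i) _ d0; exists y.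
exists (finfun w) => [i /=|]; first by rewrite ffunE; case: (hw i).
apply: le_lt_trans (hsum_norm_le _) _.
apply: (@le_lt_trans _ _ (\sum_(i < n) e / n.+1%:R)).
  by apply: ler_sum => i _; rewrite !ffunE; case: (hw i) => _ /ltW.
rewrite sumr_const card_ord -[ltLHS]mulr_natr -mulrA gtr_pMr //.
by rewrite mulrC ltr_pdivrMr ?ltr0n // mul1r ltr_nat.
Qed.

Lemma positive_dense H (T : H -> H) (D : set H) : bounded_op T ->
  dense_set D -> (forall x, D x -> 0 <= ip H (T x) x) -> positive_op T.
Proof.
move=> Tb Dd TD x; have [M M0 hM] := bounded_nonneg Tb.
apply: ge0_closed => e e0; set C := M * (2 * hnorm x + 1).
have C0 : 0 <= C by rewrite mulr_ge0 // addr_ge0 // mulr_ge0 ?hnorm_ge0.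
have [|y Dy] := Dd x (Num.min 1 (e / (C + 1))).
  by rewrite lt_min ltr01 divr_gt0 // ltr_wpDl.
set d := hnorm (x - y) => hd; exists (ip H (T y) y); first exact: TD.
move: hd; rewrite lt_min ltr_pdivlMr ?ltr_wpDl // => /andP[/ltW d1 /ltW dC].
have d0 : 0 <= d by exact: hnorm_ge0.
have -> : ip H (T x) x - ip H (T y) y =
    ip H (T (x - y)) x + ip H (T y) (x - y).
  by rewrite (linB (bounded_lin Tb)) !ipE; ring.
have y_le : hnorm y <= hnorm x + d.
  by have := hnormD x (y - x); rewrite [x + _]addrC subrK hnormB.
apply: le_trans (cnormD _ _) _.
have h1 : cnorm (ip H (T (x - y)) x) <= M * d * hnorm x.
  by apply: le_trans (cauchy_schwarz _ _) _; rewrite ler_wpM2r ?hnorm_ge0 ?hM.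
have h2 : cnorm (ip H (T y) (x - y)) <= M * (hnorm x + d) * d.
  apply: le_trans (cauchy_schwarz _ _) _; rewrite ler_wpM2r //.
  by apply: le_trans (hM _) _; rewrite ler_wpM2l.
apply: le_trans (lerD h1 h2) _; apply: le_trans dC.
have : M * d * d <= M * d * 1 by rewrite ler_wpM2l // mulr_ge0.
rewrite /C; nra.
Qed.

Lemma eq_on_dense H K (S T : H -> K) (D : set H) : bounded_op S ->
  bounded_op T -> dense_set D -> (forall x, D x -> S x = T x) -> S = T.
Proof.
move=> Sb Tb Dd ST; apply/funext => x; apply/eqP; rewrite -subr_eq0.
apply/eqP/hnorm_eq0/eqP; rewrite eq_le hnorm_ge0 andbT; apply: le_eps => e e0.
have [M M0 hM] := bounded_nonneg Sb; have [N N0 hN] := bounded_nonneg Tb.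
have C0 : 0 < M + N + 1 by rewrite ltr_wpDl ?addr_ge0.
have [|y Dy] := Dd x (e / (M + N + 1)); first by rewrite divr_gt0.
rewrite ltr_pdivlMr // => /ltW hy.
have -> : S x - T x = S (x - y) - T (x - y).
  rewrite (linB (bounded_lin Sb)) (linB (bounded_lin Tb)) (ST y Dy).
  by rewrite opprB addrA subrK.
apply: le_trans (hnormD _ _) _; rewrite hnormN.
apply: le_trans (lerD (hM _) (hN _)) _; rewrite add0r; apply: le_trans hy.
rewrite -mulrDl [leRHS]mulrC ler_wpM2r ?hnorm_ge0 // lerDl //.
Qed.

End Density.

(** * The Hilbert space of a positive kernel *)

(** Positivity is required of the Gram form of every finite combination; lists
    of coefficients and points may repeat points. *)
Record psd_kernel (R : realType) (X : Type) := PsdKernel {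
  kernel :> X -> X -> R[i];
  kernelC : forall x y, kernel x y = Num.conj (kernel y x);
  kernel_psd : forall t : seq (R[i] * X),
    0 <= \sum_(p <- t) \sum_(q <- t) Num.conj p.1 * (q.1 * kernel q.2 p.2)
}.

Section KernelSpace.
Variables (R : realType) (X : Type) (k : psd_kernel R X).
Implicit Types (s t : seq (R[i] * X)) (F G : X -> R[i]) (c : R).
Local Notation Re := complex.Re.

(** A list [t] stands for the combination of the functions [k x], of which
    [comb t] is the value; [pairing F] is the functional that the inner product
    with [F] will be, so that [pairing (comb s) t] is the Gram form. *)
Definition comb t : X -> R[i] := fun y => \sum_(p <- t) p.1 * k p.2 y.

Definition pairing F t : R[i] := \sum_(p <- t) Num.conj p.1 * F p.2.

Definition scale_comb (a : R[i]) t := [seq (a * p.1, p.2) | p <- t].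

Definition comb_norm t : R := Num.sqrt (Re (pairing (comb t) t)).

Lemma comb_cat s t : comb (s ++ t) = comb s + comb t.
Proof. by apply/funext => y; rewrite /comb big_cat. Qed.

Lemma comb_scale a t : comb (scale_comb a t) = a *: comb t.
Proof.
apply/funext => y; rewrite /comb /scale_comb big_map.
have -> : (a *: comb t) y = a * comb t y by [].
by rewrite mulr_sumr; apply: eq_bigr => p _; rewrite mulrA.
Qed.

Lemma pairing_cat F s t : pairing F (s ++ t) = pairing F s + pairing F t.
Proof. by rewrite /pairing big_cat. Qed.

Lemma pairing_scale F a t : pairing F (scale_comb a t) = Num.conj a * pairing F t.
Proof.
rewrite /pairing /scale_comb big_map mulr_sumr.
by apply: eq_bigr => p _; rewrite rmorphM mulrA.
Qed.

Lemma pairing_lin a F G t :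
  pairing (a *: F + G) t = a * pairing F t + pairing G t.
Proof.
rewrite /pairing mulr_sumr -big_split; apply: eq_bigr => p _ /=.
have -> : (a *: F + G) p.2 = a * F p.2 + G p.2 by [].
by ring.
Qed.

Lemma pairingD F G t : pairing (F + G) t = pairing F t + pairing G t.
Proof. by rewrite -[F]scale1r pairing_lin mul1r scale1r. Qed.

Lemma pairing0 t : pairing 0 t = 0.
Proof. by rewrite /pairing big1 // => p _; rewrite mulr0. Qed.

Lemma pairingZ a F t : pairing (a *: F) t = a * pairing F t.
Proof. by rewrite -[a *: F]addr0 pairing_lin pairing0 addr0. Qed.

Lemma pairingB F G t : pairing (F - G) t = pairing F t - pairing G t.
Proof. by rewrite pairingD -scaleN1r pairingZ mulN1r. Qed.

Lemma pairing1 F x : pairing F [:: (1, x)] = F x.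
Proof. by rewrite /pairing big_seq1 rmorph1 mul1r. Qed.

Lemma gramC s t : pairing (comb s) t = Num.conj (pairing (comb t) s).
Proof.
rewrite /pairing /comb rmorph_sum.
under eq_bigr => p _ do rewrite mulr_sumr.
under [RHS]eq_bigr => p _ do rewrite rmorphM /= conjCK rmorph_sum mulr_sumr.
rewrite exchange_big; apply: eq_bigr => p _; apply: eq_bigr => q _.
by rewrite rmorphM /= -kernelC; ring.
Qed.

Lemma gram_ge0 t : 0 <= pairing (comb t) t.
Proof.
have := kernel_psd k t; congr (0 <= _); apply: eq_bigr => p _.
by rewrite mulr_sumr.
Qed.

Lemma comb_norm_ge0 t : 0 <= comb_norm t. Proof. exact: sqrtr_ge0. Qed.

Lemma comb_norm_sqr t : comb_norm t ^+ 2 = Re (pairing (comb t) t).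
Proof. by rewrite sqr_sqrtr //; have /ge0_ReIm[] := gram_ge0 t. Qed.

Lemma comb_norm_sqrC t : (comb_norm t ^+ 2)%:C = pairing (comb t) t.
Proof.
rewrite comb_norm_sqr; have /ge0_ReIm[h _] := gram_ge0 t.
by apply: complexP; rewrite //= h.
Qed.

Lemma gram_cauchy_schwarz s t :
  cnorm (pairing (comb s) t) <= comb_norm s * comb_norm t.
Proof.
rewrite -(@ler_pXn2r _ 2) ?nnegrE ?cnorm_ge0 ?mulr_ge0 ?comb_norm_ge0 //.
rewrite exprMn; apply: discriminant_le; rewrite ?sqr_ge0 // => a.
have := sqr_ge0 (comb_norm (s ++ scale_comb (Num.conj a) t)).
rewrite comb_norm_sqr comb_cat comb_scale pairingD pairingZ !pairing_cat.
rewrite !pairing_scale conjCK (gramC t s) -!comb_norm_sqrC cnorm_sqr !ReImE /=.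
lra.
Qed.

(** ** Functionals dominated by the norm of combinations *)

Definition dominated F c : Prop :=
  0 <= c /\ forall s, cnorm (pairing F s) <= c * comb_norm s.

Lemma dominated0 : dominated 0 0.
Proof. by split=> // s; rewrite pairing0 cnorm0 mul0r. Qed.

Lemma dominated_lin a F G c d : dominated F c -> dominated G d ->
  dominated (a *: F + G) (cnorm a * c + d).
Proof.
move=> [c0 hF] [d0 hG]; split=> [|s].
  by rewrite addr_ge0 // mulr_ge0 ?cnorm_ge0.
rewrite pairing_lin; apply: le_trans (cnormD _ _) _.
by rewrite cnormM mulrDl lerD // -mulrA ler_wpM2l ?cnorm_ge0.
Qed.

Lemma dominatedD F G c d : dominated F c -> dominated G d ->
  dominated (F + G) (c + d).
Proof.
move=> hF hG; have := dominated_lin 1 hF hG.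
by rewrite scale1r cnormR // mul1r.
Qed.

Lemma dominatedN F c : dominated F c -> dominated (- F) c.
Proof.
move=> hF; have := dominated_lin (-1) hF dominated0.
by rewrite scaleN1r !addr0 cnormN cnormR // mul1r.
Qed.

Lemma dominated_le F c d : c <= d -> dominated F c -> dominated F d.
Proof.
move=> cd [c0 h]; split=> [|s]; first exact: le_trans cd.
by apply: le_trans (h s) _; rewrite ler_wpM2r ?comb_norm_ge0.
Qed.

Lemma dominated_comb t : dominated (comb t) (comb_norm t).
Proof. by split=> [|s]; [exact: comb_norm_ge0|exact: gram_cauchy_schwarz]. Qed.

Lemma comb_norm_dominated t c : dominated (comb t) c -> comb_norm t <= c.
Proof.
move=> [c0 /(_ t)]; rewrite -comb_norm_sqrC cnormR ?sqr_ge0 // expr2.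
have [->//|t0] := eqVneq (comb_norm t) 0.
by rewrite ler_pM2r // lt0r t0 comb_norm_ge0.
Qed.

(** The completion consists of functions rather than of classes of Cauchy
    sequences: a functional is determined by its values at the points, and
    combinations of norm zero vanish as functions. *)
Definition in_kernel_space F : Prop :=
  forall e : R, 0 < e -> exists t, dominated (F - comb t) e.

Definition kernel_space_pred : {pred X -> R[i]} :=
  fun F => `[< in_kernel_space F >].

Fact kernel_space_submod_closed : submod_closed kernel_space_pred.
Proof.
split=> [|a F G /asboolP hF /asboolP hG]; apply/asboolP => e e0.
  exists [::]; have -> : comb [::] = 0.
    by apply/funext => y; rewrite /comb big_nil.
  by rewrite subr0; apply: dominated_le (dominated0); exact: ltW.
have d0 : 0 < e / (cnorm a + 1) by rewrite divr_gt0 // ltr_wpDl ?cnorm_ge0.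
have [s hs] := hF _ d0; have [t ht] := hG _ d0.
exists (scale_comb a s ++ t); rewrite comb_cat comb_scale.
have -> : a *: F + G - (a *: comb s + comb t) = a *: (F - comb s) + (G - comb t).
  by rewrite scalerBr opprD addrACA.
apply: dominated_le (dominated_lin a hs ht).
by rewrite -[X in _ + X]mul1r -mulrDl mulrC mulfVK // gt_eqF // ltr_wpDl ?cnorm_ge0.
Qed.

HB.instance Definition _ := GRing.isSubmodClosed.Build R[i] (X -> R[i])
  kernel_space_pred kernel_space_submod_closed.

Record kernel_space := KernelSpace {
  kernel_fun :> X -> R[i];
  _ : kernel_fun \in kernel_space_pred
}.

HB.instance Definition _ := [isSub for kernel_fun].
HB.instance Definition _ := [Choice of kernel_space by <:].
HB.instance Definition _ := [SubChoice_isSubLmodule of kernel_space by <:].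

End KernelSpace.

Section KernelInnerProduct.
Variables (R : realType) (X : Type) (k : psd_kernel R X).
Implicit Types (F G : kernel_space k) (c : R).
Local Notation Re := complex.Re.
Local Notation climit := (@cvg_for R R[i] (@cnorm R)).
Local Notation comb := (comb k).
Local Notation comb_norm := (comb_norm k).
Local Notation dominated := (dominated k).
Local Notation residual F t := ((F : X -> R[i]) - comb t).

Lemma kernel_spaceP F : in_kernel_space k F.
Proof. by have /asboolP := valP F. Qed.

Lemma kernel_space_dominated F : exists c, dominated F c.
Proof.
have [t ht] := kernel_spaceP F ltr01; exists (1 + comb_norm t).
by rewrite -[X in dominated X _](subrK (comb t)); exact: dominatedD ht (dominated_comb k t).
Qed.

Definition approx F (t : nat -> seq (R[i] * X)) : Prop :=
  forall e : R, 0 < e -> exists m0, forall m, (m0 <= m)%N ->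
    dominated (residual F (t m)) e.

Lemma approx_exists F : exists t, approx F t.
Proof.
have /choice[t ht] : forall n : nat, exists t, dominated (residual F t) n.+1%:R^-1.
  by move=> n; apply: kernel_spaceP; rewrite invr_gt0 ltr0n.
exists t => e /inv_eps[m0 hm]; exists m0 => m /hm h.
exact: dominated_le (ltW h) (ht m).
Qed.

Lemma approx_cst t F : F = comb t :> (X -> R[i]) -> approx F (fun=> t).
Proof.
move=> Ft e e0; exists 0%N => m _; rewrite Ft subrr.
exact: dominated_le (ltW e0) (dominated0 k).
Qed.

Lemma comb_norm_sub s t F e d : dominated (residual F s) e ->
  dominated (residual F t) d ->
  comb_norm (s ++ scale_comb (-1) t) <= e + d.
Proof.
move=> hs ht; apply: comb_norm_dominated; rewrite comb_cat comb_scale scaleN1r addrC.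
have -> : - comb t + comb s = residual F t - residual F s.
  by rewrite opprB addrA addrAC [_ + _ - _]addrAC subrr add0r addrC.
by rewrite addrC; exact: dominatedD (dominatedN hs) ht.
Qed.

Lemma pairing_approx_close F G s t c e d : dominated F c ->
  dominated (residual G s) e ->
  dominated (residual G t) d ->
  cnorm (pairing F s - pairing F t) <= c * (e + d).
Proof.
move=> [c0 hF] hs ht; have := hF (s ++ scale_comb (-1) t).
rewrite pairing_cat pairing_scale rmorphN rmorph1 mulN1r => /le_trans; apply.
by rewrite ler_wpM2l // (comb_norm_sub hs ht).
Qed.

(** The bound of [pairing F] by a multiple of the norm extends it by
    continuity to limits of combinations: the value at [G] is the limit along
    any sequence approximating [G]. *)
Definition kernel_ip F G : R[i] :=
  xget 0 [set z | forall t, approx G t -> climit (fun n => pairing F (t n)) z].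

Lemma kernel_ipP F G t : approx G t ->
  climit (fun n => pairing F (t n)) (kernel_ip F G).
Proof.
move=> ht; suff ex : exists z, forall t, approx G t -> climit (fun n => pairing F (t n)) z.
  by have := xgetPex 0 ex; apply.
have [c hc] := kernel_space_dominated F; have c0 := hc.1.
have c1 : 0 < 2 * c + 1 by rewrite ltr_wpDl // mulr_ge0.
have close s s' : approx G s -> approx G s' -> forall e : R, 0 < e ->
    exists m0, forall m n, (m0 <= m)%N -> (m0 <= n)%N ->
    cnorm (pairing F (s m) - pairing F (s' n)) < e.
  move=> hs hs' e e0; have d0 : 0 < e / (2 * c + 1) by rewrite divr_gt0.
  have [m1 h1] := hs _ d0; have [m2 h2] := hs' _ d0.
  exists (maxn m1 m2) => m n; rewrite !geq_max => /andP[hm _] /andP[_ hn].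
  apply: le_lt_trans (pairing_approx_close hc (h1 _ hm) (h2 _ hn)) _.
  by have := mulfVK (lt0r_neq0 c1) e; move: d0; nra.
have [z hz] : exists z, climit (fun n => pairing F (t n)) z.
  by apply: complex_complete => e; exact: close.
exists z => s hs e e0; have e2 : 0 < e / 2 by rewrite divr_gt0.
have [m1 h1] := hz _ e2; have [m2 h2] := close _ _ hs ht _ e2.
exists (maxn m1 m2) => m; rewrite geq_max => /andP[/h1 hm1 hm2].
have := h2 _ _ hm2 hm2; rewrite -[pairing F (s m) - z](subrKA (pairing F (t m))).
move=> h3; apply: le_lt_trans (cnormD _ _) _; lra.
Qed.

Lemma kernel_ip_comb F G t : G = comb t :> (X -> R[i]) -> kernel_ip F G = pairing F t.
Proof.
by move=> /approx_cst/kernel_ipP => /(_ F) h; exact: climit_unique h (climit_cst _).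
Qed.

Lemma kernel_ip_linl G a F F' :
  kernel_ip (a *: F + F') G = a * kernel_ip F G + kernel_ip F' G.
Proof.
have [t ht] := approx_exists G; apply: climit_unique (kernel_ipP _ ht) _.
have := climit_lin a (kernel_ipP F ht) (kernel_ipP F' ht).
congr (cvg_for _ _ _); apply/funext => n.
by rewrite -pairing_lin.
Qed.

(** Replacing [F] too by its approximants restores the symmetry between the
    two arguments, from which hermitian symmetry and positivity follow. *)
Lemma kernel_ip_gram F G s t : approx F s -> approx G t ->
  climit (fun n => pairing (comb (s n)) (t n)) (kernel_ip F G).
Proof.
move=> hs ht; have [c [c0 hc]] := kernel_space_dominated G.
apply: (@climitP _ _ _ (c + 2)) => [|e e0]; first by rewrite addr_ge0.
have [m1 h1] := hs _ e0; have [m2 h2] := ht _ ltr01.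
have [m3 h3] := kernel_ipP F ht e0.
exists (maxn m1 (maxn m2 m3)) => m; rewrite !geq_max => /and3P[/h1 hs1 /h2 ht1 /h3 /ltW hz].
rewrite -[_ - _](subrKA (pairing F (t m))); apply: le_trans (cnormD _ _) _.
have Nt : comb_norm (t m) <= c + 1.
  apply: comb_norm_dominated.
  have -> : comb (t m) = (G : X -> R[i]) - residual G (t m) by rewrite opprB addrC subrK.
  exact: dominatedD (dominatedN ht1).
have : cnorm (pairing (comb (s m)) (t m) - pairing F (t m)) <= e * (c + 1).
  rewrite cnormB -pairingB; apply: le_trans (hs1.2 _) _.
  by rewrite ler_wpM2l // ltW.
move: hz; nra.
Qed.

Lemma kernel_ipC F G : kernel_ip F G = Num.conj (kernel_ip G F).
Proof.
have [s hs] := approx_exists F; have [t ht] := approx_exists G.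
apply: climit_unique (kernel_ip_gram hs ht) _.
have := climitJ (kernel_ip_gram ht hs); congr (cvg_for _ _ _).
by apply/funext => n; rewrite -gramC.
Qed.

Lemma kernel_ip_linr F a G G' :
  kernel_ip F (a *: G + G') = Num.conj a * kernel_ip F G + kernel_ip F G'.
Proof. by rewrite kernel_ipC kernel_ip_linl rmorphD rmorphM /= -!kernel_ipC. Qed.

Lemma kernel_ip_ge0 F : 0 <= kernel_ip F F.
Proof.
have [s hs] := approx_exists F; apply: climit_ge0 (kernel_ip_gram hs hs) => n.
exact: gram_ge0.
Qed.

Lemma kernel_ip_eq0 F : kernel_ip F F = 0 -> F = 0.
Proof.
move=> F0; apply/val_inj/funext => x; apply/eqP; rewrite -cnorm_eq0.
rewrite eq_le cnorm_ge0 andbT; set N := comb_norm [:: (1, x)].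
have N0 : 0 <= N by exact: comb_norm_ge0.
apply: le_eps => e e0; have d0 : 0 < e / (2 * N + 1).
  by rewrite divr_gt0 // ltr_wpDl // mulr_ge0.
set d := e / _ in d0.
have [s hs] := approx_exists F; have [m1 h1] := hs _ d0.
have d2 : 0 < d ^+ 2 by rewrite exprn_gt0.
have [m2 h2] := kernel_ip_gram hs hs d2.
have := h1 _ (leq_maxl m1 m2); have := h2 _ (leq_maxr m1 m2).
set m := maxn _ _; rewrite F0 subr0 -comb_norm_sqrC cnormR ?sqr_ge0 //.
rewrite ltr_pXn2r ?nnegrE ?comb_norm_ge0 ?(ltW d0) // => /ltW hN [_ hF].
have -> : val F x = pairing (residual F (s m)) [:: (1, x)] + pairing (comb (s m)) [:: (1, x)].
  by rewrite -pairingD subrK pairing1.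
apply: le_trans (cnormD _ _) _; apply: le_trans (lerD (hF _) (gram_cauchy_schwarz _ _ _)) _.
rewrite -/N -mulrDl add0r; apply: (@le_trans _ _ (d * (2 * N + 1))); last first.
  by rewrite /d mulfVK // gt_eqF // ltr_wpDl // mulr_ge0.
have : comb_norm (s m) * N <= d * N by rewrite ler_wpM2r.
move: (ltW d0); nra.
Qed.

Fact kernel_ip_bilinear :
  bilinear_for ( *%R : GRing.Scale.law R[i] R[i])
    (Num.conj \; *%R : GRing.Scale.law R[i] R[i]) kernel_ip.
Proof. by split=> [G a F F'|F a G G'] /=; rewrite (kernel_ip_linl, kernel_ip_linr). Qed.

HB.instance Definition _ :=
  bilinear_isBilinear.Build R[i] (kernel_space k) (kernel_space k) R[i]
    *%R (Num.conj \; *%R) kernel_ip kernel_ip_bilinear.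

Fact kernel_ip_hermitian F G : kernel_ip F G = (-1) ^+ false * Num.conj (kernel_ip G F).
Proof. by rewrite expr0 mul1r -kernel_ipC. Qed.

HB.instance Definition _ :=
  isHermitianSesquilinear.Build R[i] (kernel_space k) false Num.conj
    kernel_ip kernel_ip_hermitian.

Fact kernel_ip_gt0 F : F != 0 -> 0 < kernel_ip F F.
Proof.
by move=> F0; rewrite lt0r kernel_ip_ge0 andbT; apply: contraNneq F0 => /kernel_ip_eq0 ->.
Qed.

HB.instance Definition _ :=
  isDotProduct.Build R[i] (kernel_space k) kernel_ip kernel_ip_gt0.

Local Notation knorm := (dot_norm kernel_ip).

Lemma kernel_norm_sqr F : knorm F ^+ 2 = Re (kernel_ip F F).
Proof. by rewrite sqr_sqrtr //; have /ge0_ReIm[] := kernel_ip_ge0 F. Qed.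

(** With [kernel_norm_dominated], this identifies the Hilbert space norm with
    the dual norm used to define the space. *)
Lemma kernel_norm_le F c : dominated F c -> knorm F <= c.
Proof.
move=> hF; have c0 := hF.1; have [s hs] := approx_exists F.
rewrite -(@ler_pXn2r _ 2) ?nnegrE ?sqrtr_ge0 // kernel_norm_sqr.
apply: le_eps => e e0; pose d := Num.min 1 (e / (2 * c + 2)).
have c2 : 0 < 2 * c + 2 by rewrite ltr_wpDl // mulr_ge0.
have d0 : 0 < d by rewrite lt_min ltr01 divr_gt0.
have dle : d * (2 * c + 2) <= e by rewrite -ler_pdivlMr // ge_min lexx orbT.
have d1 : d <= 1 by rewrite ge_min lexx.
have [m1 h1] := hs _ d0; have [m2 h2] := kernel_ip_gram hs hs d0.
have := h1 _ (leq_maxl m1 m2); have := h2 _ (leq_maxr m1 m2).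
set m := maxn _ _; rewrite cnormB => /ltW hz ht.
have Ns : comb_norm (s m) <= c + d.
  apply: comb_norm_dominated.
  have -> : comb (s m) = (F : X -> R[i]) - residual F (s m) by rewrite opprB addrC subrK.
  exact: dominatedD (dominatedN ht).
have := le_trans (ler_norm _) (le_trans (Re_le_cnorm _) hz).
rewrite ReD ReN -comb_norm_sqr; have := comb_norm_ge0 k (s m).
move: (ltW d0); nra.
Qed.

Fact comb_in_kernel_space t : comb t \in kernel_space_pred k.
Proof.
apply/asboolP => e e0; exists t; rewrite subrr.
exact: dominated_le (ltW e0) (dominated0 k).
Qed.

Definition kernel_comb t : kernel_space k := KernelSpace (comb_in_kernel_space t).

Lemma kernel_ip_kernel_comb F t : kernel_ip F (kernel_comb t) = pairing F t.
Proof. exact: kernel_ip_comb. Qed.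

Lemma kernel_norm_dominated F : dominated F (knorm F).
Proof.
split=> [|t]; first exact: sqrtr_ge0.
rewrite -(@ler_pXn2r _ 2) ?nnegrE ?cnorm_ge0 ?mulr_ge0 ?sqrtr_ge0 //.
rewrite exprMn -kernel_ip_kernel_comb.
apply: discriminant_le; rewrite ?sqr_ge0 // => a.
have /ge0_ReIm[_] := kernel_ip_ge0 (Num.conj a *: kernel_comb t + F).
rewrite !(kernel_ip_linl, kernel_ip_linr) conjCK (kernel_ipC _ F).
rewrite kernel_norm_sqr [kernel_ip (kernel_comb t) _]kernel_ip_kernel_comb.
by rewrite -comb_norm_sqrC cnorm_sqr !ReImE /=; lra.
Qed.

(** Point evaluations are bounded, so a Cauchy sequence has a pointwise limit;
    domination passes to pointwise limits. *)
Lemma kernel_space_complete : complete_for knorm.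
Proof.
move=> u u_cauchy.
have point m n x : cnorm (u m x - u n x) <= knorm (u m - u n) * comb_norm [:: (1, x)].
  by have [_ /(_ [:: (1, x)])] := kernel_norm_dominated (u m - u n); rewrite pairing1.
have /choice[F0 hF0] x : exists z, climit (fun n => u n x) z.
  apply: complex_complete => e e0; set N := comb_norm [:: (1, x)].
  have N1 : 0 < N + 1 by rewrite ltr_wpDl // comb_norm_ge0.
  have [m0 hm] := u_cauchy _ (divr_gt0 e0 N1); exists m0 => m n m0m m0n.
  have := hm _ _ m0m m0n; rewrite ltr_pdivlMr //; apply: le_lt_trans.
  apply: le_trans (point m n x) _.
  by rewrite ler_wpM2l ?sqrtr_ge0 // lerDl.
have limF m s : climit (fun n => pairing (u m - u n) s) (pairing ((u m : X -> R[i]) - F0) s).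
  elim: s => [|p s IH].
    by rewrite /pairing big_nil; under eq_fun do rewrite big_nil; exact: climit_cst.
  have h : climit (fun n => (u m - u n) p.2) (((u m : X -> R[i]) - F0) p.2).
    move=> e /(hF0 p.2)[m0 hm]; exists m0 => n /hm.
    have -> : (u m - u n) p.2 - ((u m : X -> R[i]) - F0) p.2 = F0 p.2 - u n p.2.
      have -> : (u m - u n) p.2 = u m p.2 - u n p.2 by [].
      have -> : ((u m : X -> R[i]) - F0) p.2 = u m p.2 - F0 p.2 by [].
      by ring.
    by rewrite cnormB.
  rewrite /pairing big_cons; under eq_fun do rewrite big_cons.
  exact: climit_lin h IH.
have dom e : 0 < e -> exists m0, forall m, (m0 <= m)%N ->
    dominated ((u m : X -> R[i]) - F0) e.
  move=> e0; have [m0 hm] := u_cauchy _ e0; exists m0 => m m0m.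
  split=> [|s]; first exact: ltW.
  apply: le_eps => d d0; have [m1 h1] := limF m s _ d0.
  have := h1 _ (leq_maxr m0 m1); set n := maxn _ _; rewrite cnormB => hd.
  have h2 : cnorm (pairing (u m - u n) s) <= e * comb_norm s.
    apply: le_trans ((kernel_norm_dominated _).2 s) _.
    by rewrite ler_wpM2r ?comb_norm_ge0 // ltW // hm // leq_maxl.
  rewrite -[X in cnorm X](subrK (pairing (u m - u n) s)).
  by apply: le_trans (cnormD _ _) _; rewrite addrC lerD // ltW.
have F0in : F0 \in kernel_space_pred k.
  apply/asboolP => e e0; have e2 : 0 < e / 2 by rewrite divr_gt0.
  have [m0 /(_ _ (leqnn _)) hm] := dom _ e2.
  have [t ht] := kernel_spaceP (u m0) e2; exists t.
  have -> : F0 - comb t = residual (u m0) t - ((u m0 : X -> R[i]) - F0).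
    by rewrite opprB [RHS]addrC subrKA.
  have -> : e = e / 2 + e / 2 by rewrite -splitr.
  exact: dominatedD ht (dominatedN hm).
exists (KernelSpace F0in) => e e0; have e2 : 0 < e / 2 by rewrite divr_gt0.
have [m0 hm] := dom _ e2; exists m0 => m /hm h.
apply: (@le_lt_trans _ _ (e / 2)); first exact: kernel_norm_le.
by rewrite ltr_pdivrMr // ltr_pMr // ltr1n.
Qed.

(** The reproducing kernel Hilbert space of Moore and Aronszajn. *)
Definition kernel_hilbert : hilbert R := Hilbert kernel_space_complete.

Lemma kernel_comb_dense :
  dense_set (fun F : kernel_hilbert => exists t, F = kernel_comb t).
Proof.
move=> F e e0; have e2 : 0 < e / 2 by rewrite divr_gt0.
have [t ht] := kernel_spaceP F e2; exists (kernel_comb t); first by exists t.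
apply: (@le_lt_trans _ _ (e / 2)); first exact: kernel_norm_le.
by rewrite ltr_pdivrMr // ltr_pMr // ltr1n.
Qed.

End KernelInnerProduct.

Section CompositionOperators.
Variables (R : realType) (X : Type) (k : psd_kernel R X).
Local Notation K := (kernel_hilbert k).
Implicit Types (g : X -> X) (F : kernel_space k).

Definition map_comb g (t : seq (R[i] * X)) : seq (R[i] * X) :=
  [seq (p.1, g p.2) | p <- t].

Lemma pairing_map_comb (F : X -> R[i]) g t :
  pairing F (map_comb g t) = pairing (F \o g) t.
Proof. by rewrite /pairing big_map. Qed.

Lemma kernel_fun_eq F x y : (forall z, k x z = k y z) -> F x = F y.
Proof.
move=> xy; rewrite -!(pairing1 F) -!kernel_ip_kernel_comb; congr kernel_ip.
by apply/val_inj/funext => z; rewrite /= /comb !big_seq1 xy.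
Qed.

(** Functions of the space inherit, with a conjugate, the linear relations that
    the kernel satisfies in its first variable. *)
Lemma kernel_fun_conj_linear F x y z a :
  (forall w, k x w = a * k y w + k z w) -> F x = Num.conj a * F y + F z.
Proof.
move=> xyz; rewrite -!(pairing1 F) -!kernel_ip_kernel_comb -kernel_ip_linr.
congr kernel_ip; apply/val_inj/funext => w.
rewrite /= /comb big_seq1 mul1r xyz.
have -> (u v : X -> R[i]) : (a *: u + v) w = a * u w + v w by [].
by rewrite !big_seq1 !mul1r.
Qed.

(** [F \o g] is again in the space when [g] has an adjoint with respect to the
    kernel and acts boundedly on combinations; taking composition operators
    rather than extending maps from a dense subspace makes their algebraic
    identities pointwise statements. *)
Definition composable g : Prop :=
  exists g' (M : R), [/\ 0 <= M, forall x y, k (g' x) y = k x (g y)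
    & forall t, comb_norm k (map_comb g t) <= M * comb_norm k t].

Definition comp_op g : K -> K :=
  fun F : kernel_space k => insubd (0 : kernel_space k) ((F : X -> R[i]) \o g).

Lemma comp_dominated (F : X -> R[i]) g (c M : R) : 0 <= M ->
  (forall t, comb_norm k (map_comb g t) <= M * comb_norm k t) ->
  dominated k F c -> dominated k (F \o g) (c * M).
Proof.
move=> M0 gM [c0 hF]; split=> [|t]; first exact: mulr_ge0.
rewrite -pairing_map_comb -mulrA; apply: le_trans (hF _) _.
by rewrite ler_wpM2l.
Qed.

Lemma comp_in_kernel_space g F : composable g ->
  ((F : X -> R[i]) \o g) \in kernel_space_pred k.
Proof.
move=> [g' [M [M0 gg' gM]]]; apply/asboolP => e e0.
have d0 : 0 < e / (M + 1) by rewrite divr_gt0 // ltr_wpDl.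
have [t ht] := kernel_spaceP F d0; exists (map_comb g' t).
have -> : ((F : X -> R[i]) \o g) - comb k (map_comb g' t) =
    ((F : X -> R[i]) - comb k t) \o g.
  apply/funext => y /=.
  have -> (u v : X -> R[i]) z : (u - v) z = u z - v z by [].
  have -> (u v : X -> R[i]) z : (u - v) z = u z - v z by [].
  congr (_ - _); rewrite /comb big_map; apply: eq_bigr => p _.
  by rewrite /= gg'.
apply: dominated_le (comp_dominated M0 gM ht).
by rewrite mulrAC ler_pdivrMr ?ltr_wpDl // ler_wpM2l ?lerDl // ltW.
Qed.

Lemma comp_opE g F x : composable g -> (comp_op g F : kernel_space k) x = F (g x).
Proof.
move=> gc; rewrite /comp_op.
by rewrite -[LHS]/(val (insubd (0 : kernel_space k) _) x) insubdK //; exact: comp_in_kernel_space.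
Qed.

Lemma comp_op_bounded g : composable g -> bounded_op (comp_op g).
Proof.
move=> gc; split=> [a F G|].
  apply/val_inj/funext => x; rewrite /= comp_opE //.
  have -> (u v : kernel_space k) y : (a *: u + v : kernel_space k) y = a * u y + v y by [].
  rewrite -[RHS]/(a * (comp_op g F : kernel_space k) x
                  + (comp_op g G : kernel_space k) x).
  by rewrite !comp_opE.
have [g' [M [M0 gg' gM]]] := gc; exists M => F.
have hF := kernel_norm_dominated (F : kernel_space k).
rewrite mulrC; apply: kernel_norm_le.
have -> : kernel_fun (comp_op g F) = (F : kernel_space k) \o g.
  by apply/funext => x; rewrite comp_opE.
exact: comp_dominated.
Qed.

Lemma comp_op_ip g F t : composable g ->
  ip K (comp_op g F) (kernel_comb k t) = pairing F (map_comb g t).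
Proof.
move=> gc; rewrite -[LHS]/(kernel_ip _ _) kernel_ip_kernel_comb pairing_map_comb.
by congr pairing; apply/funext => x; rewrite comp_opE.
Qed.

(** By density it suffices to test on combinations. Those of the [n]
    coordinates are merged into one list of length [m], and [tau] records the
    coordinate that each term comes from. *)
Lemma comp_op_mx_positive n (g : 'I_n -> 'I_n -> X -> X) :
  (forall i j, composable (g i j)) ->
  (forall m (tau : 'I_m -> 'I_n) (c : 'I_m -> R[i]) (x : 'I_m -> X),
    0 <= \sum_a \sum_b Num.conj (c a) * (c b * k (x b) (g (tau a) (tau b) (x a)))) ->
  positive_op (op_mx (\matrix_(i, j) comp_op (g i j))).
Proof.
move=> gc pos; have D := @dense_hsum _ _ _ n (@kernel_comb_dense _ _ k).
apply: (positive_dense _ D).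
  by apply: op_mx_bounded => i j; rewrite mxE; exact: comp_op_bounded.
move=> v /choice[t ht]; rewrite op_mx_ip.
pose s := [seq (i, p) | i <- enum 'I_n, p <- t i].
have -> : \sum_i \sum_j ip K ((\matrix_(i, j) comp_op (g i j)) i j ((v : {ffun _ -> K}) j))
                        ((v : {ffun _ -> K}) i)
   = \sum_(w <- s) \sum_(z <- s)
       Num.conj w.2.1 * (z.2.1 * k z.2.2 (g w.1 z.1 w.2.2)).
  rewrite [RHS]big_allpairs_dep big_enum; apply: eq_bigr => i _.
  under [RHS]eq_bigr => p _ do rewrite big_allpairs_dep big_enum.
  rewrite exchange_big; apply: eq_bigr => j _.
  rewrite mxE !ht comp_op_ip // pairing_map_comb /pairing.
  by apply: eq_bigr => p _; rewrite mulr_sumr.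
under eq_bigr => w _ do rewrite big_tnth.
rewrite big_tnth.
exact: (pos _ (fun a => (tnth (in_tuple s) a).1) (fun a => (tnth (in_tuple s) a).2.1)
              (fun a => (tnth (in_tuple s) a).2.2)).
Qed.

End CompositionOperators.

Lemma map_comb_norm_le (R : realType) (X : Type) (k : psd_kernel R X)
    (g : X -> X) (M : R) : 0 <= M ->
  (forall m (c : 'I_m -> R[i]) (x : 'I_m -> X),
    0 <= \sum_a \sum_b Num.conj (c a) *
           (c b * ((M ^+ 2)%:C * k (x b) (x a) - k (g (x b)) (g (x a))))) ->
  forall t, comb_norm k (map_comb g t) <= M * comb_norm k t.
Proof.
move=> M0 pos t.
rewrite -(@ler_pXn2r _ 2) ?nnegrE ?mulr_ge0 ?comb_norm_ge0 // exprMn.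
rewrite -lecR [leRHS]rmorphM /= !comb_norm_sqrC -subr_ge0.
have := pos _ (fun a => (tnth (in_tuple t) a).1) (fun a => (tnth (in_tuple t) a).2).
congr (0 <= _); rewrite pairing_map_comb /pairing mulr_sumr -sumrB [RHS]big_tnth.
apply: eq_bigr => a _; rewrite /comb /= big_map !mulr_sumr -sumrB [RHS]big_tnth.
by apply: eq_bigr => b _; ring.
Qed.

(** * Adjoints inside an operator system *)

Section Star.
Variables (R : realType) (H : hilbert R) (S : set (H -> H)).
Hypothesis S_system : operator_system S.

(** A total function choosing the adjoint inside [S]; adjoints being unique,
    the choice is immaterial. *)
Definition star (x : H -> H) : H -> H := xget 0 [set y | S y /\ adjoint_op x y].

Lemma starP x : S x -> S (star x) /\ adjoint_op x (star x).
Proof.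
move=> Sx; have [y Sy xy] := os_adjoint S_system Sx.
by have := @xgetPex _ 0 [set y | S y /\ adjoint_op x y]; apply; exists y.
Qed.

Lemma star_in x : S x -> S (star x). Proof. by case/starP. Qed.

Lemma star_ip x v w : S x -> ip H (x v) w = ip H v (star x w).
Proof. by case/starP. Qed.

Lemma adjoint_unique (x y z : H -> H) : adjoint_op x y -> adjoint_op x z -> y = z.
Proof.
move=> xy xz; apply/funext => v; apply: ip_inj => w.
by rewrite ipC -xy xz -ipC.
Qed.

Lemma star_unique x y : S x -> adjoint_op x y -> star x = y.
Proof. by move=> /starP[_ h] xy; exact: adjoint_unique h xy. Qed.

Lemma adjoint_opC (x y : H -> H) : adjoint_op x y -> adjoint_op y x.
Proof. by move=> xy v w; rewrite ipC -xy -ipC. Qed.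

Lemma starK x : S x -> star (star x) = x.
Proof. by move=> Sx; apply: star_unique; [exact: star_in|apply/adjoint_opC; case: (starP Sx)]. Qed.

Lemma star_id : star idfun = idfun.
Proof. by apply: star_unique => //; exact: os_unit. Qed.

Lemma star_lin a x y : S x -> S y ->
  star (a *: x + y) = Num.conj a *: star x + star y.
Proof.
move=> Sx Sy; apply: star_unique; first exact: subZD (os_subspace S_system) _ _ _ Sx Sy.
move=> v w.
have -> : (a *: x + y) v = a *: x v + y v by [].
have -> : (Num.conj a *: star x + star y) w = Num.conj a *: star x w + star y w by [].
by rewrite !ipE conjCK !star_ip.
Qed.

Lemma star_comp x y : S x -> S y -> S (x \o y) -> star (x \o y) = star y \o star x.
Proof.
by move=> Sx Sy Sxy; apply: star_unique => // v w; rewrite /= !star_ip.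
Qed.

End Star.

(** * Dilation of a commuting pair of ucp maps *)

Section Dilation.
Variables (R : realType) (H K L : hilbert R).
Variables (S : set (H -> H)) (D : set (K -> K)).
Variables (phi : (H -> H) -> (L -> L)) (psi : (K -> K) -> (L -> L)).
Hypotheses (S_system : operator_system S) (D_system : operator_system D).
Hypothesis D_mul : forall x y, D x -> D y -> D (x \o y).
Hypotheses (phi_ucp : ucp S phi) (psi_ucp : ucp D psi).
Hypothesis phi_psi : commuting_ranges S D phi psi.
Local Notation "x ^#" := (star D x) (at level 2, format "x ^#").
Local Notation X := ((K -> K) * L)%type.

Let D0 : D 0. Proof. exact: sub0 (os_subspace D_system). Qed.
Let starD x : D x -> D x^#. Proof. exact: star_in. Qed.
Let D_bounded x : D x -> bounded_op x. Proof. exact: (os_bounded D_system). Qed.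
Let D_lin x : D x -> linear x. Proof. by move=> /D_bounded/bounded_lin. Qed.
Let psi_lin x : D x -> linear (psi x).
Proof. by move=> Dx; exact/bounded_lin/(ucp_bounded psi_ucp). Qed.
Let phi_lin x : S x -> linear (phi x).
Proof. by move=> Sx; exact/bounded_lin/(ucp_bounded phi_ucp). Qed.
Let star_adj x v w : D x -> ip K (x^# v) w = ip K v (x w).
Proof. by move=> Dx; rewrite ipC -star_ip // -ipC. Qed.

(** Extends the index set of the kernel below from [D] to all functions. *)
Definition clip (d : K -> K) : K -> K := if `[< D d >] then d else 0.

Let clip_in d : D (clip d).
Proof. by rewrite /clip; case: asboolP. Qed.
#[local] Hint Resolve clip_in : core.
Let clip_id d : D d -> clip d = d.
Proof. by rewrite /clip; case: asboolP. Qed.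

(** The Gram form of Stinespring's space: [(d, l)] stands for the vector
    [pi d (V l)]. *)
Definition stinespring_kernel (x y : X) : R[i] :=
  ip L (psi ((clip y.1)^# \o clip x.1) x.2) y.2.
Local Notation kappa := stinespring_kernel.

Lemma sandwich_in d e y : D d -> D y -> D e -> D (d^# \o y \o e).
Proof. by move=> Dd Dy De; apply: (D_mul (D_mul (starD Dd) Dy)). Qed.

(** Complete positivity of [psi], applied to the positive matrix
    [d_a^* Y_(tau a, tau b) d_b]. *)
Lemma psi_sandwich_ge0 n m (Y : 'M[K -> K]_n) (tau : 'I_m -> 'I_n)
    (d : 'I_m -> K -> K) (c : 'I_m -> R[i]) (l : 'I_m -> L) :
  entries_in D Y -> positive_op (op_mx Y) -> (forall a, D (d a)) ->
  0 <= \sum_a \sum_b Num.conj (c a) *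
        (c b * ip L (psi ((d a)^# \o Y (tau a) (tau b) \o d b) (l b)) (l a)).
Proof.
move=> DY Y0 Dd.
pose Z : 'M[K -> K]_m := \matrix_(a, b) ((d a)^# \o Y (tau a) (tau b) \o d b).
have DZ : entries_in D Z by move=> a b; rewrite mxE; exact: sandwich_in.
have Z0 : positive_op (op_mx Z).
  move=> v; have Yl i j : linear (Y i j) by exact: D_lin.
  have := op_mx_pullback_positive tau Yl Y0 [ffun a => d a ((v : {ffun _ -> K}) a)].
  rewrite !op_mx_ip; congr (0 <= _).
  by apply: eq_bigr => a _; apply: eq_bigr => b _; rewrite !mxE !ffunE /= star_adj.
have := ucp_positive psi_ucp DZ Z0 [ffun a => c a *: l a].
rewrite op_mx_ip; congr (0 <= _); apply: eq_bigr => a _; apply: eq_bigr => b _.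
rewrite !mxE !ffunE (linZ (psi_lin (sandwich_in _ _ _))) //.
by rewrite ipZl ipZr; ring.
Qed.

Let id1 : 'M[K -> K]_1 := const_mx idfun.
Let id1_in : entries_in D id1.
Proof. by move=> i j; rewrite mxE; exact: (os_unit D_system). Qed.
Let id1_pos : positive_op (op_mx id1).
Proof.
by move=> v; rewrite op_mx_ip !big_ord1 mxE; exact: ipxx_ge0.
Qed.

Fact stinespring_kernelC x y : kappa x y = Num.conj (kappa y x).
Proof.
rewrite /kappa -[RHS]ipC.
have Dxy := D_mul (starD (clip_in y.1)) (clip_in x.1).
have Dyx := D_mul (starD (clip_in x.1)) (clip_in y.1).
apply: (ucp_adjoint D_system psi_ucp Dxy Dyx) => v w /=.
by rewrite star_adj // (star_ip D_system).
Qed.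

Fact stinespring_kernel_psd (t : seq (R[i] * X)) :
  0 <= \sum_(p <- t) \sum_(q <- t) Num.conj p.1 * (q.1 * kappa q.2 p.2).
Proof.
under eq_bigr => p _ do rewrite big_tnth.
rewrite big_tnth.
have := @psi_sandwich_ge0 _ (size t) id1 (fun=> ord0)
  (fun a => clip (tnth (in_tuple t) a).2.1) (fun a => (tnth (in_tuple t) a).1)
  (fun a => (tnth (in_tuple t) a).2.2) id1_in id1_pos (fun a => clip_in _).
congr (0 <= _); apply: eq_bigr => a _; apply: eq_bigr => b _.
by rewrite mxE.
Qed.

Let ker : psd_kernel R X := PsdKernel stinespring_kernelC stinespring_kernel_psd.
Local Notation M := (kernel_hilbert ker).

(** ** The representation of [D] *)

(** On functions, multiplication by [a] is composition with multiplication of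
    the index by [a^*]. *)
Let lmul (a : K -> K) (x : X) : X := (a^# \o clip x.1, x.2).

Let lmul_clip a x : D a -> clip (lmul a x).1 = a^# \o clip x.1.
Proof. by move=> Da; rewrite clip_id //; apply: D_mul; rewrite ?clip_in //; exact: starD. Qed.

Let star_lmul a d : D a -> D d -> (a^# \o d)^# = d^# \o a.
Proof.
move=> Da Dd; rewrite star_comp ?starK //; [exact: starD|].
by apply: D_mul => //; exact: starD.
Qed.

(** Boundedness is complete positivity of [psi] at the matrix of entries
    [d_p^* y d_q], where [y = N^2 - a a^*] and [N] bounds [a^*]. *)
Let lmul_composable a : D a -> composable ker (lmul a).
Proof.
move=> Da; have [N N0 hN] := bounded_nonneg (D_bounded (starD Da)).
exists (fun x => (a \o clip x.1, x.2)), N; split=> // [x y|].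
  rewrite /= /kappa /= lmul_clip // (clip_id (D_mul Da (clip_in x.1))).
  by rewrite star_lmul // compA.
apply: map_comb_norm_le => // m c x.
pose y : K -> K := (N ^+ 2)%:C *: idfun - (a \o a^#).
have Dy : D y.
  have Da' : D (a \o a^#) by apply: D_mul => //; exact: starD.
  have D1 := subZ (os_subspace D_system) (N ^+ 2)%:C (os_unit D_system).
  have := subZD (os_subspace D_system) (-1) Da' D1.
  by rewrite scaleN1r addrC.
have yE v : y v = (N ^+ 2)%:C *: v - a (a^# v) by [].
have y0 : positive_op (op_mx (const_mx y : 'M_1)).
  move=> v; rewrite op_mx_ip !big_ord1 mxE yE !ipE (star_ip D_system _ _ Da).
  rewrite -!hnorm_sqrC -rmorphM -rmorphB. rewrite ler0c subr_ge0 -exprMn.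
  by rewrite ler_pXn2r ?nnegrE ?mulr_ge0 ?hnorm_ge0.
have Dy1 : entries_in D (const_mx y : 'M_1) by move=> i j; rewrite mxE.
have := @psi_sandwich_ge0 _ m (const_mx y : 'M_1) (fun=> ord0)
  (fun a => clip (x a).1) c (fun a => (x a).2) Dy1 y0 (fun a => clip_in _).
congr (0 <= _); apply: eq_bigr => p _; apply: eq_bigr => q _.
rewrite mxE /= /kappa !lmul_clip // star_lmul ?clip_in //.
set d := clip (x p).1; set e := clip (x q).1.
have Dd : D d by exact: clip_in.
have De : D e by exact: clip_in.
have -> : d^# \o y \o e = (N ^+ 2)%:C *: (d^# \o e) + (-1) *: (d^# \o a \o (a^# \o e)).
  apply/funext => v /=; rewrite yE (linB (D_lin (starD Dd))) (linZ (D_lin (starD Dd))).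
  by rewrite -scaleN1r.
have h1 : D (d^# \o e) by exact: (D_mul (starD Dd) De).
have h2 : D (d^# \o a \o (a^# \o e)).
  by apply: (D_mul (D_mul (starD Dd) Da) (D_mul (starD Da) De)).
rewrite (ucp_linear psi_ucp) //; last exact: (subZ (os_subspace D_system)).
rewrite (lin_onZ (os_subspace D_system) (ucp_linear psi_ucp)) //.
have -> (u v : L -> L) z : ((N ^+ 2)%:C *: u + -1 *: v) z = (N ^+ 2)%:C *: u z - v z.
  by rewrite -scaleN1r.
by rewrite !ipE.
Qed.

Let pi (a : K -> K) : M -> M := @comp_op _ _ ker (lmul a).

Let piE a F x : D a -> (pi a F : kernel_space ker) x = F (a^# \o clip x.1, x.2).
Proof. by move=> Da; rewrite /pi comp_opE //; exact: lmul_composable. Qed.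

Let pi_linear : linear_on D pi.
Proof.
move=> c a b Da Db; have Dab : D (c *: a + b) by exact: (subZD (os_subspace D_system)).
apply/funext => F; apply/val_inj/funext => x.
rewrite -[RHS]/(c * (pi a F : kernel_space ker) x + (pi b F : kernel_space ker) x).
rewrite (@piE _ F x Da) (@piE _ F x Db).
rewrite -[LHS]/((pi _ F : kernel_space ker) x) (@piE _ F x Dab) -[c in RHS]conjCK.
apply: kernel_fun_conj_linear => w /=; rewrite /kappa /= (star_lin D_system) //.
set d := clip x.1; set e := clip w.1.
have Dd : D d by exact: clip_in.
have De : D e by exact: clip_in.
have Dad := D_mul (starD Da) Dd; have Dbd := D_mul (starD Db) Dd.
have E : (Num.conj c *: a^# + b^#) \o d = Num.conj c *: (a^# \o d) + (b^# \o d) by [].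
have Dabd : D ((Num.conj c *: a^# + b^#) \o d).
  by rewrite E; exact: (subZD (os_subspace D_system)).
rewrite !clip_id //.
have -> : e^# \o ((Num.conj c *: a^# + b^#) \o d) =
    Num.conj c *: (e^# \o (a^# \o d)) + (e^# \o (b^# \o d)).
  by rewrite E; apply/funext => v; exact: (D_lin (starD De)).
have h1 := D_mul (starD De) Dad; have h2 := D_mul (starD De) Dbd.
rewrite (ucp_linear psi_ucp) //.
have -> (u v : L -> L) z : (Num.conj c *: u + v) z = Num.conj c *: u z + v z by [].
by rewrite !ipE.
Qed.

Let pi_unital : pi idfun = idfun.
Proof.
apply/funext => F; apply/val_inj/funext => x.
rewrite /= piE; last exact: (os_unit D_system).
by apply: kernel_fun_eq => w; rewrite /= /kappa /= (star_id D_system) (clip_id (clip_in x.1)).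
Qed.

Let pi_positive n (Y : 'M[K -> K]_n) : entries_in D Y ->
  positive_op (op_mx Y) -> positive_op (op_mx (map_mx pi Y)).
Proof.
move=> DY Y0.
have -> : map_mx pi Y = \matrix_(i, j) @comp_op _ _ ker (lmul (Y i j)).
  by apply/matrixP => i j; rewrite !mxE.
apply: comp_op_mx_positive => [i j|m tau c x]; first exact: lmul_composable.
have := @psi_sandwich_ge0 _ m Y tau
  (fun a => clip (x a).1) c (fun a => (x a).2) DY Y0 (fun a => clip_in _).
congr (0 <= _); apply: eq_bigr => a _; apply: eq_bigr => b _.
rewrite /= /kappa lmul_clip // star_lmul //; exact: clip_in.
Qed.

Let pi_ucp : ucp D pi.
Proof.
split=> // a Da.
exact/comp_op_bounded/lmul_composable.
Qed.

Let pi_mul a b : D a -> D b -> pi (a \o b) = pi a \o pi b.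
Proof.
move=> Da Db; apply/funext => F; apply/val_inj/funext => x.
rewrite /= !piE //; last exact: D_mul.
rewrite lmul_clip // star_comp //; exact: D_mul.
Qed.

(** ** The lift of [phi] to the commutant of the representation *)

Let rmul (s : H -> H) (x : X) : X := (x.1, phi (star S s) x.2).

Let phi_star s v w : S s -> ip L (phi s v) w = ip L v (phi (star S s) w).
Proof.
move=> Ss; have [Ss' ss'] := starP S_system Ss.
exact: (ucp_adjoint S_system phi_ucp Ss Ss' ss').
Qed.

Let psi_phi s d v : S s -> D d -> psi d (phi s v) = phi s (psi d v).
Proof. by move=> Ss Dd; have /(congr1 (fun f => f v)) := phi_psi Ss Dd. Qed.

Let starS s : S s -> S (star S s). Proof. exact: star_in. Qed.

Let psi_gram m (d : 'I_m -> K -> K) : 'M[L -> L]_m :=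
  \matrix_(a, b) psi ((clip (d a))^# \o clip (d b)).

Let gram_in d e : D ((clip d)^# \o clip e).
Proof. exact: (D_mul (starD (clip_in d)) (clip_in e)). Qed.

Let psi_gram_positive m (d : 'I_m -> K -> K) : positive_op (op_mx (psi_gram d)).
Proof.
move=> v; have := @psi_sandwich_ge0 _ m id1 (fun=> ord0) (fun a => clip (d a))
  (fun=> 1) v id1_in id1_pos (fun a => clip_in _).
rewrite op_mx_ip; congr (0 <= _); apply: eq_bigr => a _; apply: eq_bigr => b _.
by rewrite !mxE rmorph1 !mul1r.
Qed.

(** Both the bound and the complete positivity of the lift are instances of
    this Schur product with the Gram matrix [psi (d_a^* d_b)]. *)
Let schur_gram_ge0 m (B : 'M[L -> L]_m) (c : 'I_m -> R[i]) (x : 'I_m -> X) :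
  (forall a b, bounded_op (B a b)) -> positive_op (op_mx B) ->
  (forall a b d v, D d -> psi d (B a b v) = B a b (psi d v)) ->
  0 <= \sum_a \sum_b Num.conj (c a) * (c b *
     ip L (psi ((clip (x a).1)^# \o clip (x b).1) (B a b (x b).2)) (x a).2).
Proof.
move=> Bb B0 comm; have Gb a b : bounded_op (psi_gram (fun a => (x a).1) a b).
  by rewrite mxE; exact/(ucp_bounded psi_ucp)/gram_in.
have GB p q r s v : psi_gram (fun a => (x a).1) p q (B r s v)
    = B r s (psi_gram (fun a => (x a).1) p q v).
  by rewrite mxE comm //; exact: gram_in.
have := schur_product_positive Gb Bb GB (psi_gram_positive _) B0
  [ffun a => c a *: (x a).2].
rewrite op_mx_ip; congr (0 <= _); apply: eq_bigr => a _; apply: eq_bigr => b _.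
rewrite !mxE !ffunE /= (linZ (bounded_lin (Bb a b))).
by rewrite (linZ (psi_lin (gram_in _ _))) ipZl ipZr; ring.
Qed.

(** Boundedness is the Schur product of the Gram matrix with the constant
    matrix of entries [N^2 - phi s (phi s)^*], where [N] bounds the adjoint of
    [phi s]. *)
Let rmul_composable s : S s -> composable ker (rmul s).
Proof.
move=> Ss; have [N N0 hN] := bounded_nonneg (ucp_bounded phi_ucp (starS Ss)).
exists (fun x => (x.1, phi s x.2)), N; split=> // [x y|].
  by rewrite /= /kappa /= psi_phi // ?phi_star //; exact: gram_in.
apply: map_comb_norm_le => // m c x.
pose b : L -> L := (N ^+ 2)%:C *: idfun + (-1) *: (phi s \o phi (star S s)).
have bE v : b v = (N ^+ 2)%:C *: v - phi s (phi (star S s) v).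
  by rewrite -scaleN1r.
have bb : bounded_op b.
  apply: bounded_lincomb; first exact: bounded_id.
  apply/bounded_scale/bounded_comp; apply: (ucp_bounded phi_ucp) => //.
  exact: starS.
have b0 : positive_op b.
  move=> v; rewrite bE !ipE phi_star // -!hnorm_sqrC -rmorphM -rmorphB ler0c.
  by rewrite subr_ge0 -exprMn ler_pXn2r ?nnegrE ?mulr_ge0 ?hnorm_ge0.
have B0 : positive_op (op_mx (const_mx b : 'M_m)).
  move=> v; have := b0 (\sum_a (v : {ffun _ -> L}) a).
  rewrite op_mx_ip (linS (bounded_lin bb)) ip_sumr; congr (0 <= _).
  apply: eq_bigr => p _; rewrite ip_suml; apply: eq_bigr => q _.
  by rewrite mxE.
have bc d v : D d -> psi d (b v) = b (psi d v).
  move=> Dd; rewrite !bE (linB (psi_lin Dd)) (linZ (psi_lin Dd)).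
  by rewrite !psi_phi //; exact: starS.
have Bb p q : bounded_op ((const_mx b : 'M_m) p q) by rewrite mxE.
have Bc p q d v : D d ->
    psi d ((const_mx b : 'M_m) p q v) = (const_mx b : 'M_m) p q (psi d v).
  by move=> Dd; rewrite !mxE bc.
have := schur_gram_ge0 c x Bb B0 Bc.
congr (0 <= _); apply: eq_bigr => p _; apply: eq_bigr => q _.
rewrite mxE /= /kappa /= bE (linB (psi_lin (gram_in _ _))).
rewrite (linZ (psi_lin (gram_in _ _))) !ipE.
by rewrite psi_phi ?phi_star //; exact: gram_in.
Qed.

Let sigma (s : H -> H) : M -> M := @comp_op _ _ ker (rmul s).

Let sigmaE s F x : S s ->
  (sigma s F : kernel_space ker) x = F (x.1, phi (star S s) x.2).
Proof. by move=> Ss; rewrite /sigma comp_opE //; exact: rmul_composable. Qed.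

Let sigma_linear : linear_on S sigma.
Proof.
move=> c s t Ss St; have Sst : S (c *: s + t) by exact: (subZD (os_subspace S_system)).
apply/funext => F; apply/val_inj/funext => x.
rewrite -[RHS]/(c * (sigma s F : kernel_space ker) x + (sigma t F : kernel_space ker) x).
rewrite (@sigmaE _ F x Ss) (@sigmaE _ F x St).
rewrite -[LHS]/((sigma _ F : kernel_space ker) x) (@sigmaE _ F x Sst) -[c in RHS]conjCK.
apply: kernel_fun_conj_linear => w /=; rewrite /kappa /= (star_lin S_system) //.
rewrite (ucp_linear phi_ucp); [|exact: starS..].
have -> (u v : L -> L) z : (Num.conj c *: u + v) z = Num.conj c *: u z + v z by [].
by rewrite (psi_lin (gram_in _ _)) !ipE.
Qed.

Let sigma_positive n (Y : 'M[H -> H]_n) : entries_in S Y ->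
  positive_op (op_mx Y) -> positive_op (op_mx (map_mx sigma Y)).
Proof.
move=> SY Y0.
have -> : map_mx sigma Y = \matrix_(i, j) @comp_op _ _ ker (rmul (Y i j)).
  by apply/matrixP => i j; rewrite !mxE.
apply: comp_op_mx_positive => [i j|m tau c x]; first exact: rmul_composable.
pose B : 'M[L -> L]_m := \matrix_(a, b) map_mx phi Y (tau a) (tau b).
have B0 : positive_op (op_mx B).
  apply: op_mx_pullback_positive => [i j|]; first by rewrite mxE; exact: phi_lin.
  exact: (ucp_positive phi_ucp).
have Bb p q : bounded_op (B p q) by rewrite !mxE; exact: (ucp_bounded phi_ucp).
have Bc p q d v : D d -> psi d (B p q v) = B p q (psi d v).
  by move=> Dd; rewrite !mxE psi_phi.
have := schur_gram_ge0 c x Bb B0 Bc.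
congr (0 <= _); apply: eq_bigr => a _; apply: eq_bigr => b _.
rewrite !mxE /= /kappa /= psi_phi ?phi_star //; exact: gram_in.
Qed.

Let sigma_ucp : ucp S sigma.
Proof.
split=> // [s Ss|]; first exact/comp_op_bounded/rmul_composable.
apply/funext => F; apply/val_inj/funext => -[d l].
rewrite /= (sigmaE F _ (os_unit S_system)) /=.
by rewrite (star_id S_system) (ucp_unital phi_ucp).
Qed.

(** Stinespring's theorem for [psi], combined with Arveson's lifting of the
    commutant of its range, to which the range of [phi] belongs. *)
Lemma commuting_dilation : exists (M : hilbert R) (sigma : (H -> H) -> (M -> M))
    (pi : (K -> K) -> (M -> M)) (V : L -> M),
  [/\ ucp S sigma, ucp D pi, commuting_ranges S D sigma pi,
      forall a b, D a -> D b -> pi (a \o b) = pi a \o pi b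
    & forall s d l l', S s -> D d ->
        ip M (sigma s (pi d (V l))) (V l') = ip L (phi s (psi d l)) l'].
Proof.
exists M, sigma, pi, (fun l => kernel_comb ker [:: (1, (idfun, l))]); split=> //.
  move=> s d Ss Dd; apply/funext => F; apply/val_inj/funext => x.
  by rewrite /= !(sigmaE _ _ Ss, piE _ _ Dd).
move=> s d l l' Ss Dd.
rewrite -[LHS]/(kernel_ip _ _) kernel_ip_kernel_comb pairing1 sigmaE // piE //.
have D1 := os_unit D_system.
rewrite /= /comb big_seq1 mul1r /= /kappa /= clip_id; last exact: D_mul (starD Dd) (clip_in _).
by rewrite !clip_id // star_lmul // -phi_star // (star_id D_system).
Qed.

End Dilation.

(** * Representations of the triangular algebra of an operator system *)

Section TriangularAlgebra.
Variables (R : realType) (H : hilbert R).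
Implicit Types (x y T : H -> H) (c d : R[i]).

Definition tri_mx c x : 'M[H -> H]_2 :=
  \matrix_(i < 2, j < 2) if i == j then c *: (idfun : H -> H)
                         else if (i < j)%N then x else 0.

Definition coord_embed n (j : 'I_n) (h : H) : {ffun 'I_n -> H} :=
  [ffun i => if i == j then h else 0].

Definition corner n (i j : 'I_n) (T : hsum n H -> hsum n H) : H -> H :=
  fun h => (T (coord_embed j h) : {ffun 'I_n -> H}) i.

Lemma corner_op_mx n i j (Y : 'M[H -> H]_n) : (forall i j, linear (Y i j)) ->
  corner i j (op_mx Y) = Y i j.
Proof.
move=> Yl; apply/funext => h; rewrite /corner op_mxE (bigD1 j) //= big1 => [|k kj].
  by rewrite ffunE eqxx addr0.
by rewrite ffunE (negPf kj) (lin0 (Yl _ _)).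
Qed.

Lemma corner_lin n i j c (T U : hsum n H -> hsum n H) :
  corner i j (c *: T + U) = c *: corner i j T + corner i j U.
Proof.
apply/funext => h; rewrite /corner.
have -> : (c *: T + U) (coord_embed j h) = c *: T (coord_embed j h) + U (coord_embed j h) by [].
by rewrite !ffunE.
Qed.

Lemma tri_mx_linear c x : linear x -> forall i j, linear (tri_mx c x i j).
Proof.
move=> xl i j a u v; rewrite mxE; case: ifP => _; last first.
  case: ifP => _; first exact: xl.
  by rewrite -[RHS]/(a *: 0 + 0 : H) scaler0 addr0.
have -> w : (c *: (idfun : H -> H)) w = c *: w by [].
by rewrite scalerDr !scalerA mulrC.
Qed.

Lemma op_mx_tri c x (v : {ffun 'I_2 -> H}) :
  op_mx (tri_mx c x) v = [ffun i => if i == ord0 then c *: v ord0 + x (v ord_max)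
                                     else c *: v ord_max] :> {ffun 'I_2 -> H}.
Proof.
apply/ffunP => i; rewrite op_mxE !ffunE big_ord_recl big_ord1 !mxE.
have E : lift ord0 ord0 = ord_max :> 'I_2 by exact/val_inj.
rewrite E; case: (unliftP ord0 i) => [j ->|->] //=.
by rewrite [j]ord1 E /= add0r.
Qed.

Lemma op_mx_tri_comp c d x y : linear x ->
  op_mx (tri_mx c x) \o op_mx (tri_mx d y)
  = op_mx (tri_mx (c * d) (c *: y + d *: x)).
Proof.
move=> xl; apply/funext => v; rewrite /= !op_mx_tri.
apply/ffunP => i; rewrite !ffunE /=; case: ifP => _; last by rewrite scalerA.
rewrite (linZ xl) scalerDr scalerA -addrA; congr (_ + _).
Qed.

(** The identification of (H^2)^n with H^(n + n). *)
Definition unfold_pair n (v : {ffun 'I_n -> hsum 2 H}) : {ffun 'I_(n + n) -> H} :=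
  hjoin [ffun a => (v a : {ffun 'I_2 -> H}) ord0]
        [ffun a => (v a : {ffun 'I_2 -> H}) ord_max].

Lemma big_ord2 (V : nmodType) (F : 'I_2 -> V) : \sum_i F i = F ord0 + F ord_max.
Proof. by rewrite big_ord_recl big_ord1; congr (_ + F _); exact/val_inj. Qed.

Lemma unfold_pair_norm n (v : {ffun 'I_n -> hsum 2 H}) :
  @hnorm _ (hsum (n + n) H) (unfold_pair v) = @hnorm _ (hsum n (hsum 2 H)) v.
Proof.
rewrite /hnorm /dot_norm ip_hjoin !hsum_ipE -big_split /=.
congr (Num.sqrt (complex.Re _)); apply: eq_bigr => a _.
by rewrite [RHS]hsum_ipE big_ord2 !ffunE.
Qed.

Lemma unfold_pair_surj n (w : {ffun 'I_(n + n) -> H}) :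
  exists v : {ffun 'I_n -> hsum 2 H}, w = unfold_pair v.
Proof.
exists [ffun a => [ffun i => if i == ord0 then w (lshift n a) else w (rshift n a)]].
by rewrite [LHS]hjoinP; congr hjoin; apply/ffunP => a; rewrite !ffunE.
Qed.

Lemma op_mx_unfold_pair n (Y : 'I_2 -> 'I_2 -> 'M[H -> H]_n)
    (v : {ffun 'I_n -> hsum 2 H}) :
  op_mx (block_mx (Y ord0 ord0) (Y ord0 ord_max) (Y ord_max ord0) (Y ord_max ord_max))
    (unfold_pair v) =
  unfold_pair (op_mx (\matrix_(a, b) op_mx (\matrix_(i, j) Y i j a b)) v).
Proof.
rewrite op_mx_block; congr hjoin; apply/ffunP => a.
  rewrite [LHS]ffunE !op_mxE [RHS]ffunE op_mxE sum_ffunE -big_split /=.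
  by apply: eq_bigr => b _; rewrite mxE op_mxE big_ord2 !mxE !ffunE.
rewrite [LHS]ffunE !op_mxE [RHS]ffunE op_mxE sum_ffunE -big_split /=.
by apply: eq_bigr => b _; rewrite mxE op_mxE big_ord2 !mxE !ffunE.
Qed.

Lemma op_mx_ampl_comm n (Y : 'M[H -> H]_n) T : linear T ->
  (forall i j, Y i j \o T = T \o Y i j) -> op_mx Y \o ampl n T = ampl n T \o op_mx Y.
Proof.
move=> Tl YT; apply/funext => v; apply/ffunP => i.
rewrite /= op_mxE [RHS]ffunE op_mxE (linS Tl); apply: eq_bigr => j _.
by rewrite ffunE; exact: (congr1 (fun f => f _) (YT i j)).
Qed.

End TriangularAlgebra.

Section TriangularRepresentation.
Variables (R : realType) (H M : hilbert R) (S : set (H -> H)).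
Variable sigma : (H -> H) -> (M -> M).
Hypotheses (S_system : operator_system S) (sigma_ucp : ucp S sigma).

Let S_sub := os_subspace S_system.
Let S_lin x : S x -> linear x.
Proof. by move=> Sx; exact/bounded_lin/(os_bounded S_system). Qed.

(** Defined through corners, so as to make sense on every operator. *)
Definition tri_rep (T : hsum 2 H -> hsum 2 H) : hsum 2 M -> hsum 2 M :=
  op_mx (\matrix_(i, j) sigma (corner i j T)).

Lemma tri_mx_in c x : S x -> entries_in S (tri_mx c x).
Proof.
move=> Sx i j; rewrite mxE; case: ifP => _.
  by apply: (subZ S_sub); exact: os_unit.
by case: ifP => // _; exact: sub0.
Qed.

Lemma Ualg_corners T : Ualg S T ->
  T = op_mx (\matrix_(i, j) corner i j T) /\ forall i j, S (corner i j T).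
Proof.
move=> [c [x [Sx ->]]]; rewrite -/(tri_mx c x).
have E i j : corner i j (op_mx (tri_mx c x)) = tri_mx c x i j.
  by apply: corner_op_mx; apply: tri_mx_linear; exact: S_lin.
split=> [|i j]; last by rewrite E; exact: tri_mx_in.
by congr op_mx; apply/matrixP => i j; rewrite [RHS]mxE E.
Qed.

Lemma tri_rep_tri c x : S x ->
  tri_rep (op_mx (tri_mx c x)) = op_mx (tri_mx c (sigma x)).
Proof.
move=> Sx; congr op_mx; apply/matrixP => i j.
rewrite mxE corner_op_mx; last exact: tri_mx_linear (S_lin Sx).
rewrite !mxE; case: ifP => _.
  rewrite (lin_onZ S_sub (ucp_linear sigma_ucp)) ?(ucp_unital sigma_ucp) //.
  exact: os_unit.
by case: ifP => // _; rewrite (lin_on0 S_sub (ucp_linear sigma_ucp)).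
Qed.

(** Completely contractive because the four corners of a matrix over the
    triangular algebra form one matrix over [S] of twice the size, to which
    [sigma] is applied entrywise; a homomorphism because the product of two
    triangular matrices involves no product of elements of [S]. *)
Lemma tri_rep_cc : cc_representation (Ualg S) tri_rep.
Proof.
split.
- move=> T /Ualg_corners[_ ST]; apply: op_mx_bounded => i j; rewrite mxE.
  exact: (ucp_bounded sigma_ucp).
- move=> c T U /Ualg_corners[_ ST] /Ualg_corners[_ SU].
  apply/funext => v; apply/ffunP => i.
  have -> : (c *: tri_rep T + tri_rep U) v = c *: tri_rep T v + tri_rep U v by [].
  rewrite !ffunE scaler_sumr -big_split; apply: eq_bigr => j _.
  by rewrite !mxE corner_lin (ucp_linear sigma_ucp).
- move=> _ _ [c [x [Sx ->]]] [d [y [Sy ->]]].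
  rewrite -!/(tri_mx _ _) op_mx_tri_comp; last exact: S_lin.
  have Syx : S (c *: y + d *: x) by apply: (subZD S_sub) => //; exact: (subZ S_sub).
  rewrite !tri_rep_tri // op_mx_tri_comp; last exact/bounded_lin/(ucp_bounded sigma_ucp).
  rewrite (ucp_linear sigma_ucp) //; last exact: (subZ S_sub).
  by rewrite (lin_onZ S_sub (ucp_linear sigma_ucp)).
move=> n X UX.
pose Y i j : 'M[H -> H]_n := \matrix_(a, b) corner i j (X a b).
have XY : X = \matrix_(a, b) op_mx (\matrix_(i, j) Y i j a b).
  apply/matrixP => a b; rewrite mxE; have [E _] := Ualg_corners (UX a b).
  by rewrite {1}E; congr op_mx; apply/matrixP => i j; rewrite !mxE.
have SY i j : entries_in S (Y i j).
  by move=> a b; rewrite mxE; have [_] := Ualg_corners (UX a b).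
pose B := block_mx (Y ord0 ord0) (Y ord0 ord_max) (Y ord_max ord0) (Y ord_max ord_max).
have SB : entries_in S B.
  move=> a b; rewrite -(splitK a) -(splitK b).
  case: (fintype.split a) (fintype.split b) => a' [] b' /=;
    rewrite ?block_mxEul ?block_mxEur ?block_mxEdl ?block_mxEdr; exact: SY.
have repX : map_mx tri_rep X =
    \matrix_(a, b) op_mx (\matrix_(i, j) (map_mx sigma (Y i j)) a b).
  by apply/matrixP => a b; rewrite !mxE; congr op_mx; apply/matrixP => i j; rewrite !mxE.
apply: opnorm_mono => [|c c0 Xc v].
  apply/bounded_lin/op_mx_bounded => a b; have [E ST] := Ualg_corners (UX a b).
  by rewrite E; apply: op_mx_bounded => i j; rewrite mxE; exact/(os_bounded S_system)/ST.
have Bc w : hnorm (op_mx B w) <= c * hnorm w.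
  have [u ->] := unfold_pair_surj w.
  by rewrite op_mx_unfold_pair -XY !unfold_pair_norm.
have := ucp_contractive S_system sigma_ucp SB c0 Bc (unfold_pair v).
rewrite map_block_mx (op_mx_unfold_pair (fun i j => map_mx sigma (Y i j))).
by rewrite -repX !unfold_pair_norm.
Qed.

End TriangularRepresentation.

(** * Positivity and norms on the spatial tensor product *)

Section Orthonormalization.
Variables (R : realType) (H : hilbert R).

Definition orthonormal_family n (e : 'I_n -> H) : Prop :=
  forall i j, ip H (e i) (e j) = (i == j)%:R.

(** One Gram-Schmidt step for each vector, skipped when its remainder is
    zero. *)
Lemma orthonormal_spanning (s : seq H) : exists n (e : 'I_n -> H),
  orthonormal_family e /\
  forall x, x \in s -> exists c : 'I_n -> R[i], x = \sum_i c i *: e i.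
Proof.
elim: s => [|x s [n [e [e_on e_span]]]].
  by exists 0%N, (fun=> 0); split=> // -[].
pose r := x - \sum_i ip H x (e i) *: e i.
have re j : ip H r (e j) = 0.
  rewrite /r ipDl ipNl ip_suml (bigD1 j) //= big1 => [|i ij].
    by rewrite ipZl e_on eqxx mulr1 addr0 subrr.
  by rewrite ipZl e_on (negPf ij) mulr0.
have [r0|r0] := eqVneq r 0.
  exists n, e; split=> // y; rewrite inE => /predU1P[->|]; last exact: e_span.
  by exists (fun i => ip H x (e i)); apply/eqP; rewrite -subr_eq0; apply/eqP.
have nr : 0 < hnorm r.
  by rewrite lt0r hnorm_ge0 andbT; apply: contra_neq r0; exact: hnorm_eq0.
pose u := (hnorm r)^-1%:C *: r.
have uu : ip H u u = 1.
  rewrite /u ipZl ipZr -hnorm_sqrC conj_ge0 ?ler0c ?invr_ge0 ?hnorm_ge0 //.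
  by rewrite -!rmorphM /= expr2 mulrA mulrACA mulVf ?mulfV ?mulr1 // gt_eqF.
have ue j : ip H u (e j) = 0 by rewrite /u ipZl re mulr0.
pose f := fun i : 'I_n.+1 => if unlift ord0 i is Some j then e j else u.
have f0 : f ord0 = u by rewrite /f unlift_none.
have fS j : f (lift ord0 j) = e j by rewrite /f liftK.
exists n.+1, f; split=> [i j|y].
  case: (unliftP ord0 i) (unliftP ord0 j) => [i' ->|->] [j' ->|->]; rewrite ?f0 ?fS.
  - by rewrite e_on (inj_eq lift_inj).
  - by rewrite ipC ue rmorph0 eq_sym eq_liftF.
  - by rewrite ue eq_liftF.
  - by rewrite uu eqxx.
rewrite inE => /predU1P[->|/e_span[c yc]]; last first.
  exists (fun i => if unlift ord0 i is Some j then c j else 0).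
  rewrite big_ord_recl unlift_none scale0r add0r yc.
  by apply: eq_bigr => i _; rewrite liftK fS.
exists (fun i => if unlift ord0 i is Some j then ip H x (e j) else (hnorm r)%:C).
rewrite big_ord_recl unlift_none f0 /u scalerA -rmorphM mulfV ?gt_eqF // scale1r.
under eq_bigr => i _ do rewrite liftK fS.
by rewrite /r subrK.
Qed.

End Orthonormalization.

Section Compression.
Variables (R : realType) (H G : hilbert R) (S : set (H -> H)).
Variable delta : (H -> H) -> (G -> G).
Hypothesis delta_ucp : ucp S delta.

Definition compression n (e : 'I_n -> G) (s : H -> H) : 'M[R[i]]_n :=
  \matrix_(a, b) ip G (delta s (e b)) (e a).

(** A vector of (C^n)^m is sent to the [m]-tuple of the combinations of the
    family [e] that it describes; this isometry turns the form of the
    compressed matrix into the form of the original one. *)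
Lemma compression_ucp n (e : 'I_n -> G) : orthonormal_family e ->
  ucp_mx S (compression e).
Proof.
move=> e_on; split.
- move=> c x y Sx Sy; apply/matrixP => a b; rewrite !mxE (ucp_linear delta_ucp) //.
  have -> : (c *: delta x + delta y) (e b) = c *: delta x (e b) + delta y (e b) by [].
  by rewrite ipDl ipZl.
- by apply/matrixP => a b; rewrite !mxE (ucp_unital delta_ucp) e_on eq_sym.
move=> m X SX X0 v.
have := ucp_positive delta_ucp SX X0 [ffun i => \sum_b v i b ord0 *: e b].
rewrite op_mx_ip; congr (0 <= _); rewrite summxE; apply: eq_bigr => i _.
rewrite summxE; apply: eq_bigr => j _; rewrite !mxE !ffunE.
have dl : linear (delta (X i j)) by exact/bounded_lin/(ucp_bounded delta_ucp).
rewrite (linS dl) ip_suml; apply: eq_bigr => b _.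
rewrite !mxE ip_sumr mulr_suml; apply: eq_bigr => a _.
by rewrite !mxE (linZ dl) ipZl ipZr; ring.
Qed.

End Compression.

Section SpatialTensor.
Variables (R : realType) (H G K : hilbert R) (S : set (H -> H)) (D : set (K -> K)).
Variable delta : (H -> H) -> (G -> G).
Hypotheses (delta_ucp : ucp S delta) (D_system : operator_system D).
Variable GK : hilbert_tensor G K.
Local Notation "g (x) k" := (@ht_pure R G K GK g k) (at level 40).

Lemma ht_tensor_dense : dense_set [set x : GK | exists t : tensor G K,
  x = tensor_eval (@ht_pure R G K GK) t].
Proof.
move=> x e /(@ht_dense _ _ _ GK x)[t ht].
by exists (tensor_eval (@ht_pure R G K GK) t) => //; exists t.
Qed.

Lemma ht_bounded a b : bounded_op a -> bounded_op b ->
  bounded_op (@ht_op R G K GK a b).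
Proof. exact: ht_op_bounded. Qed.

Lemma ht_op_pureE a b g k : bounded_op a -> bounded_op b ->
  @ht_op R G K GK a b (g (x) k) = a g (x) b k.
Proof. by move=> ab bb; exact: ht_op_pure. Qed.

Lemma tensor_eval_bounded (L : hilbert R) (f : (H -> H) -> (K -> K) -> L -> L)
    (t : tensor (H -> H) (K -> K)) : tensor_in S D t ->
  (forall s d, S s -> D d -> bounded_op (f s d)) -> bounded_op (tensor_eval f t).
Proof.
move=> SDt fb; rewrite /tensor_eval; apply: bounded_sum => p /SDt[Sp Dp].
exact: fb.
Qed.

Lemma tensor_evalE (A E : Type) (L : hilbert R) (f : A -> E -> L -> L)
    (t : tensor A E) (v : L) :
  tensor_eval f t v = \sum_(p <- t) f p.1 p.2 v.
Proof. by rewrite /tensor_eval; elim/big_rec2: _ => // p w g _ <-. Qed.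

Lemma map_mx_entry (A B : Type) m k (F : A -> B) (Y : 'M[A]_(m, k)) i j :
  map_mx F Y i j = F (Y i j).
Proof. by rewrite mxE. Qed.

Lemma mxtens_sum (V : nmodType) m k (F : 'I_(m * k) -> V) :
  \sum_c F c = \sum_a \sum_b F (mxtens_index (a, b)).
Proof.
rewrite pair_big /= (reindex (@mxtens_index m k)) /=; last first.
  by exists (@mxtens_unindex m k) => c _; rewrite ?mxtens_indexK ?mxtens_unindexK.
by apply: eq_bigr => -[a b].
Qed.

Lemma tensor_span m k (e : 'I_m -> G) (f : 'I_k -> K) (t : tensor G K) :
  (forall p, p \in t -> (exists c : 'I_m -> R[i], p.1 = \sum_a c a *: e a) /\
                       (exists c : 'I_k -> R[i], p.2 = \sum_b c b *: f b)) ->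
  exists w : 'I_m -> 'I_k -> R[i],
    tensor_eval (@ht_pure R G K GK) t = \sum_a \sum_b w a b *: (e a (x) f b).
Proof.
rewrite /tensor_eval; elim: t => [|p t IH] h.
  exists (fun _ _ => 0); rewrite big_nil big1 // => a _.
  by rewrite big1 // => b _; rewrite scale0r.
have [|w hw] := IH; first by move=> q qt; apply: h; rewrite inE qt orbT.
have [[c hc] [d hd]] := h p (mem_head _ _).
exists (fun a b => c a * d b + w a b); rewrite big_cons hw hc hd.
rewrite (linS (ht_linl GK _)) -big_split; apply: eq_bigr => a _ /=.
rewrite (linZ (ht_linl GK _)) (linS (ht_linr GK _)) scaler_sumr -big_split.
apply: eq_bigr => b _ /=.
by rewrite (linZ (ht_linr GK _)) scalerA scalerDl.
Qed.

Lemma system_id_ucp : ucp D (fun d => d).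
Proof.
split=> // [d /(os_bounded D_system)//|n X _ X0].
by rewrite map_mx_id.
Qed.

Definition spatial_map (s : H -> H) (d : K -> K) : GK -> GK :=
  @ht_op R G K GK (delta s) d.

Lemma spatial_map_bounded s d : S s -> D d -> bounded_op (spatial_map s d).
Proof.
move=> Ss Dd; apply: ht_bounded; first exact: (ucp_bounded delta_ucp).
exact: (os_bounded D_system).
Qed.

(** Matricial states detect positivity on the spatial tensor product: a vector
    of the algebraic tensor product lives in the tensor product of two finite
    dimensional subspaces, to which both factors are compressed. *)
Lemma min_positive_spatial n (X : 'M[tensor (H -> H) (K -> K)]_n) :
  entries_in (tensor_in S D) X -> min_positive S D X ->
  positive_op (op_mx (map_mx (tensor_eval spatial_map) X)).
Proof.
move=> SDX X0; have dns := @dense_hsum _ _ _ n ht_tensor_dense.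
apply: (positive_dense _ dns) => [|v /choice[t vt]].
  apply: op_mx_bounded => i j; rewrite mxE.
  by apply: tensor_eval_bounded => // s d; exact: spatial_map_bounded.
have [m [e [e_on e_span]]] :=
  orthonormal_spanning [seq (p : G * K).1 | i <- enum 'I_n, p <- t i].
have [k [f [f_on f_span]]] :=
  orthonormal_spanning [seq (p : G * K).2 | i <- enum 'I_n, p <- t i].
have /choice[w hw] i : exists w : 'I_m -> 'I_k -> R[i],
    (v : {ffun _ -> GK}) i = \sum_a \sum_b w a b *: (e a (x) f b).
  rewrite vt; apply: tensor_span => p pt; split.
    by apply: e_span; apply/allpairsPdep; exists i, p; rewrite mem_enum.
  by apply: f_span; apply/allpairsPdep; exists i, p; rewrite mem_enum.
pose u i : 'cV[R[i]]_(m * k) :=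
  \col_c w i (mxtens_unindex c).1 (mxtens_unindex c).2.
have := X0 _ _ _ _ (compression_ucp delta_ucp e_on)
                   (compression_ucp system_id_ucp f_on) u.
rewrite op_mx_ip; congr (0 <= _).
rewrite summxE; apply: eq_bigr => i _; rewrite summxE; apply: eq_bigr => j _.
rewrite !map_mx_entry tensor_evalE ip_suml /tensor_eval mulmx_sumr mulmx_suml summxE.
apply: eq_big_seq => p /SDX[Sp Dp].
have sb := spatial_map_bounded Sp Dp.
rewrite !hw (linS (bounded_lin sb)) ip_suml mxE mxtens_sum.
apply: eq_bigr => a' _; rewrite (linS (bounded_lin sb)) ip_suml.
apply: eq_bigr => b' _; rewrite !mxE mxtens_indexK /=.
rewrite (linZ (bounded_lin sb)) ipZl mxtens_sum mulr_suml ip_sumr mulr_sumr.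
apply: eq_bigr => a _; rewrite ip_sumr mulr_suml mulr_sumr.
apply: eq_bigr => b _; rewrite tensmxE !mxE !mxtens_indexK /= ipZr.
rewrite /spatial_map ht_op_pureE ?ht_ip; first by ring.
  exact: (ucp_bounded delta_ucp).
exact: (os_bounded D_system).
Qed.

End SpatialTensor.

(** * From norms to positivity *)

Section NumericalRange.
Variable R : realType.
Local Notation Re := complex.Re.

Lemma linear_growth_le0 (a C : R) : (forall t, 0 <= t -> t * a <= C) -> a <= 0.
Proof.
move=> h; rewrite leNgt; apply/negP => a0.
have C0 : 0 <= C by have := h 0 (lexx _); rewrite mul0r.
have := h ((C + 1) / a); rewrite divfK ?gt_eqF // => /(_ _).
by rewrite divr_ge0 ?addr_ge0 ?(ltW a0) // => /(_ isT); lra.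
Qed.

(** The estimate on [T + z] says that the numerical range of [T] lies in every
    disc of centre [- z] and radius [sqrt (|z|^2 + C)], for [z] in the left
    half-plane; letting [z] tend to infinity along the negative axis gives the
    right half-plane, and along both halves of the imaginary axis the real
    line. *)
Lemma positive_of_shifts (H : hilbert R) (T : H -> H) (C : R) :
  (forall z : R[i], Re z <= 0 -> forall x,
     hnorm (T x + z *: x) ^+ 2 <= (cnorm z ^+ 2 + C) * hnorm x ^+ 2) ->
  positive_op T.
Proof.
move=> h x; set a := ip H (T x) x.
have {}h (z : R[i]) : Re z <= 0 -> 2 * Re (Num.conj z * a) <= C * hnorm x ^+ 2.
  move=> /h/(_ x); rewrite hnorm_sqrD hnormZ exprMn ipZr -/a.
  have := sqr_ge0 (hnorm (T x)); lra.
apply/ge0_ReIm; split.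
  apply/eqP; rewrite eq_le; apply/andP; split.
    apply: (@linear_growth_le0 _ (C * hnorm x ^+ 2)) => t t0.
    have := h (0 +i* (t / 2)); rewrite !ReImE /= => /(_ (lexx _)); lra.
  rewrite -oppr_le0; apply: (@linear_growth_le0 _ (C * hnorm x ^+ 2)) => t t0.
  have := h (0 +i* (- (t / 2))); rewrite !ReImE /= => /(_ (lexx _)); lra.
rewrite -oppr_le0; apply: (@linear_growth_le0 _ (C * hnorm x ^+ 2)) => t t0.
have := h ((- (t / 2)) +i* 0); rewrite !ReImE /= => /(_ _).
rewrite oppr_le0 divr_ge0 // => /(_ isT); lra.
Qed.

Lemma shift_norm_le (H : hilbert R) (T : H -> H) (M : R) (z : R[i]) x :
  0 <= ip H (T x) x -> hnorm (T x) <= M * hnorm x -> Re z <= 0 ->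
  hnorm (T x + z *: x) ^+ 2 <= (cnorm z ^+ 2 + M ^+ 2) * hnorm x ^+ 2.
Proof.
move=> /ge0_ReIm[a0 a1] TM z0.
rewrite hnorm_sqrD hnormZ exprMn ipZr mulrDl.
have h1 : hnorm (T x) ^+ 2 <= M ^+ 2 * hnorm x ^+ 2.
  rewrite -exprMn ler_pXn2r ?nnegrE ?hnorm_ge0 //.
  exact: le_trans (hnorm_ge0 _) TM.
have : Re (Num.conj z * ip H (T x) x) <= 0.
  by rewrite !ReImE a0 mulr0 subr0 mulr_le0_ge0.
move: h1; lra.
Qed.

Lemma bound_dense (H L : hilbert R) (T : H -> L) (E : set H) (c : R) : 0 <= c ->
  bounded_op T -> dense_set E -> (forall y, E y -> hnorm (T y) <= c * hnorm y) ->
  forall x, hnorm (T x) <= c * hnorm x.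
Proof.
move=> c0 Tb Ed TE x; have [M M0 hM] := bounded_nonneg Tb.
apply: le_eps => e e0; have C0 : 0 < M + c + 1 by rewrite ltr_wpDl ?addr_ge0.
have [|y Ey] := Ed x (e / (M + c + 1)); first by rewrite divr_gt0.
rewrite ltr_pdivlMr // => /ltW hy.
have -> : T x = T (x - y) + T y by rewrite -(linD (bounded_lin Tb)) subrK.
apply: le_trans (hnormD _ _) _; apply: le_trans (lerD (hM _) (TE _ Ey)) _.
have y_le : hnorm y <= hnorm x + hnorm (x - y).
  by have := hnormD x (y - x); rewrite [x + _]addrC subrK [hnorm (y - x)]hnormB.
have : c * hnorm y <= c * (hnorm x + hnorm (x - y)) by rewrite ler_wpM2l.
have := hnorm_ge0 (x - y); nra.
Qed.

End NumericalRange.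

Lemma ampl_ucp (R : realType) (H L : hilbert R) (S : set (H -> H))
    (phi : (H -> H) -> (L -> L)) n : ucp S phi -> ucp S (fun s => ampl n (phi s)).
Proof.
move=> phi_ucp; split.
- by move=> s Ss; exact/ampl_bounded/(ucp_bounded phi_ucp).
- by move=> c x y Sx Sy; rewrite (ucp_linear phi_ucp) // amplZD.
- by rewrite (ucp_unital phi_ucp) ampl_id.
move=> m X SX X0.
have -> : map_mx (fun s => ampl n (phi s)) X = map_mx (ampl n) (map_mx phi X).
  by apply/matrixP => i j; rewrite !mxE.
exact/op_mx_ampl_positive/(ucp_positive phi_ucp).
Qed.

Section NilpotentLift.
Variables (R : realType) (H K : hilbert R).
Local Notation Re := complex.Re.

Definition nilp (s : H -> H) : hsum 2 H -> hsum 2 H := op_mx (tri_mx 0 s).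

(** The element [X + z (1 (x) 1)], placed in the nilpotent corner of the
    triangular algebra. *)
Definition nilp_lift (z : R[i]) n (X : 'M[tensor (H -> H) (K -> K)]_n) :
    'M[tensor (hsum 2 H -> hsum 2 H) (K -> K)]_n :=
  \matrix_(i, j) ([seq (nilp p.1, p.2) | p <- X i j] ++
                  (if i == j then [:: (nilp (z *: idfun), idfun)] else [::])).

Lemma nilpE s (v : {ffun 'I_2 -> H}) :
  nilp s v = coord_embed ord0 (s (v ord_max)) :> {ffun 'I_2 -> H}.
Proof.
rewrite /nilp op_mx_tri; apply/ffunP => i; rewrite !ffunE.
by case: ifP => // _; rewrite !scale0r ?add0r.
Qed.

Lemma nilp_bounded s : bounded_op s -> bounded_op (nilp s).
Proof.
move=> sb; apply: op_mx_bounded => i j; rewrite mxE.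
case: ifP => _; first exact/bounded_scale/bounded_id.
by case: ifP => // _; exact: bounded_zero.
Qed.

Lemma nilp_ampl s : linear s -> nilp s = ampl 2 s \o nilp idfun.
Proof.
move=> sl; apply/funext => v; rewrite /= !nilpE; apply/ffunP => i; rewrite !ffunE.
by case: ifP => // _; rewrite (lin0 sl).
Qed.

Lemma nilp_Ualg (S : set (H -> H)) s : S s -> Ualg S (nilp s).
Proof. by move=> Ss; exists 0, s. Qed.

Variable HK : hilbert_tensor (hsum 2 H) K.
Local Notation "g (x) k" := (@ht_pure R _ _ HK g k) (at level 40).
Local Notation op := (@ht_op R _ _ HK).
Let dns := @ht_tensor_dense _ _ _ HK.
Let shift := op (nilp idfun) idfun.

Let shift_bounded : bounded_op shift.
Proof. by apply: ht_bounded; [exact/nilp_bounded/bounded_id|exact: bounded_id]. Qed.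

Let op_nilp s d : bounded_op s -> bounded_op d ->
  op (nilp s) d = op (ampl 2 s) d \o shift.
Proof.
move=> sb db; apply: (eq_on_dense _ _ dns) => [||_ [t ->]].
- by apply: ht_bounded => //; exact: nilp_bounded.
- by apply: bounded_comp => //; apply: ht_bounded => //; exact: ampl_bounded.
rewrite /= (linS (bounded_lin (ht_bounded _ (nilp_bounded sb) db))).
rewrite (linS (bounded_lin shift_bounded)).
rewrite (linS (bounded_lin (ht_bounded _ (ampl_bounded 2 sb) db))).
apply: eq_bigr => p _; rewrite /shift !ht_op_pureE //.
- by rewrite (nilp_ampl (bounded_lin sb)).
- exact: ampl_bounded.
- exact/nilp_bounded/bounded_id.
- exact: bounded_id.
- exact: nilp_bounded.
Qed.

Let op_scalar (z : R[i]) : op (ampl 2 (z *: idfun)) idfun = z *: idfun.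
Proof.
have zb : bounded_op (ampl 2 (z *: (idfun : H -> H))).
  exact/ampl_bounded/bounded_scale/bounded_id.
have kb : bounded_op (idfun : K -> K) := bounded_id K.
apply: (eq_on_dense _ _ dns) => [||_ [t ->]].
- exact: ht_bounded.
- exact/bounded_scale/bounded_id.
rewrite (linS (bounded_lin (ht_bounded _ zb kb))).
rewrite -[RHS]/(z *: tensor_eval _ t) scaler_sumr; apply: eq_bigr => p _.
rewrite ht_op_pureE // -(linZ (ht_linl HK _)); congr (_ (x) _).
Qed.

(** [1 = |shift|^2 + |p (x) 1|^2] on elementary tensors, where [p] is the
    projection to the first coordinate. *)
Let shift_contractive x : hnorm (shift x) <= hnorm x.
Proof.
rewrite -[leRHS]mul1r; apply: (bound_dense _ _ dns) => // _ [t ->].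
rewrite mul1r -(@ler_pXn2r _ 2) ?nnegrE ?hnorm_ge0 // -lecR !hnorm_sqrC.
pose p (g : {ffun 'I_2 -> H}) : {ffun 'I_2 -> H} := coord_embed ord0 (g ord0).
have ip_tensor (f f' : hsum 2 H -> hsum 2 H) :
  ip HK (\sum_(q <- t) f q.1 (x) q.2) (\sum_(q <- t) f' q.1 (x) q.2) =
  \sum_(q <- t) \sum_(q' <- t) ip _ (f q.1) (f' q'.1) * ip K q.2 q'.2.
  rewrite ip_suml; apply: eq_bigr => q _; rewrite ip_sumr.
  by apply: eq_bigr => q' _; rewrite ht_ip.
have -> : shift (tensor_eval (@ht_pure R _ _ HK) t) =
    \sum_(q <- t) nilp idfun q.1 (x) q.2.
  rewrite (linS (bounded_lin shift_bounded)); apply: eq_bigr => q _.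
  by rewrite /shift ht_op_pureE //; [exact/nilp_bounded/bounded_id|exact: bounded_id].
rewrite ip_tensor [leRHS](ip_tensor id id) -subr_ge0.
have := ipxx_ge0 (\sum_(q <- t) (p q.1 : hsum 2 H) (x) q.2).
rewrite (ip_tensor p p) -sumrB; congr (0 <= _); apply: eq_bigr => q _.
rewrite -sumrB; apply: eq_bigr => q' _; rewrite -mulrBl; congr (_ * _).
rewrite !nilpE !hsum_ipE !big_ord2 !ffunE /= !ip0l !addr0.
by rewrite addrK.
Qed.

Variables (S : set (H -> H)) (D : set (K -> K)).
Hypotheses (S_system : operator_system S) (D_system : operator_system D).

Lemma nilp_lift_in z n (X : 'M[tensor (H -> H) (K -> K)]_n) :
  entries_in (tensor_in S D) X -> entries_in (tensor_in (Ualg S) D) (nilp_lift z X).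
Proof.
move=> SDX i j p; rewrite mxE mem_cat => /orP[/mapP[q /SDX[Sq Dq] ->]|].
  by split=> //; exact: nilp_Ualg.
case: ifP => // _; rewrite inE => /eqP ->; split; last exact: os_unit.
apply: nilp_Ualg; apply: (subZ (os_subspace S_system)); exact: os_unit.
Qed.

(** The nilpotent corner factors through the contraction [shift], so that its
    norm is that of the operator [T + z] on the diagonal copy of [X]. *)
Lemma nilp_lift_min_norm n (X : 'M[tensor (H -> H) (K -> K)]_n) :
  entries_in (tensor_in S D) X -> min_positive S D X ->
  exists C : R, forall z : R[i], Re z <= 0 ->
    (min_norm HK (nilp_lift z X) <= (Num.sqrt (cnorm z ^+ 2 + C ^+ 2))%:E)%E.
Proof.
move=> SDX X0.
have amp_ucp : ucp S (ampl 2) by exact: ampl_ucp (system_id_ucp S_system).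
pose T := op_mx (map_mx (tensor_eval (@spatial_map _ _ _ _ (ampl 2) HK)) X).
have T0 : positive_op T by exact: (min_positive_spatial amp_ucp D_system).
have Tb : bounded_op T.
  apply: op_mx_bounded => i j; rewrite mxE.
  by apply: (tensor_eval_bounded (SDX i j)) => s d; exact: (spatial_map_bounded amp_ucp D_system).
have [C C0 hC] := bounded_nonneg Tb; exists C => z z0.
apply: opnorm_le => [|v]; first exact: sqrtr_ge0.
pose u := ampl n shift v.
have -> : op_mx (map_mx (tensor_eval op) (nilp_lift z X)) v = T u + z *: u.
  apply/ffunP => i; rewrite op_mxE [RHS]ffunE op_mxE.
  have -> : (z *: u) i = \sum_j (if i == j then z *: u j else 0).
    rewrite (bigD1 i) //= eqxx big1 ?addr0 ?ffunE // => j ji.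
    by rewrite eq_sym (negPf ji).
  rewrite -big_split; apply: eq_bigr => j _; rewrite /= !map_mx_entry.
  rewrite !tensor_evalE [nilp_lift z X i j]mxE big_cat big_map; congr (_ + _).
    apply: eq_big_seq => p /SDX[Sp Dp]; rewrite op_nilp ?ffunE //.
      exact: (os_bounded S_system).
    exact: (os_bounded D_system).
  case: ifP => _; last by rewrite big_nil.
  rewrite big_seq1 /= op_nilp ?op_scalar ?ffunE //; last exact: bounded_id.
  exact/bounded_scale/bounded_id.
have uv : hnorm u <= hnorm v.
  rewrite -(@ler_pXn2r _ 2) ?nnegrE ?hnorm_ge0 // !hsum_norm ler_sum // => i _.
  by rewrite ler_pXn2r ?nnegrE ?hnorm_ge0 // ffunE shift_contractive.
have c0 : 0 <= cnorm z ^+ 2 + C ^+ 2 by rewrite addr_ge0 ?sqr_ge0.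
rewrite -(@ler_pXn2r _ 2) ?nnegrE ?mulr_ge0 ?sqrtr_ge0 ?hnorm_ge0 //.
have h := shift_norm_le (T0 u) (hC u) z0.
rewrite exprMn (sqr_sqrtr c0); apply: le_trans h _.
by rewrite ler_wpM2l // ler_pXn2r ?nnegrE ?hnorm_ge0.
Qed.

End NilpotentLift.

(** * From minimal to commuting positivity *)

Section Completions.
Variables (R : realType) (H K : hilbert R) (A : set (H -> H)) (E : set (K -> K)).

Lemma completion_linear_tensor (p q : forall n, 'M[tensor (H -> H) (K -> K)]_n -> \bar R)
    (W : mx_completion A E p) (W' : mx_completion A E q) (Phi : {linear W -> W'})
    (t : tensor (H -> H) (K -> K)) :
  (forall a e, A a -> E e -> Phi (mc_pure W a e) = mc_pure W' a e) ->
  tensor_in A E t ->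
  Phi (tensor_eval (mc_pure W) t) = tensor_eval (mc_pure W') t.
Proof.
move=> Phi_pure AEt; rewrite /tensor_eval linear_sum.
by apply: eq_big_seq => x /AEt[Ax Ex]; exact: Phi_pure.
Qed.

(** An isometric isomorphism of the completions that fixes elementary tensors
    identifies the two norms on the algebraic tensor product. *)
Lemma alg_min_eq_max_norm : alg_min_eq_max A E ->
  exists HK : hilbert_tensor H K, forall n (X : 'M[tensor (H -> H) (K -> K)]_n),
    entries_in (tensor_in A E) X -> max_norm A E X = min_norm HK X.
Proof.
move=> [HK [Wmin [Wmax [Phi [_ Phi_norm Phi_pure]]]]]; exists HK => n X AEX.
rewrite -(mc_isometric Wmax AEX) -(mc_isometric Wmin AEX) -Phi_norm.
congr (mc_norm _)%:E; apply/matrixP => i j; rewrite !mxE.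
by rewrite (completion_linear_tensor Phi_pure).
Qed.

Lemma max_norm_ge (L : hilbert R) (pi : (H -> H) -> (L -> L))
    (rho : (K -> K) -> (L -> L)) n (X : 'M[tensor (H -> H) (K -> K)]_n) :
  cc_representation A pi -> cc_representation E rho ->
  commuting_ranges A E pi rho ->
  (opnorm (op_mx (map_mx (dot_map pi rho) X)) <= max_norm A E X)%E.
Proof. by move=> hpi hrho hc; apply: ereal_sup_ubound; exists L, pi, rho. Qed.

End Completions.

Section MinimalToCommuting.
Variables (R : realType) (H K : hilbert R) (S : set (H -> H)) (D : set (K -> K)).
Hypotheses (S_system : operator_system S) (D_system : operator_system D).
Hypothesis D_mul : forall x y, D x -> D y -> D (x \o y).

Lemma ucp_cc_representation (L : hilbert R) (rho : (K -> K) -> (L -> L)) :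
  ucp D rho -> (forall a b, D a -> D b -> rho (a \o b) = rho a \o rho b) ->
  cc_representation D rho.
Proof.
move=> rho_ucp rho_mul; split=> //.
- exact: (ucp_bounded rho_ucp).
- exact: (ucp_linear rho_ucp).
by move=> n X; exact: ucp_opnorm.
Qed.

Section Representation.
Variables (M : hilbert R) (sigma : (H -> H) -> (M -> M)) (pi : (K -> K) -> (M -> M)).
Hypotheses (sigma_ucp : ucp S sigma) (pi_ucp : ucp D pi).
Hypothesis sigma_pi : commuting_ranges S D sigma pi.
Hypothesis pi_mul : forall a b, D a -> D b -> pi (a \o b) = pi a \o pi b.

Let rho (d : K -> K) : hsum 2 M -> hsum 2 M := ampl 2 (pi d).

Lemma rho_cc : cc_representation D rho.
Proof.
apply: ucp_cc_representation => [|a b Da Db]; first exact: ampl_ucp.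
by rewrite /rho pi_mul // ampl_comp.
Qed.

Lemma tri_rep_comm : commuting_ranges (Ualg S) D (tri_rep sigma) rho.
Proof.
move=> T d UT Dd; have [_ ST] := Ualg_corners S_system UT.
apply: op_mx_ampl_comm => [|i j]; first exact/bounded_lin/(ucp_bounded pi_ucp).
by rewrite mxE; exact: sigma_pi.
Qed.

(** Vectors of the second copy of [M] are sent to the first one by the
    represented element itself, whose norm is therefore at most that of the
    representation of its nilpotent copy. *)
Lemma nilp_lift_rep (z : R[i]) n (X : 'M[tensor (H -> H) (K -> K)]_n)
    (w : {ffun 'I_n -> M}) : entries_in (tensor_in S D) X ->
  op_mx (map_mx (dot_map (tri_rep sigma) rho) (nilp_lift z X))
    ([ffun i => coord_embed ord_max (w i)] : {ffun 'I_n -> hsum 2 M})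
  = [ffun i => coord_embed ord0
       (((op_mx (map_mx (dot_map sigma pi) X) w : hsum n M) + z *: (w : hsum n M)
          : {ffun 'I_n -> M}) i)] :> {ffun 'I_n -> hsum 2 M}.
Proof.
move=> SDX; apply/ffunP => i; rewrite op_mxE [RHS]ffunE.
have pure s d x : S s -> D d ->
    (tri_rep sigma (nilp s) \o rho d) (coord_embed ord_max x)
    = coord_embed ord0 (sigma s (pi d x)) :> {ffun 'I_2 -> M}.
  move=> Ss Dd; rewrite /= /nilp (tri_rep_tri S_system sigma_ucp _ Ss) -/(nilp _) nilpE.
  by rewrite !ffunE eqxx.
have embedD x y : coord_embed ord0 (x + y) = coord_embed ord0 x + coord_embed ord0 y
    :> {ffun 'I_2 -> M}.
  by apply/ffunP => k; rewrite !ffunE; case: ifP => // _; rewrite addr0.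
have embed0 : coord_embed ord0 0 = 0 :> {ffun 'I_2 -> M}.
  by apply/ffunP => k; rewrite !ffunE; case: ifP.
have -> : ((op_mx (map_mx (dot_map sigma pi) X) w : hsum n M) + z *: (w : hsum n M)
          : {ffun 'I_n -> M}) i
   = \sum_j (\sum_(p <- X i j) sigma p.1 (pi p.2 (w j)) + (if i == j then z *: w j else 0)).
  rewrite ffunE op_mxE big_split /=; congr (_ + _).
    by apply: eq_bigr => j _; rewrite map_mx_entry /dot_map tensor_evalE.
  rewrite (bigD1 i) //= eqxx big1 ?addr0 ?ffunE // => j ji.
  by rewrite eq_sym (negPf ji).
have wE j : ([ffun i => coord_embed ord_max (w i)] : {ffun 'I_n -> hsum 2 M}) j
    = coord_embed ord_max (w j) by rewrite ffunE.
rewrite (big_morph _ embedD embed0); apply: eq_bigr => j _.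
rewrite wE map_mx_entry /dot_map tensor_evalE [nilp_lift z X i j]mxE big_cat big_map embedD.
congr (_ + _).
  rewrite (big_morph _ embedD embed0); apply: eq_big_seq => p /SDX[Sp Dp].
  by rewrite pure.
case: ifP => _; last by rewrite big_nil embed0.
have S1 := os_unit S_system.
rewrite big_seq1 pure.
- rewrite (ucp_unital pi_ucp) (lin_onZ (os_subspace S_system) (ucp_linear sigma_ucp)) //.
  by rewrite (ucp_unital sigma_ucp).
- exact: (subZ (os_subspace S_system)).
exact: (os_unit D_system).
Qed.

Lemma coord_embed_norm n (j : 'I_n) (x : M) :
  @hnorm _ (hsum n M) (coord_embed j x) = hnorm x.
Proof.
rewrite /hnorm /dot_norm hsum_ipE (bigD1 j) //= big1 => [|i ij].
  by rewrite !ffunE eqxx addr0.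
by rewrite !ffunE (negPf ij) ip0l.
Qed.

Lemma embed_family_norm n (j : 'I_2) (w : {ffun 'I_n -> M}) :
  @hnorm _ (hsum n (hsum 2 M)) [ffun i => coord_embed j (w i)] = @hnorm _ (hsum n M) w.
Proof.
apply/eqP; rewrite -(@eqrXn2 _ 2) ?hnorm_ge0 // !hsum_norm; apply/eqP.
by apply: eq_bigr => i _; rewrite ffunE coord_embed_norm.
Qed.

(** Where the hypothesis on the two norms is used: it bounds the represented
    element by the spatial norm. *)
Lemma min_positive_representation n (X : 'M[tensor (H -> H) (K -> K)]_n) :
  alg_min_eq_max (Ualg S) D -> entries_in (tensor_in S D) X ->
  min_positive S D X -> positive_op (op_mx (map_mx (dot_map sigma pi) X)).
Proof.
move=> /alg_min_eq_max_norm[HK maxmin] SDX X0.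
have [C hC] := nilp_lift_min_norm HK S_system D_system SDX X0.
apply: (@positive_of_shifts _ _ _ (C ^+ 2)) => z z0 w.
have c0 : 0 <= cnorm z ^+ 2 + C ^+ 2 by rewrite addr_ge0 ?sqr_ge0.
pose T := op_mx (map_mx (dot_map (tri_rep sigma) rho) (nilp_lift z X)).
have USX : entries_in (tensor_in (Ualg S) D) (nilp_lift z X) by exact: nilp_lift_in.
have Tl : linear T.
  apply/bounded_lin/op_mx_bounded => i j; rewrite map_mx_entry.
  apply: (tensor_eval_bounded (USX i j)) => a e Ua De; apply: bounded_comp.
    exact: (ccr_bounded (tri_rep_cc S_system sigma_ucp)).
  exact: (ccr_bounded rho_cc).
have Tle : (opnorm T <= (Num.sqrt (cnorm z ^+ 2 + C ^+ 2))%:E)%E.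
  apply: le_trans (hC z z0); rewrite -maxmin //.
  by apply: max_norm_ge; [exact: tri_rep_cc|exact: rho_cc|exact: tri_rep_comm].
have := opnorm_bound Tl Tle [ffun i => coord_embed ord_max ((w : {ffun _ -> M}) i)].
rewrite /T nilp_lift_rep // !embed_family_norm => h.
rewrite -(sqr_sqrtr c0) -exprMn ler_pXn2r ?nnegrE ?mulr_ge0 ?hnorm_ge0 ?sqrtr_ge0 //.
Qed.

End Representation.

Lemma min_positive_c_positive n (X : 'M[tensor (H -> H) (K -> K)]_n) :
  alg_min_eq_max (Ualg S) D -> entries_in (tensor_in S D) X ->
  min_positive S D X -> c_positive S D X.
Proof.
move=> UD SDX X0 L phi psi phi_ucp psi_ucp phi_psi v.
have [M [sigma [pi [V [sigma_ucp pi_ucp sigma_pi pi_mul dil]]]]] :=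
  commuting_dilation S_system D_system D_mul phi_ucp psi_ucp phi_psi.
have := min_positive_representation sigma_ucp pi_ucp sigma_pi pi_mul UD SDX X0
  [ffun i => V ((v : {ffun _ -> L}) i)].
rewrite !op_mx_ip; congr (0 <= _); apply: eq_bigr => i _; apply: eq_bigr => j _.
rewrite !map_mx_entry !ffunE /dot_map !tensor_evalE !ip_suml.
by apply: eq_big_seq => p /SDX[Sp Dp]; exact: dil.
Qed.

End MinimalToCommuting.

(** * From commuting to minimal positivity *)

Section Scalars.
Variable R : realType.

Definition scalar_ip (a b : R[i]^o) : R[i] := a * Num.conj b.

Fact scalar_ip_bilinear :
  bilinear_for ( *%R : GRing.Scale.law R[i] R[i])
    (Num.conj \; *%R : GRing.Scale.law R[i] R[i]) scalar_ip.
Proof.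
split=> [b c a a'|a c b b'] /=; rewrite /scalar_ip.
  by rewrite mulrDl -mulrA.
by rewrite rmorphD rmorphM mulrDr /=; congr (_ + _); rewrite mulrCA.
Qed.

HB.instance Definition _ :=
  bilinear_isBilinear.Build R[i] R[i]^o R[i]^o R[i]
    *%R (Num.conj \; *%R) scalar_ip scalar_ip_bilinear.

Fact scalar_ip_hermitian a b : scalar_ip a b = (-1) ^+ false * Num.conj (scalar_ip b a).
Proof. by rewrite expr0 mul1r /scalar_ip rmorphM /= conjCK mulrC. Qed.

HB.instance Definition _ :=
  isHermitianSesquilinear.Build R[i] R[i]^o false Num.conj
    scalar_ip scalar_ip_hermitian.

Fact scalar_ip_gt0 (a : R[i]^o) : a != 0 -> 0 < scalar_ip a a.
Proof. by move=> a0; rewrite /scalar_ip -normCK exprn_gt0 // normr_gt0. Qed.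

HB.instance Definition _ :=
  isDotProduct.Build R[i] R[i]^o scalar_ip scalar_ip_gt0.

Fact scalar_norm (a : R[i]^o) : dot_norm scalar_ip a = cnorm a.
Proof.
rewrite /dot_norm -[RHS]ger0_norm ?cnorm_ge0 // -sqrtr_sqr; congr Num.sqrt.
by rewrite /= /scalar_ip cnorm_sqr !ReImE; ring.
Qed.

Fact scalar_complete : complete_for (dot_norm scalar_ip).
Proof.
have -> : dot_norm scalar_ip = @cnorm R by apply/funext; exact: scalar_norm.
exact: complex_complete.
Qed.

Definition scalar_hilbert : hilbert R := Hilbert scalar_complete.

End Scalars.

Section ScalarMatrices.
Variables (R : realType) (L : hilbert R).

(** The operator [A (x) 1] on the [m]-fold sum of a Hilbert space. *)
Definition mx_ampl m (A : 'M[R[i]]_m) : hsum m L -> hsum m L :=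
  op_mx (map_mx (fun c => c *: (idfun : L -> L)) A).

Lemma mx_amplE m (A : 'M[R[i]]_m) (v : {ffun 'I_m -> L}) b :
  (mx_ampl A v : {ffun 'I_m -> L}) b = \sum_b' A b b' *: v b'.
Proof. by rewrite op_mxE; apply: eq_bigr => b' _; rewrite mxE. Qed.

Lemma mx_ampl_bounded m (A : 'M[R[i]]_m) : bounded_op (mx_ampl A).
Proof. by apply: op_mx_bounded => b b'; rewrite mxE; exact/bounded_scale/bounded_id. Qed.

(** Expanding the entries of a vector in an orthonormal family of [L] writes
    the form as a sum of forms of the scalar matrix, one for each member of the
    family. *)
Lemma mx_ampl_ucp (K : hilbert R) (D : set (K -> K)) m (psi : (K -> K) -> 'M[R[i]]_m) :
  ucp_mx D psi -> ucp D (fun d => mx_ampl (psi d)).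
Proof.
move=> psi_ucp; split.
- by move=> d _; exact: mx_ampl_bounded.
- move=> c x y Dx Dy; rewrite (ucpm_linear psi_ucp) //.
  apply/funext => v; apply/ffunP => b.
  have -> : (c *: mx_ampl (psi x) + mx_ampl (psi y)) v
      = c *: mx_ampl (psi x) v + mx_ampl (psi y) v by [].
  rewrite mx_amplE !ffunE scaler_sumr -big_split; apply: eq_bigr => b' _ /=.
  by rewrite !mxE scalerDl !scalerA.
- rewrite (ucpm_unital psi_ucp); apply/funext => v; apply/ffunP => b.
  rewrite mx_amplE (bigD1 b) //= big1 ?addr0 => [|b' bb'].
    by rewrite mxE eqxx scale1r.
  by rewrite mxE eq_sym (negPf bb') scale0r.
move=> n X DX X0 v.
pose w i : 'I_m -> L := fun b => ((v : {ffun 'I_n -> hsum m L}) i : {ffun _ -> L}) b.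
have [q [e [e_on e_span]]] := orthonormal_spanning [seq w i b | i <- enum 'I_n, b <- enum 'I_m].
have /choice[c hc] ib : exists c : 'I_q -> R[i], w ib.1 ib.2 = \sum_a c a *: e a.
  by apply: e_span; apply/allpairsPdep; exists ib.1, ib.2; rewrite !mem_enum.
pose u a i : 'cV[R[i]]_m := \col_b c (i, b) a.
have : 0 <= \sum_a (\sum_i \sum_j
    (map_mx Num.conj (u a i))^T *m map_mx psi X i j *m u a j) ord0 ord0.
  by apply: sumr_ge0 => a _; exact: (ucpm_positive psi_ucp DX X0).
rewrite op_mx_ip; congr (0 <= _).
under eq_bigr => a _ do rewrite summxE.
rewrite exchange_big; apply: eq_bigr => i _ /=.
under eq_bigr => a _ do rewrite summxE.
rewrite exchange_big; apply: eq_bigr => j _ /=.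
rewrite !map_mx_entry hsum_ipE.
under [RHS]eq_bigr => b _ do rewrite mx_amplE ip_suml.
under eq_bigr => a _ do rewrite mxE.
rewrite exchange_big [RHS]exchange_big; apply: eq_bigr => b' _ /=.
under eq_bigr => a _ do rewrite !mxE mulr_suml.
rewrite exchange_big; apply: eq_bigr => b _ /=.
rewrite ipZl -/(w j b') -/(w i b) (hc (j, b')) (hc (i, b)).
rewrite ip_suml mulr_sumr; apply: eq_bigr => a _.
rewrite ip_sumr (bigD1 a) //= big1 => [|a' a'a].
  have e1 : ip L (e a) (e a) = 1 by rewrite e_on eqxx.
  by rewrite !mxE ipZl ipZr e1; ring.
by rewrite ipZl ipZr e_on eq_sym (negPf a'a) !mulr0.
Qed.

End ScalarMatrices.

Section CommutingToMinimal.
Variables (R : realType) (H K : hilbert R) (S : set (H -> H)) (D : set (K -> K)).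

(** The two legs are realized on the [k]-fold sum of the [m]-fold sum of C: the
    first map acts on the outer index and the second one on the inner index. *)
Lemma c_positive_min_positive n (X : 'M[tensor (H -> H) (K -> K)]_n) :
  c_positive S D X -> min_positive S D X.
Proof.
move=> X0 k m phi psi phi_ucp psi_ucp v.
pose C1 := scalar_hilbert R.
pose phi' s := mx_ampl (L := hsum m C1) (phi s).
pose psi' d := ampl k (mx_ampl (L := C1) (psi d)).
have phi'_ucp : ucp S phi' by exact: mx_ampl_ucp.
have psi'_ucp : ucp D psi' by exact/ampl_ucp/mx_ampl_ucp.
have comm : commuting_ranges S D phi' psi'.
  move=> s d _ _; apply: op_mx_ampl_comm => [|i j].
    exact/bounded_lin/mx_ampl_bounded.
  rewrite mxE; apply/funext => x.
  by rewrite /= -[RHS]/(mx_ampl _ (_ *: x)) (linZ (bounded_lin (mx_ampl_bounded _ _))).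
pose x i : {ffun 'I_k -> hsum m C1} :=
  [ffun a => [ffun b => v i (mxtens_index (a, b)) ord0]].
have xE i : ([ffun i => x i] : {ffun 'I_n -> hsum k (hsum m C1)}) i = x i by rewrite ffunE.
have := X0 _ phi' psi' phi'_ucp psi'_ucp comm [ffun i => x i].
rewrite op_mx_ip; congr (0 <= _); symmetry.
rewrite summxE; apply: eq_bigr => i _; rewrite summxE; apply: eq_bigr => j _.
rewrite !map_mx_entry /dot_map tensor_evalE ip_suml /tensor_eval mulmx_sumr mulmx_suml summxE.
apply: eq_bigr => p _; rewrite mxE mxtens_sum.
rewrite !xE hsum_ipE; under [RHS]eq_bigr => a _ do rewrite hsum_ipE.
have E a b : ((phi' p.1 (psi' p.2 (x j)) : {ffun _ -> hsum m C1}) a : {ffun _ -> C1}) b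
    = \sum_a' \sum_b' phi p.1 a a' * (psi p.2 b b' * v j (mxtens_index (a', b')) ord0).
  rewrite mx_amplE sum_ffunE; apply: eq_bigr => a' _.
  rewrite !ffunE scaler_sumr; apply: eq_bigr => b' _.
  by rewrite !mxE !ffunE.
transitivity (\sum_a \sum_b \sum_a' \sum_b' Num.conj (v i (mxtens_index (a, b)) ord0)
    * (phi p.1 a a' * psi p.2 b b') * v j (mxtens_index (a', b')) ord0); last first.
  apply: eq_bigr => a _; apply: eq_bigr => b _.
  rewrite -[RHS]/(((phi' p.1 (psi' p.2 (x j)) : {ffun _ -> hsum m C1}) a : {ffun _ -> C1}) b
                  * Num.conj ((x i a : {ffun _ -> C1}) b)).
  rewrite E !ffunE mulr_suml; apply: eq_bigr => a' _.
  by rewrite mulr_suml; apply: eq_bigr => b' _; ring.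
under [RHS]eq_bigr => a _ do rewrite exchange_big.
rewrite [RHS]exchange_big; apply: eq_bigr => a' _ /=.
under [RHS]eq_bigr => a _ do rewrite exchange_big.
rewrite [RHS]exchange_big; apply: eq_bigr => b' _ /=.
rewrite mxE mxtens_sum mulr_suml; apply: eq_bigr => a _.
rewrite mulr_suml; apply: eq_bigr => b _.
by rewrite tensmxE !mxE.
Qed.

End CommutingToMinimal.

(** * Comparison of the tensor products *)

Lemma unital_cstar_system (R : realType) (K : hilbert R) (D : set (K -> K)) :
  unital_cstar_algebra D -> operator_system D.
Proof. by move=> [[Db Ds _ Da _] D1]. Qed.

Theorem lemma5p2 (R : realType) (H : hilbert R) (S : set (H -> H))
    (hS : operator_system S) :
  (forall (K : hilbert R) (D : set (K -> K)), unital_cstar_algebra D ->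
     alg_min_eq_max (Ualg S) D -> sys_min_eq_c S D) /\
  (system_nuclearity_detector S -> algebra_nuclearity_detector (Ualg S)).
Proof.
have min_eq_c (K : hilbert R) (D : set (K -> K)) : unital_cstar_algebra D ->
    alg_min_eq_max (Ualg S) D -> sys_min_eq_c S D.
  move=> hD UD n X SDX; have D_system := unital_cstar_system hD.
  split; last exact: c_positive_min_positive.
  by apply: min_positive_c_positive => //; case: hD => -[].
split=> // detects K D hD UD.
exact: detects (min_eq_c _ _ hD UD).
Qed.
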